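(* Let $p\in(0,\infty)$. For every convex body $K\subset\mathbb{R}^2$, $$\inf_{x\in\Delta_{2,0}}\mathcal{M}_p(\Delta_{2,0}-x)\ \leq\ \mathcal{M}_p(K).$$
   Context: A convex body in $\mathbb{R}^n$ is a compact convex set with nonempty interior; $|K|$ is Lebesgue measure. $\Delta_{2,0}\subset\mathbb{R}^2$ is the triangle with vertices $e_1=(1,0)$, $e_2=(0,1)$, $-e_1-e_2=(-1,-1)$. For $p\in(0,\infty)$ the $L^p$-support function of $K$ is $h_{p,K}(y)=\frac1p\log\left(\int_K e^{p\langle x,y\rangle}\frac{dx}{|K|}\right)$, $y\in\mathbb{R}^n$, and the $L^p$-Mahler volume is $\mathcal{M}_p(K)=|K|\int_{\mathbb{R}^n}e^{-h_{p,K}(y)}\,dy\in(0,\infty]$. *)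

(* Defs.v *)
From mathcomp Require Import all_boot all_order all_algebra.
From mathcomp Require Import all_classical all_reals all_analysis.
From mathcomp Require Import measurable_realfun.

Set Implicit Arguments.
Unset Strict Implicit.
Unset Printing Implicit Defensive.

Import Order.TTheory GRing.Theory Num.Theory.
Import numFieldNormedType.Exports.

Local Open Scope classical_set_scope.
Local Open Scope ring_scope.

(* R^2 is R * R with the product topology and product Lebesgue measure. *)

Definition lebesgue2 (R : realType) :
    {measure set (measurableTypeR R * measurableTypeR R)%type -> \bar R} :=
  (@lebesgue_measure R \x @lebesgue_measure R)%E.

Definition dot (R : realType) (x y : R * R) : R := x.1 * y.1 + x.2 * y.2.

(* R^o carries the R-module structure on R that convex_set requires. *)
Definition convex_body (R : realType) (K : set (R * R)) : Prop :=
  [/\ compact K, convex_set (K : set (R^o * R^o)%type) & K° !=set0].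

(* The L^p-support function h_{p,K}. For a convex body K and p > 0, both |K|
   and the integral are finite and positive, so that taking the real-valued
   integral, fine, the division and ln is harmless. *)
Definition Lp_support (R : realType) (p : R) (K : set (R * R)) (y : R * R) :
    R :=
  p^-1 * ln (\int[lebesgue2 R]_(x in K)
               (expR (p * dot x y) / fine (lebesgue2 R K))).

Definition Lp_mahler (R : realType) (p : R) (K : set (R * R)) : \bar R :=
  (lebesgue2 R K * \int[lebesgue2 R]_y (expR (- Lp_support p K y))%:E)%E.

Definition triangle (R : realType) (a b c : R * R) : set (R * R) :=
  [set z | exists s t u : R,
     [/\ 0 <= s, 0 <= t, 0 <= u, s + t + u = 1 &
         z = (s * a.1 + t * b.1 + u * c.1, s * a.2 + t * b.2 + u * c.2)]].

Definition Delta20 (R : realType) : set (R * R) :=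
  triangle (1, 0) (0, 1) (-1, -1).
Arguments Delta20 : clear implicits.

Definition shift_by_opp (R : realType) (K : set (R * R)) (x : R * R) :
    set (R * R) :=
  [set z - x | z in K].

(* Main.v *)
Require Import Defs.
From HB Require Import structures.
From mathcomp Require Import all_boot all_order all_algebra.
From mathcomp Require Import all_classical all_reals all_analysis.
From mathcomp Require Import measurable_realfun.
From mathcomp Require Import ring lra.

(** The proof works with the functional |K| ^ (1 + 1/p) N(K), where N(K) is the
    integral over y of (\int_K exp (p <x, y>) dx) ^ (-1/p); it equals the L^p-Mahler
    volume. A translation of K changes N(K); the lower bound B, the Mahler volume of
    the triangle Delta20, is proved for all translates of polygons, a property
    invariant under affine maps ([translated_mahler_affine]).

    The triangle itself has an affine symmetry of order three fixing the origin.
    Averaging the integrand over this symmetry shows that the origin minimises the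
    Mahler volume among its translates ([Lp_mahler_symmetric_min]).

    Polygons reduce to triangles by the shadow systems of Rogers and Shephard. If
    v is a vertex of a polygon with neighbours a and b, let v move parallel to ab
    and carry the triangle vab along by shears. The area is constant, and the
    motion can be continued in both directions until a or b stops being a
    vertex. The bound for the two extreme polygons, which have fewer vertices,
    implies it for the given one ([shear_step], [shear_until_collinear],
    [above_triangle_hull]).

    This rests on the quasi-concavity of N in time, once it is minimised over
    horizontal translations ([shadow_quasiconcave]). N is the sum of the integrals
    over the two half-planes y.1 > 0 and y.1 < 0. In the projective coordinates
    u = 1 / y.1, v = y.2 / y.1, the integrand over a half-plane, to the power -1/3,
    is a convex function of u, v and the horizontal coordinate function xi on K
    jointly ([projective_density_concave]). The Borell-Brascamp-Lieb inequality on
    the line lowers the exponent by one at each integration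
    ([borell_brascamp_lieb]), so that the inverse of each half-plane integral is
    convex in xi ([half_integral_inv_convex]). One half-plane integral decreases
    under translations to the right and the other increases, which lets the
    separate convexity of the two inverses be turned into a statement about the
    minimum over translations of the sum ([balanced_quasiconcave]).

    Finally a convex body K lies in a polygon P that lies in a dilated copy of K by
    a ratio close to 1 ([outer_polygon]). Since N decreases under inclusion, the
    Mahler volume of P exceeds that of K at most by a factor close to 1
    ([Lp_mahler_outer]). The infimum of the statement is at most its value at the
    origin, which is B. *)

Import Order.TTheory GRing.Theory Num.Theory.
Import numFieldNormedType.Exports.

Set Implicit Arguments.
Unset Strict Implicit.
Unset Printing Implicit Defensive.

Local Open Scope classical_set_scope.
Local Open Scope ring_scope.

(** * Prekopa-Leindler inequality on the line *)

Lemma measure_le d (T : measurableType d) (R : realType)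
    (m : {measure set T -> \bar R}) (A B : set T) :
  measurable A -> measurable B -> A `<=` B -> (m A <= m B)%E.
Proof. by move=> mA mB; apply: le_measure; rewrite inE. Qed.

Section one_dim.
Context {R : realType}.
Local Notation mu := (@lebesgue_measure R).

Lemma lebesgue_le_diam (A : set (measurableTypeR R)) (M : R) :
  measurable A -> 0 <= M -> (forall x y, A x -> A y -> y - x <= M) ->
  (mu A <= M%:E)%E.
Proof.
move=> mA M0 AM.
have [->|/set0P[a Aa]] := eqVneq A set0; first by rewrite measure0 lee_fin.
have supA : has_sup A.
  by split; [exists a|exists (a + M) => y Ay; have := AM _ _ Aa Ay; lra].
have infA : has_inf A.
  by split; [exists a|exists (a - M) => y Ay; have := AM _ _ Ay Aa; lra].
have dM : sup A - inf A <= M.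
  rewrite lerBlDr; apply: ge_sup; first by exists a.
  move=> y Ay; rewrite -lerBlDl; apply: lb_le_inf; first by exists a.
  by move=> x Ax; have := AM _ _ Ax Ay; lra.
apply: (@le_trans _ _ (mu `[inf A, sup A])).
  apply: measure_le => // y Ay /=; rewrite in_itv/=; apply/andP; split.
    by apply: ge_inf => //; case: infA.
  by apply: ub_le_sup => //; case: supA.
rewrite lebesgue_measure_itv/= lte_fin; case: ifPn => _; last by rewrite lee_fin.
by rewrite -EFinB lee_fin.
Qed.

Definition convex1 (A : set R) := forall x y l, A x -> A y -> 0 <= l <= 1 ->
  A ((1 - l) * x + l * y).

(** For a1 <= a2 in A and b1 <= b2 in B, the whole segment between the two
    combinations lies in C, since A and B are convex. Its length is the
    combination of a2 - a1 and b2 - b1, and these differences approximate the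
    measures of A and B. *)
Lemma brunn_minkowski_convex1 (A B C : set (measurableTypeR R)) (l : R) :
  measurable A -> measurable B -> measurable C -> 0 < l < 1 ->
  A !=set0 -> B !=set0 -> convex1 A -> convex1 B ->
  (forall x y, A x -> B y -> C ((1 - l) * x + l * y)) ->
  ((1 - l)%:E * mu A + l%:E * mu B <= mu C)%E.
Proof.
move=> mA mB mC /andP[l0 l1] [a Aa] [b Bb] cA cB ABC.
have [->|Cy] := eqVneq (mu C) +oo%E; first by rewrite leey.
have Cfin : mu C \is a fin_num by rewrite ge0_fin_numE ?ltey.
set c := fine (mu C).
have Cc : mu C = c%:E by rewrite fineK.
have k0 : 0 < 1 - l by lra.
have c0 : 0 <= c by rewrite /c fine_ge0.
have key a1 a2 b1 b2 : A a1 -> A a2 -> B b1 -> B b2 -> a1 <= a2 -> b1 <= b2 ->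
    (1 - l) * (a2 - a1) + l * (b2 - b1) <= c.
  move=> A1 A2 B1 B2 a12 b12.
  set s := (1 - l) * a1 + l * b1; set t := (1 - l) * a2 + l * b2.
  have -> : (1 - l) * (a2 - a1) + l * (b2 - b1) = t - s by rewrite /s /t; ring.
  have st : s <= t by rewrite /s /t; nra.
  rewrite -lee_fin -Cc.
  have [ts|] := ltP s t; last by move=> h; rewrite (@le_trans _ _ 0%E)// lee_fin; lra.
  apply: (@le_trans _ _ (mu `[s, t])).
    by rewrite lebesgue_measure_itv/= lte_fin ts -EFinB.
  apply: measure_le => // z /=; rewrite in_itv/= => /andP[sz zt].
  pose q := (z - s) / (t - s).
  have q01 : 0 <= q <= 1.
    by rewrite /q divr_ge0/= ?subr_ge0// ler_pdivrMr ?subr_gt0// mul1r; lra.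
  have -> : z = (1 - l) * ((1 - q) * a1 + q * a2) + l * ((1 - q) * b1 + q * b2).
    have -> : (1 - l) * ((1 - q) * a1 + q * a2) + l * ((1 - q) * b1 + q * b2)
       = s + q * (t - s) by rewrite /s /t; ring.
    by rewrite /q divfK; [ring|rewrite subr_eq0 gt_eqF].
  by apply: ABC; [exact: cA|exact: cB].
have key' a1 a2 b1 b2 : A a1 -> A a2 -> B b1 -> B b2 -> b1 <= b2 ->
    (1 - l) * (a2 - a1) + l * (b2 - b1) <= c.
  move=> A1 A2 B1 B2 b12; have [?|a21] := leP a1 a2; first exact: key.
  by have := key _ _ _ _ A1 A1 B1 B2 (lexx _) b12; nra.
have HA b1 b2 : B b1 -> B b2 -> b1 <= b2 ->
    (mu A <= ((c - l * (b2 - b1)) / (1 - l))%:E)%E.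
  move=> B1 B2 b12; apply: lebesgue_le_diam => //.
    apply: divr_ge0; last lra.
    by have := key' _ _ _ _ Aa Aa B1 B2 b12; lra.
  move=> x y Ax Ay; rewrite ler_pdivlMr//.
  by have := key' _ _ _ _ Ax Ay B1 B2 b12; lra.
have Afin : mu A \is a fin_num.
  by rewrite ge0_fin_numE// (le_lt_trans (HA _ _ Bb Bb (lexx _)))// ltry.
have Aa' := fineK Afin; set al := fine (mu A) in Aa'; rewrite -Aa'.
have HB : (mu B <= ((c - (1 - l) * al) / l)%:E)%E.
  have HA' b1 b2 : B b1 -> B b2 -> b1 <= b2 -> l * (b2 - b1) <= c - (1 - l) * al.
    move=> B1 B2 b12; have := HA _ _ B1 B2 b12; rewrite -Aa' lee_fin ler_pdivlMr//.
    by lra.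
  have h0 : 0 <= c - (1 - l) * al by have := HA' _ _ Bb Bb (lexx _); lra.
  apply: lebesgue_le_diam => //; first by apply: divr_ge0; lra.
  move=> x y Bx By; rewrite ler_pdivlMr//.
  have [xy|yx] := leP x y; first by have := HA' _ _ Bx By xy; lra.
  by nra.
have Bfin : mu B \is a fin_num by rewrite ge0_fin_numE// (le_lt_trans HB)// ltry.
rewrite -(fineK Bfin) lee_fin ler_pdivlMr// in HB.
by rewrite Cc -(fineK Bfin) -!EFinM -EFinD lee_fin; lra.
Qed.

(** The strict inequality 0 < s keeps the subgraph, and thus the level sets below,
    empty at negative heights. *)
Let subgraph (f : R -> R) : set (measurableTypeR R * measurableTypeR R) :=
  [set z | 0 < z.2 < f z.1].

Let measurable_subgraph (f : R -> R) : measurable_fun setT f ->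
  measurable (subgraph f).
Proof.
move=> mf.
have m2 : measurable_fun [set: measurableTypeR R * measurableTypeR R] snd.
  exact: measurable_snd.
have m1 : measurable_fun [set: measurableTypeR R * measurableTypeR R] (f \o fst).
  by apply: measurableT_comp => //; exact: measurable_fst.
have h1 := @measurable_fun_ltr _ _ R setT _ _ (measurable_cst (0 : R)) m2.
have h2 := @measurable_fun_ltr _ _ R setT _ _ m2 m1.
have -> : subgraph f = (setT `&` (fun z : R * R => 0 < z.2) @^-1` [set true])
    `&` (setT `&` (fun z : R * R => z.2 < f z.1) @^-1` [set true]).
  apply/seteqP; split => z; rewrite /subgraph /=; first by move=> /andP[].
  by move=> [[_ ->] [_ ->]].
by apply: measurableI; [exact: (h1 measurableT)|exact: (h2 measurableT)].
Qed.

Let subgraph_ysection (f : R -> R) (s : R) :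
  ysection (subgraph f) s = [set x | 0 < s < f x].
Proof. by apply/seteqP; split => x; rewrite /ysection /= inE. Qed.

Lemma measurable_layer (f : R -> R) : measurable_fun setT f ->
  measurable_fun setT (fun s : R => mu [set x | 0 < s < f x]).
Proof.
move=> mf; have /= := measurable_fun_ysection mu (measurable_subgraph mf).
by under [X in measurable_fun _ X]eq_fun do rewrite subgraph_ysection.
Qed.

Lemma layer_cake (f : R -> R) : measurable_fun setT f -> (forall x, 0 <= f x) ->
  (\int[mu]_x (f x)%:E = \int[mu]_s mu [set x | (0 < s < f x)%R])%E.
Proof.
move=> mf f0; have mD := measurable_subgraph mf.
have := @indic_fubini_tonelli _ _ _ _ R mu mu _ mD.
rewrite indic_fubini_tonelli_FE// indic_fubini_tonelli_GE// => H.
transitivity (\int[mu]_x (mu \o xsection (subgraph f)) x)%E.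
  apply: eq_integral => x _ /=.
  have -> : xsection (subgraph f) x = `]0, f x[%classic.
    by apply/seteqP; split => s; rewrite /xsection /= inE /subgraph /= in_itv/=.
  rewrite lebesgue_measure_itv/= lte_fin; case: ltP; first by rewrite oppr0 adde0.
  by move=> h; congr (_%:E); apply/eqP; rewrite eq_le h f0.
by rewrite H; apply: eq_integral => s _ /=; rewrite subgraph_ysection.
Qed.

Lemma measurable_super_level (f : R -> R) (s : R) : measurable_fun setT f ->
  measurable ([set x | 0 < s < f x] : set (measurableTypeR R)).
Proof.
move=> mf; rewrite -subgraph_ysection.
exact: (measurable_ysection s (measurable_subgraph mf)).
Qed.

(** When both functions have supremum 1, their level sets at every height between
    0 and 1 are nonempty, so that the Brunn-Minkowski inequality on the line holds
    height by height and integrates to an additive inequality. *)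
Lemma prekopa_leindler_sup (f g h : R -> R) (l : R) : 0 < l < 1 ->
  measurable_fun setT f -> measurable_fun setT g -> measurable_fun setT h ->
  (forall x, 0 <= f x <= 1) -> (forall x, 0 <= g x <= 1) -> (forall x, 0 <= h x) ->
  (forall s, s < 1 -> exists x, s < f x) -> (forall s, s < 1 -> exists x, s < g x) ->
  (forall s, 0 < s -> convex1 [set x | s < f x]) ->
  (forall s, 0 < s -> convex1 [set x | s < g x]) ->
  (forall x y, Num.min (f x) (g y) <= h ((1 - l) * x + l * y)) ->
  ((1 - l)%:E * \int[mu]_x (f x)%:E + l%:E * \int[mu]_x (g x)%:E
    <= \int[mu]_x (h x)%:E)%E.
Proof.
move=> l01 mf mg mh f01 g01 h0 supf supg cf cg fgh.
have /andP[l0 l1] := l01.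
have k0 : 0 < 1 - l by lra.
have f0 x : 0 <= f x by case/andP: (f01 x).
have g0 x : 0 <= g x by case/andP: (g01 x).
have mLf := measurable_layer mf.
have mLg := measurable_layer mg.
have mLh := measurable_layer mh.
rewrite !layer_cake// -!ge0_integralZl//; try exact: ltW.
rewrite -ge0_integralD//; last first.
- by apply: emeasurable_funM.
- by move=> s _; rewrite mule_ge0// lee_fin ltW.
- by apply: emeasurable_funM.
- by move=> s _; rewrite mule_ge0// lee_fin ltW.
apply: ge0_le_integral => //.
- by move=> s _; rewrite adde_ge0// mule_ge0// lee_fin ltW.
- by apply: emeasurable_funD; apply: emeasurable_funM.
move=> s _.
have [s0|] := boolP (s <= 0).
  have e (u : R -> R) : [set x | 0 < s < u x] = set0.
    by apply/seteqP; split => x //= /andP[]; rewrite ltNge s0.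
  by rewrite !e measure0 !mule0 adde0.
rewrite -ltNge => s0; have [s1|s1] := leP 1 s.
  have e (u : R -> R) : (forall x, 0 <= u x <= 1) -> [set x | 0 < s < u x] = set0.
    move=> u01; apply/seteqP; split => x //= /andP[_ sx].
    by have /andP[_ ux] := u01 x; move: (lt_le_trans sx ux); rewrite ltNge s1.
  by rewrite (e f f01) (e g g01) measure0 !mule0 adde0.
have e (u : R -> R) : [set x | 0 < s < u x] = [set x | s < u x].
  by apply/seteqP; split => x /=; rewrite s0.
apply: brunn_minkowski_convex1 => //.
- exact: measurable_super_level.
- exact: measurable_super_level.
- exact: measurable_super_level.
- by rewrite e; exact: supf.
- by rewrite e; exact: supg.
- by rewrite e; exact: cf.
- by rewrite e; exact: cg.
move=> x y /=; rewrite s0/= => fx gy; apply: lt_le_trans (fgh x y).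
by rewrite lt_min fx.
Qed.

End one_dim.

(** * Borell-Brascamp-Lieb inequality *)

Lemma inv_pow_surj {R : realType} (n : nat) (a : R) : 0 < a ->
  exists2 x, 0 < x & x ^- n.+1 = a.
Proof.
move=> a0; exists (a `^ (- (n.+1%:R)^-1)); first exact: powR_gt0.
rewrite -powR_invn ?powR_ge0// -powRrM mulrNN mulVf ?pnatr_eq0// powRr1//.
exact: ltW.
Qed.

(** The graph of w |-> w ^ (n + 1) lies above its tangent at z. *)
Lemma bernoulli_homogeneous {R : realType} (n : nat) (w z : R) :
  0 <= w -> 0 <= z -> n.+1%:R * z ^+ n * w - n%:R * z ^+ n.+1 <= w ^+ n.+1.
Proof.
move=> w0 z0; elim: n => [|n IH].
  by rewrite mul0r subr0 expr0 mulr1 mul1r expr1.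
rewrite [w ^+ n.+2]exprS.
have := ler_wpM2l w0 IH; apply: le_trans.
have zn : 0 <= z ^+ n by exact: exprn_ge0.
have h : 0 <= n.+1%:R * z ^+ n * (w - z) ^+ 2.
  by rewrite mulr_ge0 ?sqr_ge0// mulr_ge0.
rewrite -subr_ge0; apply: le_trans h _; rewrite le_eqVlt; apply/orP; left.
rewrite !exprS expr0 -!natr1; apply/eqP; ring.
Qed.

(** The function x ^ (n + 1) / a ^ n is the supremum over z of the linear functions
    (n + 1) z ^ n x - n z ^ (n + 1) a, by the tangent inequality at x / a; the
    supremum is attained at z = x / a. *)
Lemma perspective_pow_convex {R : realType} (n : nat) (l x y a b : R) :
  0 <= l <= 1 -> 0 < x -> 0 < y -> 0 < a -> 0 < b ->
  ((1 - l) * x + l * y) ^+ n.+1 / ((1 - l) * a + l * b) ^+ n <=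
  (1 - l) * (x ^+ n.+1 / a ^+ n) + l * (y ^+ n.+1 / b ^+ n).
Proof.
move=> /andP[l0 l1] x0 y0 a0 b0.
set X := (1 - l) * x + l * y; set A := (1 - l) * a + l * b.
have A0 : 0 < A by rewrite /A; nra.
have X0 : 0 < X by rewrite /X; nra.
pose z := X / A; have z0 : 0 <= z by rewrite divr_ge0// ltW.
have tang u v : 0 < u -> 0 < v ->
    n.+1%:R * z ^+ n * u - n%:R * z ^+ n.+1 * v <= u ^+ n.+1 / v ^+ n.
  move=> u0 v0; have uv : 0 <= u / v by rewrite divr_ge0// ltW.
  have := ler_wpM2l (ltW v0) (bernoulli_homogeneous n uv z0).
  have v1 : v != 0 by rewrite gt_eqF.
  have -> : v * (n.+1%:R * z ^+ n * (u / v) - n%:R * z ^+ n.+1) =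
      n.+1%:R * z ^+ n * u - n%:R * z ^+ n.+1 * v by field.
  have -> // : v * (u / v) ^+ n.+1 = u ^+ n.+1 / v ^+ n.
  by rewrite expr_div_n [v ^+ n.+1]exprS invfM mulrCA [v * _]mulrA divff// mul1r.
have E : X ^+ n.+1 / A ^+ n = n.+1%:R * z ^+ n * X - n%:R * z ^+ n.+1 * A.
  have A1 : A != 0 by rewrite gt_eqF.
  rewrite /z !expr_div_n !exprS -natr1.
  by field; rewrite expf_neq0.
rewrite E.
have -> : n.+1%:R * z ^+ n * X - n%:R * z ^+ n.+1 * A =
  (1 - l) * (n.+1%:R * z ^+ n * x - n%:R * z ^+ n.+1 * a) +
  l * (n.+1%:R * z ^+ n * y - n%:R * z ^+ n.+1 * b) by rewrite /X /A; ring.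
by apply: lerD; apply: ler_wpM2l; rewrite ?subr_ge0//; apply: tang.
Qed.

Section borell_brascamp_lieb.
Context {R : realType}.
Local Notation mu := (@lebesgue_measure R).

(** The inequality h ^ (-1/n) <= (1 - l) f ^ (-1/n) + l g ^ (-1/n) between the
    values at a convex combination and at its ends, written without roots so that
    it makes sense when some of the values are 0 or +oo. *)
Definition inv_pow_concave (n : nat) (l : R) (f g h : R -> \bar R) :=
  forall x y a b, 0 < a -> 0 < b ->
  ((a ^- n)%:E <= f x)%E -> ((b ^- n)%:E <= g y)%E ->
  ((((1 - l) * a + l * b) ^- n)%:E <= h ((1 - l) * x + l * y)%R)%E.

Let trunc (N : R) (f : R -> \bar R) (x : R) : R := fine (mine (f x) N%:E).

Let truncE N f x : 0 <= N -> (forall x, 0 <= f x)%E ->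
  (trunc N f x)%:E = mine (f x) N%:E.
Proof.
move=> N0 f0; rewrite /trunc fineK// ge0_fin_numE; last by rewrite le_min f0 lee_fin.
by rewrite gt_min ltry orbT.
Qed.

Let measurable_trunc N f : measurable_fun setT f -> measurable_fun setT (trunc N f).
Proof.
move=> mf; apply: (@measurableT_comp _ _ _ _ _ _ fine); first by [].
by apply: measurable_mine => //; exact: measurable_cst.
Qed.

Lemma integral_trunc_lb (f : R -> \bar R) (r : R) :
  measurable_fun setT f -> (forall x, 0 <= f x)%E -> (r%:E < \int[mu]_x f x)%E ->
  exists2 N : R, 0 < N & (r%:E <= \int[mu]_x (trunc N f x)%:E)%E.
Proof.
move=> mf f0 rf; apply: contrapT => H.
have : (\int[mu]_x f x <= r%:E)%E; last by rewrite leNgt rf.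
pose g (n : nat) x := (trunc n.+1%:R f x)%:E.
have gE n x : g n x = mine (f x) (n.+1%:R)%:E by rewrite /g truncE.
have -> : (\int[mu]_x f x = \int[mu]_x limn (g ^~ x))%E.
  apply: eq_integral => x _; apply/esym/cvg_lim => //.
  under eq_fun do rewrite gE.
  have [fx|fx] := eqVneq (f x) +oo%E.
    rewrite fx; under eq_fun do rewrite min_r ?leey//.
    apply/cvgeryP; apply/cvgryPge => A; near=> n.
    rewrite (@le_trans _ _ n%:R)// ?ler_nat//.
    by near: n; exact: nbhs_infty_ger.
  have fxf : f x \is a fin_num by rewrite ge0_fin_numE// ltey.
  apply: cvg_near_cst; near=> n; rewrite min_l// -(fineK fxf) lee_fin.
  rewrite (@le_trans _ _ n%:R)// ?ler_nat//.
  by near: n; exact: nbhs_infty_ger.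
rewrite monotone_convergence//; last 3 first.
- by move=> n; apply/measurable_EFinP; exact: measurable_trunc.
- by move=> n x _; rewrite gE le_min f0/= lee_fin.
- move=> x _ m n mn; rewrite !gE le_min ge_min lexx/=.
  by rewrite ge_min lee_fin ler_nat ltnS mn orbT.
apply: lime_le.
  apply: ereal_nondecreasing_is_cvgn => m n mn; apply: ge0_le_integral => //.
  - by move=> x _; rewrite gE le_min f0/= lee_fin.
  - by apply/measurable_EFinP; exact: measurable_trunc.
  - by apply/measurable_EFinP; exact: measurable_trunc.
  move=> x _; rewrite !gE le_min ge_min lexx/=.
  by rewrite ge_min lee_fin ler_nat ltnS mn orbT.
apply: nearW => n; rewrite leNgt; apply/negP => h.
by apply: H; exists n.+1%:R => //; exact: ltW.
Unshelve. all: by end_near. Qed.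

(** Dividing a truncation of f by its supremum, written as the power of a scale
    xi, gives a function of supremum 1 whose level sets are still convex and whose
    integral is still bounded below. *)
Let normalised (n : nat) (f : R -> \bar R) (N r : R) :
  measurable_fun setT f -> (forall x, 0 <= f x)%E ->
  (forall l, 0 <= l <= 1 -> inv_pow_concave n.+1 l f f f) ->
  0 < N -> 0 < r -> (r%:E <= \int[mu]_x (trunc N f x)%:E)%E ->
  exists f1 : R -> R, exists2 xi : R, 0 < xi &
    [/\ measurable_fun setT f1, forall x, 0 <= f1 x <= 1,
     forall s, s < 1 -> exists x, s < f1 x &
     forall s, 0 < s -> convex1 [set x | s < f1 x]] /\
    (forall x, ((f1 x * xi ^- n.+1)%:E <= f x)%E) /\
    ((xi ^+ n.+1 * r)%:E <= \int[mu]_x (f1 x)%:E)%E.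
Proof.
move=> mf f0 cf N0 r0 rint.
pose fN := trunc N f.
have fNE x : (fN x)%:E = mine (f x) N%:E by rewrite truncE// ltW.
have fNf x : ((fN x)%:E <= f x)%E by rewrite fNE ge_min lexx.
have fNN x : fN x <= N by rewrite -lee_fin fNE ge_min lexx orbT.
have fN0 x : 0 <= fN x by rewrite -lee_fin fNE le_min f0 lee_fin ltW.
have sfN : has_sup (range fN).
  by split; [exists (fN 0); exists 0|exists N => _ [x _ <-]].
set a := sup (range fN).
have fNa x : fN x <= a by apply: ub_le_sup; [case: sfN|exists x].
have aN : a <= N by apply: ge_sup; [case: sfN|move=> _ [x _ <-]].
have a0 : 0 < a.
  rewrite ltNge; apply/negP => a0.
  have : (\int[mu]_x (fN x)%:E = 0)%E.
    apply: integral0_eq => x _; congr EFin; apply/eqP.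
    by rewrite eq_le fN0 (le_trans (fNa x)).
  by move=> h; move: rint; rewrite [X in (_ <= X)%E]h lee_fin leNgt r0.
have [xi xi0 xia] := inv_pow_surj n a0.
have mfN : measurable_fun setT fN by exact: measurable_trunc.
exists (fun x => a^-1 * fN x); exists xi => //; split; [split|split].
- by apply: measurable_funM => //; exact: measurable_cst.
- move=> x; rewrite mulr_ge0 ?invr_ge0 ?(ltW a0)//=.
  by rewrite ler_pdivrMl// mulr1.
- move=> s s1; have : a * s < a by rewrite -[ltRHS]mulr1 ltr_pM2l.
  move=> /(sup_gt (ex_intro _ _ (ex_intro2 _ _ 0 I erefl)))[_ [x _ <-] h].
  by exists x; rewrite ltr_pdivlMl.
- move=> s s0 x y l /= sx sy l01; rewrite ltr_pdivlMl//.
  rewrite ltr_pdivlMl// in sx; rewrite ltr_pdivlMl// in sy.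
  set m := Num.min (fN x) (fN y).
  have ms : a * s < m by rewrite lt_min sx.
  have m0 : 0 < m by rewrite (lt_trans _ ms)// mulr_gt0.
  apply: lt_le_trans ms _.
  have [t t0 tm] := inv_pow_surj n m0.
  have := cf _ l01 x y t t t0 t0; rewrite tm.
  have -> : (1 - l) * t + l * t = t by ring.
  rewrite tm => H.
  rewrite -lee_fin fNE le_min H//=.
  + by rewrite lee_fin /m ge_min fNN.
  + by apply: le_trans (fNf x); rewrite lee_fin /m ge_min lexx.
  + by apply: le_trans (fNf y); rewrite lee_fin /m ge_min lexx orbT.
- by move=> x; rewrite xia mulrAC mulVf ?gt_eqF// mul1r.
- under eq_integral do rewrite EFinM.
  rewrite ge0_integralZl//; last 3 first.
  + exact/measurable_EFinP.
  + by move=> x _; rewrite lee_fin.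
  + by rewrite lee_fin invr_ge0 ltW.
  have -> : xi ^+ n.+1 = a^-1 by rewrite -xia invrK.
  by rewrite EFinM lee_pmul2l// lte_fin invr_gt0.
Qed.

(** Integration over the line lowers the exponent by one. After normalisation to
    supremum 1, the three functions satisfy the hypotheses of the additive
    inequality [prekopa_leindler_sup]; the scales xi and et of the normalisations
    recombine through the convexity of x ^ (n + 1) / a ^ n. *)
Lemma borell_brascamp_lieb (n : nat) (l : R) (f g h : R -> \bar R) (a b : R) :
  0 < l < 1 ->
  measurable_fun setT f -> measurable_fun setT g -> measurable_fun setT h ->
  (forall x, 0 <= f x)%E -> (forall x, 0 <= g x)%E -> (forall x, 0 <= h x)%E ->
  inv_pow_concave n.+1 l f g h ->
  (forall l, 0 <= l <= 1 -> inv_pow_concave n.+1 l f f f) ->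
  (forall l, 0 <= l <= 1 -> inv_pow_concave n.+1 l g g g) ->
  0 < a -> 0 < b ->
  ((a ^- n)%:E <= \int[mu]_x f x)%E -> ((b ^- n)%:E <= \int[mu]_x g x)%E ->
  ((((1 - l) * a + l * b) ^- n)%:E <= \int[mu]_x h x)%E.
Proof.
move=> l01 mf mg mh f0 g0 h0 cfgh cf cg a0 b0 aint bint.
have /andP[l0 l1] := l01; have k0 : 0 < 1 - l by lra.
set c := (1 - l) * a + l * b.
have c0 : 0 < c by rewrite /c; nra.
(* The factor rho makes room for replacing f and g by truncations. *)
suff H rho : 0 < rho < 1 -> ((rho * c ^- n)%:E <= \int[mu]_x h x)%E.
  have [->|hy] := eqVneq (\int[mu]_x h x)%E +oo%E; first by rewrite leey.
  have hf : (\int[mu]_x h x)%E \is a fin_num.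
    by rewrite ge0_fin_numE ?ltey// integral_ge0.
  rewrite -(fineK hf) lee_fin; apply/ler_addgt0Pr => e e0.
  have d0 : 0 < c ^- n by rewrite invr_gt0 exprn_gt0.
  set d := c ^- n in d0 *.
  pose rho := Num.max (2^-1) (1 - e / d).
  have := H rho; rewrite -(fineK hf) lee_fin => hr.
  have ed : 0 < e / d by rewrite divr_gt0.
  have r1 : 0 < rho < 1.
    by rewrite /rho lt_max gt_max invr_gt0 ltr0n /= invf_lt1// ltr1n/=; lra.
  apply: le_trans (lerD (hr r1) (lexx _)).
  have : 1 - e / d <= rho by rewrite /rho le_max lexx orbT.
  move=> /(ler_wpM2r (ltW d0)); rewrite mulrBl mul1r divfK ?gt_eqF//.
  by rewrite -/d; lra.
move=> /andP[r0 r1].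
have lower u v : 0 < u -> ((u ^- n)%:E <= v)%E -> ((rho * u ^- n)%:E < v)%E.
  move=> u0; apply: lt_le_trans; rewrite lte_fin -[ltRHS]mul1r.
  by rewrite ltr_pM2r// invr_gt0 exprn_gt0.
have [N N0 Nf] := integral_trunc_lb mf f0 (lower _ _ a0 aint).
have [M M0 Mg] := integral_trunc_lb mg g0 (lower _ _ b0 bint).
have ra0 : 0 < rho * a ^- n by rewrite mulr_gt0// invr_gt0 exprn_gt0.
have rb0 : 0 < rho * b ^- n by rewrite mulr_gt0// invr_gt0 exprn_gt0.
have [f1 [xi xi0 [[mf1 f101 supf1 cf1] [f1f intf1]]]] :=
  normalised mf f0 cf N0 ra0 Nf.
have [g1 [et et0 [[mg1 g101 supg1 cg1] [g1g intg1]]]] :=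
  normalised mg g0 cg M0 rb0 Mg.
set z := (1 - l) * xi + l * et.
have z0 : 0 < z by rewrite /z; nra.
pose m := z ^- n.+1.
have m0 : 0 < m by rewrite /m invr_gt0 exprn_gt0.
pose h1 x := m^-1 * trunc m h x.
have hmE x : (trunc m h x)%:E = mine (h x) m%:E by rewrite truncE// ltW.
have hm0 x : 0 <= trunc m h x by rewrite -lee_fin hmE le_min h0 lee_fin ltW.
have mh1 : measurable_fun setT h1.
  by apply: measurable_funM => //; apply: measurable_trunc.
have H1 := @prekopa_leindler_sup R f1 g1 h1 l l01 mf1 mg1 mh1 f101 g101.
have h10 x : 0 <= h1 x by rewrite mulr_ge0// invr_ge0 ltW.
have fgh1 x y : Num.min (f1 x) (g1 y) <= h1 ((1 - l) * x + l * y).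
  set s := Num.min _ _.
  have [s0|s0] := leP s 0; first exact: le_trans s0 (h10 _).
  have [t t0 ts] := inv_pow_surj n s0.
  rewrite /h1 ler_pdivlMl// -lee_fin hmE le_min; apply/andP; split; last first.
    rewrite lee_fin -[leRHS]mulr1 ler_pM2l// /s ge_min.
    by case/andP: (f101 x) => _ ->.
  have := cfgh x y (t * xi) (t * et) (mulr_gt0 t0 xi0) (mulr_gt0 t0 et0).
  have -> : (1 - l) * (t * xi) + l * (t * et) = t * z by rewrite /z; ring.
  rewrite !exprMn !invfM ts [m * s]mulrC; apply.
    apply: le_trans (f1f x); rewrite lee_fin ler_wpM2r//.
      by rewrite invr_ge0 exprn_ge0// ltW.
    by rewrite /s ge_min lexx.
  apply: le_trans (g1g y); rewrite lee_fin ler_wpM2r//.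
    by rewrite invr_ge0 exprn_ge0// ltW.
  by rewrite /s ge_min lexx orbT.
have {}H1 := H1 h10 supf1 supg1 cf1 cg1 fgh1.
have : ((m * ((1 - l) * (xi ^+ n.+1 * (rho * a ^- n)) +
      l * (et ^+ n.+1 * (rho * b ^- n))))%:E <= \int[mu]_x h x)%E.
  apply: (@le_trans _ _ (m%:E * \int[mu]_x (h1 x)%:E)%E).
    rewrite EFinM lee_pmul2l//; apply: le_trans H1.
    by rewrite EFinD !EFinM; apply: leeD; rewrite lee_pmul2l// lte_fin.
  rewrite -ge0_integralZl//; last 3 first.
  - by apply/measurable_EFinP.
  - by move=> x _; rewrite lee_fin.
  - by rewrite lee_fin ltW.
  apply: ge0_le_integral => //.
  - by move=> x _; rewrite -EFinM lee_fin mulr_ge0// ltW.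
  - by apply: emeasurable_funM => //; apply/measurable_EFinP.
  move=> x _; rewrite -EFinM /h1 mulrA divff ?gt_eqF// mul1r hmE.
  by rewrite ge_min lexx.
apply: le_trans; rewrite lee_fin.
have pz := @perspective_pow_convex R n l xi et a b.
have {pz} := pz _ xi0 et0 a0 b0; rewrite -/z -/c => pz.
have {}pz : z ^+ n.+1 / c ^+ n <=
  (1 - l) * (xi ^+ n.+1 / a ^+ n) + l * (et ^+ n.+1 / b ^+ n) by apply: pz; lra.
have -> : m * ((1 - l) * (xi ^+ n.+1 * (rho / a ^+ n)) +
     l * (et ^+ n.+1 * (rho / b ^+ n))) =
  m * rho * ((1 - l) * (xi ^+ n.+1 / a ^+ n) + l * (et ^+ n.+1 / b ^+ n)) by ring.
have -> : rho / c ^+ n = m * rho * (z ^+ n.+1 / c ^+ n).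
  rewrite /m; field; rewrite !expf_neq0 ?gt_eqF//.
by rewrite ler_pM2l// mulr_gt0.
Qed.

End borell_brascamp_lieb.

(** * Change of variables on the line *)

Section change_of_variables.
Context {R : realType}.
Local Notation mu := (@lebesgue_measure R).
Local Notation T2 := (measurableTypeR R * measurableTypeR R)%type.
Implicit Types f : R -> \bar R.

Lemma lebesgue_measure_affine (c d : R) (A : set (measurableTypeR R)) : 0 < c ->
  measurable A ->
  mu A = (c%:E * mu ((fun x => c * x + d)%R @^-1` A))%E.
Proof.
move=> c0 mA.
have mphi : measurable_fun [set: measurableTypeR R]
    ((fun x => c * x + d) : measurableTypeR R -> measurableTypeR R).
  by apply: measurable_funD => //; apply: measurable_funM.
unshelve refine (eq_trans (@lebesgue_measure_unique R (mscale (NngNum (ltW c0))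
  (pushforward mu ((fun x => c * x + d) : measurableTypeR R -> measurableTypeR R)))
  _ A mA) _) => //= _ [[a b]] _ <-.
rewrite -[RHS]/(c%:E * mu ((fun x => c * x + d)%R @^-1` `]a, b]%classic))%E.
have -> : (fun x => c * x + d) @^-1` `]a, b] = `](a - d) / c, (b - d) / c]%classic.
  apply/seteqP; split => x /=; rewrite !in_itv/= ltr_pdivrMr// ler_pdivlMr//.
    by move=> /andP[h1 h2]; apply/andP; split; lra.
  by move=> /andP[h1 h2]; apply/andP; split; lra.
rewrite !lebesgue_measure_itv/= !lte_fin ltr_pM2r ?invr_gt0// ltrD2r.
case: ifPn => ab; last by rewrite mule0.
rewrite -!EFinB -EFinM; congr EFin; field; lra.
Qed.

Lemma integral_affine_pos (c d : R) f : 0 < c ->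
  measurable_fun setT f -> (forall x, 0 <= f x)%E ->
  (\int[mu]_x f x = c%:E * \int[mu]_x f (c * x + d)%R)%E.
Proof.
move=> c0 mf f0.
have mphi : measurable_fun [set: measurableTypeR R]
    ((fun x => c * x + d) : measurableTypeR R -> measurableTypeR R).
  by apply: measurable_funD => //; apply: measurable_funM.
have := @ge0_integral_pushforward _ _ _ _ R _ mphi mu setT f measurableT mf
  (fun y _ => f0 y).
rewrite preimage_setT => <-.
have ci : 0 <= c^-1 by rewrite invr_ge0 ltW.
rewrite [X in (_ * X)%E](_ : _ = \int[mscale (NngNum ci) mu]_x f x)%E; last first.
  apply: eq_measure_integral => A mA _.
  rewrite -[LHS]/(mu ((fun x => c * x + d)%R @^-1` A)).
  rewrite -[RHS]/(c^-1%:E * mu A)%E.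
  by rewrite (lebesgue_measure_affine d c0 mA) muleA -EFinM mulVf ?gt_eqF// mul1e.
rewrite ge0_integral_mscale//= muleA -EFinM divff ?gt_eqF// mul1e.
by [].
Qed.

Lemma integral_opp f : measurable_fun setT f -> (forall x, 0 <= f x)%E ->
  (\int[mu]_x f x = \int[mu]_x f (- x)%R)%E.
Proof.
move=> mf f0.
have mphi : measurable_fun [set: measurableTypeR R]
    (-%R : measurableTypeR R -> measurableTypeR R) by exact: measurable_funN.
have := @ge0_integral_pushforward _ _ _ _ R _ mphi mu setT f measurableT mf
  (fun y _ => f0 y).
rewrite preimage_setT => <-.
by apply: eq_measure_integral => A mA _; exact/esym/lebesgue_measureN.
Qed.

Lemma integral_affine (c d : R) f : c != 0 ->
  measurable_fun setT f -> (forall x, 0 <= f x)%E ->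
  (\int[mu]_x f x = `|c|%:E * \int[mu]_x f (c * x + d)%R)%E.
Proof.
move=> c0 mf f0; have [cn|cp|] := ltgtP c 0; last by move/eqP; rewrite (negbTE c0).
- rewrite ltr0_norm// integral_opp// (@integral_affine_pos (- c) (- d))//; last 2 first.
  + by rewrite oppr_gt0.
  + by apply: measurableT_comp => //; exact: measurable_funN.
  by congr (_ * _)%E; apply: eq_integral => x _; congr f; ring.
by rewrite gtr0_norm//; exact: integral_affine_pos.
Qed.

(** The density 1 / r of the Haar measure of the multiplicative group of positive
    reals; it also serves as a measurable inverse on that group. *)
Definition haar_density (r : R) : R := if 0 < r then r^-1 else 0.
Local Notation hw := haar_density.

Lemma haar_density_ge0 r : 0 <= hw r.
Proof. by rewrite /hw; case: ifPn => // r0; rewrite invr_ge0 ltW. Qed.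

Lemma haar_density_ge0E r : (0 <= (hw r)%:E)%E.
Proof. by rewrite lee_fin haar_density_ge0. Qed.

Lemma measurable_haar_density : measurable_fun setT hw.
Proof.
have -> : hw = fun r => if 0 < r then expR (- ln r) else 0.
  apply/funext => r; rewrite /hw; case: ifPn => // r0.
  by rewrite expRN lnK.
apply: measurable_fun_ifT => //.
  by apply: measurable_fun_ltr.
apply: measurableT_comp => //; apply: measurableT_comp => //.
Qed.

Definition haar_integral f := (\int[mu]_r ((hw r)%:E * f r))%E.
Local Notation H := haar_integral.

Lemma haar_integral_scale (c : R) f : 0 < c ->
  measurable_fun setT f -> (forall x, 0 <= f x)%E ->
  H (fun r => f (c * r)) = H f.
Proof.
move=> c0 mf f0; rewrite /H.
have mh := measurable_haar_density.
have mhf : measurable_fun setT (fun r => (hw r)%:E * f r)%E.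
  by apply: emeasurable_funM => //; apply/measurable_EFinP.
have hf0 r : (0 <= (hw r)%:E * f r)%E by rewrite mule_ge0// lee_fin haar_density_ge0.
rewrite [RHS](integral_affine_pos 0 c0)//.
rewrite -ge0_integralZl//; last 2 first.
- apply: (measurableT_comp mhf).
  by apply: measurable_funD => //; apply: measurable_funM.
- by rewrite lee_fin ltW.
apply: eq_integral => r _; rewrite addr0 muleA -EFinM; congr (_%:E * _)%E.
rewrite /hw pmulr_rgt0//; case: ifPn => r0; last by rewrite mulr0.
by rewrite invfM mulrA divff ?gt_eqF// mul1r.
Qed.

Lemma haar_integral_eq (u v : R -> \bar R) :
  (forall r, 0 < r -> u r = v r) -> H u = H v.
Proof.
move=> uv; rewrite /H; apply: eq_integral => r _; rewrite /hw.
by case: ifPn => [r0|_]; [rewrite uv|rewrite !mul0e].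
Qed.

Lemma haar_integral_ge0 (u : R -> \bar R) : (forall r, 0 <= u r)%E -> (0 <= H u)%E.
Proof.
by move=> u0; apply: integral_ge0 => r _; apply: mule_ge0; [exact: haar_density_ge0E|].
Qed.

Lemma haar_integralZl (k : \bar R) (u : R -> \bar R) : (0 <= k)%E ->
  measurable_fun setT u -> (forall x, 0 <= u x)%E ->
  (H (fun r => k * u r) = k * H u)%E.
Proof.
move=> k0 mu' u0; rewrite /haar_integral.
have mh := measurable_haar_density.
rewrite -ge0_integralZl.
- by apply: eq_integral => r _; rewrite muleCA.
- by [].
- by apply: emeasurable_funM => //; apply/measurable_EFinP.
- by move=> r _; apply: mule_ge0; [exact: haar_density_ge0E|exact: u0].
- by [].
Qed.

Lemma haar_integral_exchange (u : T2 -> \bar R) :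
  measurable_fun setT u -> (forall z, 0 <= u z)%E ->
  H (fun r => H (fun s => u (r, s))) = H (fun s => H (fun r => u (r, s))).
Proof.
move=> mu' u0.
have mh := measurable_haar_density.
have mhw1 : measurable_fun [set: T2] (fun z => hw z.1).
  by apply: measurableT_comp => //; exact: measurable_fst.
have mhw2 : measurable_fun [set: T2] (fun z => hw z.2).
  by apply: measurableT_comp => //; exact: measurable_snd.
pose w (z : T2) := ((hw z.1)%:E * ((hw z.2)%:E * u z))%E.
have mw : measurable_fun setT w.
  apply: emeasurable_funM; first exact/measurable_EFinP.
  by apply: emeasurable_funM => //; exact/measurable_EFinP.
have w0 z : (0 <= w z)%E by apply: mule_ge0; [exact: haar_density_ge0E|apply: mule_ge0; [exact: haar_density_ge0E|exact: u0]].
have := @fubini_tonelli _ _ _ _ R mu mu w mw w0.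
rewrite /fubini_F /fubini_G => tw.
transitivity (\int[mu]_x \int[mu]_y w (x, y))%E.
  rewrite /haar_integral.
  apply: eq_integral => r _.
  rewrite /w -ge0_integralZl.
  - by [].
  - by [].
  - apply: emeasurable_funM; first exact/measurable_EFinP.
    exact: measurableT_comp.
  - by move=> y _; apply: mule_ge0; [exact: haar_density_ge0E|exact: u0].
  - exact: haar_density_ge0E.
rewrite tw /haar_integral; apply: eq_integral => r _.
rewrite /w -ge0_integralZl.
- by apply: eq_integral => s _; rewrite muleCA.
- by [].
- apply: emeasurable_funM; first exact/measurable_EFinP.
  exact: measurableT_comp.
- by move=> y _; apply: mule_ge0; [exact: haar_density_ge0E|exact: u0].
- exact: haar_density_ge0E.
Qed.

(** Uniqueness of the Haar measure, in its usual proof: weight by a function g of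
    integral 1, exchange the integrals, and use the invariance under scaling in
    each of the two variables. *)
Lemma haar_integral_inv f : measurable_fun setT f -> (forall x, 0 <= f x)%E ->
  H (fun r => f r^-1) = H f.
Proof.
move=> mf f0.
have mh := measurable_haar_density.
have mhi : measurable_fun setT (fun r : R => f (hw r)) by apply: measurableT_comp.
have inv r : 0 < r -> r^-1 = hw r by rewrite /hw => ->.
(* The product of g with the density is the indicator of the interval ]0, 1]. *)
pose g (s : R) : \bar R := (Num.max (if s <= 1 then s else 0) 0)%:E.
have mg : measurable_fun setT g.
  apply/measurable_EFinP; apply: measurable_maxr => //.
  by apply: measurable_fun_ifT => //; apply: measurable_fun_ler.
have g0 s : (0 <= g s)%E by rewrite /g lee_fin le_max lexx orbT.
have Hg : H g = 1%E.
  have -> : H g = (\int[mu]_r (\1_(`]0, 1]%classic) r)%:E)%E.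
    apply: eq_integral => r _; rewrite /g -EFinM; congr EFin.
    rewrite indicE /hw; have [r1|r1] := leP r 1; have [r0|r0] := ltP 0 r.
    - by rewrite mem_set/= ?in_itv/= ?r0// mulVf// gt_eqF.
    - by rewrite memNset/= ?in_itv/= ?mul0r//; apply/negP; rewrite negb_and -leNgt r0.
    - rewrite memNset/= ?in_itv/= ?maxxx ?mulr0//; apply/negP.
      by rewrite negb_and -ltNge r1 orbT.
    - by rewrite memNset/= ?in_itv/= ?mul0r//; apply/negP; rewrite negb_and -leNgt r0.
  have E : (mu `]0%R, 1%R]%classic = 1)%E.
    by rewrite lebesgue_measure_itv/= lte_fin ltr01 oppr0 adde0.
  by rewrite integral_indic// setIT; exact: E.
have mhw1 : measurable_fun [set: T2] (fun z => hw z.1).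
  by apply: measurableT_comp => //; exact: measurable_fst.
have mhw2 : measurable_fun [set: T2] (fun z => hw z.2).
  by apply: measurableT_comp => //; exact: measurable_snd.
have tonelli := haar_integral_exchange.
have m1 : measurable_fun [set: T2] fst by exact: measurable_fst.
have m2 : measurable_fun [set: T2] snd by exact: measurable_snd.
transitivity (H (fun r => g r * H (fun s => f (r * hw s)%R))%E).
  rewrite -[LHS]mule1 -Hg -haar_integralZl//; last exact: haar_integral_ge0.
  apply: haar_integral_eq => r r0; rewrite muleC; congr (_ * _)%E.
  rewrite -(@haar_integral_scale r (fun s => f (r * hw s)))//; last first.
    by apply: measurableT_comp => //; apply: measurable_funM.
  apply: haar_integral_eq => s s0; rewrite -inv ?mulr_gt0//.
  by rewrite invfM mulrA divff ?mul1r// gt_eqF.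
transitivity (H (fun r => H (fun s => g r * f (r * hw s)%R))%E).
  apply: haar_integral_eq => r r0; rewrite haar_integralZl//.
  by apply: measurableT_comp => //; apply: measurable_funM.
rewrite (tonelli (fun z => g z.1 * f (z.1 * hw z.2)%R)%E); last 2 first.
- apply: emeasurable_funM; first by apply: measurableT_comp.
  by apply: measurableT_comp => //; apply: measurable_funM.
- by move=> z; rewrite mule_ge0.
transitivity (H (fun s => H (fun r => g (s * r)%R * f r)%E)).
  apply: haar_integral_eq => s s0 /=.
  rewrite -(@haar_integral_scale s (fun r => g r * f (r * hw s)%R)%E)//; last 2 first.
  - apply: emeasurable_funM => //; apply: measurableT_comp => //.
    by apply: measurable_funM.
  - by move=> r; rewrite mule_ge0.
  apply: haar_integral_eq => r r0; congr (_ * f _)%E.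
  by rewrite -inv// mulrAC divff ?mul1r// gt_eqF.
rewrite -(tonelli (fun z => g (z.2 * z.1)%R * f z.1)%E); last 2 first.
- apply: emeasurable_funM; last by apply: measurableT_comp.
  by apply: measurableT_comp => //; apply: measurable_funM.
- by move=> z; rewrite mule_ge0.
rewrite -[RHS]mule1 -Hg muleC -haar_integralZl//; last exact: haar_integral_ge0.
apply: haar_integral_eq => r r0 /=.
rewrite muleC -(haar_integral_scale r0 mg g0) -haar_integralZl//; last first.
  by apply: measurableT_comp => //; apply: measurable_funM.
by apply: haar_integral_eq => s s0; rewrite muleC mulrC.
Qed.

End change_of_variables.

(** * Change of variables in the plane *)

Section plane.
Context {R : realType}.
Local Notation mu := (@lebesgue_measure R).
Local Notation T2 := (measurableTypeR R * measurableTypeR R)%type.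
Local Notation mu2 := (lebesgue2 R).

Lemma integral2E (f : T2 -> \bar R) : measurable_fun setT f ->
  (forall z, 0 <= f z)%E -> (\int[mu2]_z f z = \int[mu]_x \int[mu]_y f (x, y))%E.
Proof. by move=> mf f0; exact: fubini_tonelli1. Qed.

Lemma integral2_swapE (f : T2 -> \bar R) : measurable_fun setT f ->
  (forall z, 0 <= f z)%E -> (\int[mu2]_z f z = \int[mu]_y \int[mu]_x f (x, y))%E.
Proof. move=> mf f0; rewrite (integral2E mf f0); exact: (@fubini_tonelli _ _ _ _ R mu mu f mf f0). Qed.

Lemma sigma_finite_lebesgue2 : sigma_finite setT mu2.
Proof.
exists (fun n => `[(- n%:R : R), n%:R] `*` `[(- n%:R : R), n%:R]).
  apply/seteqP; split => // z _.
  have [n nz] : exists n, Num.max `|z.1| `|z.2| < n%:R.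
    exists (Num.trunc (Num.max `|z.1| `|z.2|)).+1; exact: truncnS_gt.
  exists n => //; move: nz; rewrite gt_max => /andP[z1 z2].
  by split; rewrite /= in_itv/= -ler_norml ltW.
move=> n; set I := `[(- n%:R : R), n%:R]%classic.
have mI : measurable (I : set (measurableTypeR R)) by exact: measurable_itv.
split; first exact: measurableX.
rewrite (_ : mu2 _ = mu I * mu I)%E; last exact: product_measure1E.
by rewrite !lebesgue_measure_itv/=; case: ifPn => _; rewrite ?mule0// -EFinB -EFinM ltry.
Qed.

Definition leb2 : set T2 -> \bar R := (mu \x mu)%E.
HB.instance Definition _ := Measure.on leb2.
HB.instance Definition _ :=
  Measure_isSigmaFinite.Build _ T2 R leb2 sigma_finite_lebesgue2.

(** Defined by the substitution rule itself rather than by derivatives: it then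
    holds for shears along any measurable function, and composes. *)
Definition jacobian (d : R) (phi : R * R -> R * R) :=
  [/\ 0 < d, measurable_fun [set: T2] (phi : T2 -> T2) &
   forall f : T2 -> \bar R, measurable_fun setT f -> (forall z, 0 <= f z)%E ->
     (\int[mu2]_z f z = d%:E * \int[mu2]_z f (phi z))%E].

Lemma jacobian_comp d e phi psi : jacobian d phi -> jacobian e psi ->
  jacobian (d * e) (phi \o psi).
Proof.
move=> [d0 mphi hphi] [e0 mpsi hpsi]; split; first exact: mulr_gt0.
  exact: measurableT_comp.
move=> f mf f0; rewrite hphi// EFinM -muleA; congr (_ * _)%E.
by rewrite hpsi//; exact: measurableT_comp.
Qed.

Lemma jacobian_eq d e phi psi : d = e -> phi =1 psi -> jacobian d phi ->
  jacobian e psi.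
Proof. by move=> -> /funext ->. Qed.

Lemma jacobian_swap : jacobian 1 (fun z => (z.2, z.1)).
Proof.
split => //.
  by apply: measurable_fun_pair; [exact: measurable_snd|exact: measurable_fst].
move=> f mf f0; rewrite mul1e integral2_swapE// integral2E//.
apply: measurableT_comp => //.
by apply: measurable_fun_pair; [exact: measurable_snd|exact: measurable_fst].
Qed.

Lemma jacobian_fst (c : R) (g : R -> R) : c != 0 -> measurable_fun setT g ->
  jacobian `|c| (fun z => (c * z.1 + g z.2, z.2)).
Proof.
move=> c0 mg.
have mphi : measurable_fun [set: T2]
    ((fun z => (c * z.1 + g z.2, z.2)) : T2 -> T2).
  apply: measurable_fun_pair; last exact: measurable_snd.
  apply: measurable_funD.
    by apply: measurable_funM => //; exact: measurable_fst.
  by apply: measurableT_comp => //; exact: measurable_snd.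
split => //; first by rewrite normr_gt0.
move=> f mf f0; rewrite integral2_swapE// [in RHS]integral2_swapE//; last first.
  by apply: measurableT_comp.
rewrite -ge0_integralZl//; last 2 first.
- apply: (@measurable_fun_fubini_tonelli_G _ _ _ _ R mu
    (fun z : T2 => f (c * z.1 + g z.2, z.2))) => //.
  exact: measurableT_comp.
- by move=> y _; exact: integral_ge0.
apply: eq_integral => y _ /=.
by rewrite (integral_affine (g y) c0)//; apply: measurableT_comp.
Qed.

Lemma jacobian_snd (c : R) (g : R -> R) : c != 0 -> measurable_fun setT g ->
  jacobian `|c| (fun z => (z.1, c * z.2 + g z.1)).
Proof.
move=> c0 mg; have h := jacobian_comp jacobian_swap
  (jacobian_comp (jacobian_fst c0 mg) jacobian_swap).
by apply: jacobian_eq h; rewrite ?mul1r ?mulr1.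
Qed.

Definition affine (a b c d e f : R) (z : R * R) : R * R :=
  (a * z.1 + b * z.2 + e, c * z.1 + d * z.2 + f).

Lemma jacobian_affine a b c d e f : a * d - b * c != 0 ->
  jacobian `|a * d - b * c| (affine a b c d e f).
Proof.
have H a' b' c' d' e' f' : a' != 0 -> a' * d' - b' * c' != 0 ->
    jacobian `|a' * d' - b' * c'| (affine a' b' c' d' e' f').
  move=> a0 D0.
  have D1 : (a' * d' - b' * c') / a' != 0 by rewrite mulf_neq0// invr_eq0.
  have h1 := jacobian_fst a0 (g := fun y => b' * y + e').
  have h2 := jacobian_snd D1 (g := fun y => c' / a' * (y - e') + f').
  have {}h1 : jacobian `|a'| (fun z => (a' * z.1 + (b' * z.2 + e'), z.2)).
    by apply: h1; apply: measurable_funD => //; apply: measurable_funM.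
  have {h2}h2 := h2 (measurable_funD (measurable_funM (measurable_cst _)
    (measurable_funB (@measurable_id _ _ _) (measurable_cst _))) (measurable_cst _)).
  apply: jacobian_eq (jacobian_comp h2 h1).
    by rewrite -normrM divfK.
  by move=> [x y]; rewrite /affine /=; congr pair; [ring|field].
have [a0|a0] := eqVneq a 0; last by exact: H.
move=> D0; have b0 : b != 0.
  by apply: contraNneq D0 => ->; rewrite a0 !mul0r subr0.
have D1 : b * c - a * d != 0 by rewrite -oppr_eq0 opprB.
apply: jacobian_eq (jacobian_comp (H b a d c e f b0 D1) jacobian_swap).
  by rewrite mulr1 distrC.
by move=> [x y]; rewrite /affine /=; congr pair; ring.
Qed.

Lemma jacobian_integral d phi (A : set T2) (f : T2 -> \bar R) : jacobian d phi ->
  measurable A -> measurable_fun setT f -> (forall z, 0 <= f z)%E ->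
  (\int[mu2]_(z in A) f z = d%:E * \int[mu2]_(z in phi @^-1` A) f (phi z))%E.
Proof.
move=> [d0 mphi h] mA mf f0; rewrite integral_mkcond h.
- by rewrite [in RHS]integral_mkcond; congr (_ * _)%E; apply: eq_integral.
- by apply/(measurable_restrictT _ mA); exact: measurable_funTS.
- by move=> z; exact: erestrict_ge0.
Qed.

Lemma jacobian_measure d phi (A : set T2) : jacobian d phi -> measurable A ->
  (mu2 A = d%:E * mu2 (phi @^-1` A))%E.
Proof.
move=> h mA; have [_ mphi _] := h.
have mA' : measurable (phi @^-1` A) by rewrite -[X in measurable X]setTI; exact: mphi.
by rewrite -[LHS]mul1e -integral_cst// (jacobian_integral h)// integral_cst// mul1e.
Qed.

End plane.

(** * Log-convexity of exponential integrals *)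

Lemma inv_pow_concave_closed {R : realType} (n : nat) (f : R -> \bar R) :
  (forall l, 0 < l < 1 -> inv_pow_concave n l f f f) ->
  forall l, 0 <= l <= 1 -> inv_pow_concave n l f f f.
Proof.
move=> H l /andP[l0 l1] x y a b a0 b0 fx fy.
have [->|ln0] := eqVneq l 0; first by rewrite subr0 !mul1r !mul0r !addr0.
have [->|ln1] := eqVneq l 1; first by rewrite subrr !mul1r !mul0r !add0r.
by apply: H => //; rewrite !lt_neqAle l0 l1 ln1 eq_sym ln0.
Qed.

Section log_integral.
Context d (T : measurableType d) (R : realType).
Variables (m : {sigma_finite_measure set T -> \bar R}) (D : set T).
Hypotheses (mD : measurable D) (D_gt0 : (0 < m D)%E) (D_fin : (m D < +oo)%E).

Definition tame (phi : T -> R) :=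
  measurable_fun setT phi /\ exists C, forall x, D x -> `|phi x| <= C.

Lemma tameD phi psi : tame phi -> tame psi -> tame (fun x => phi x + psi x).
Proof.
move=> [m1 [C1 h1]] [m2 [C2 h2]]; split; first exact: measurable_funD.
exists (C1 + C2) => x Dx; apply: le_trans (ler_normD _ _) _.
by apply: lerD; [exact: h1|exact: h2].
Qed.

Lemma tame_cst c : tame (fun=> c).
Proof. by split => //; exists `|c|. Qed.

Lemma tameZ c phi : tame phi -> tame (fun x => c * phi x).
Proof.
move=> [m1 [C1 h1]]; split; first exact: measurable_funM.
by exists (`|c| * C1) => x Dx; rewrite normrM ler_wpM2l// h1.
Qed.

Lemma tameN phi : tame phi -> tame (fun x => - phi x).
Proof.
by move=> [m1 [C1 h1]]; split; [exact: measurable_funN|exists C1 => x Dx; rewrite normrN h1].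
Qed.

Definition log_integral (phi : T -> R) : R :=
  ln (\int[m]_(x in D) expR (phi x)).
Local Notation L := log_integral.

Lemma integrable_expR phi : tame phi ->
  m.-integrable D (EFin \o (fun x => expR (phi x))).
Proof.
move=> [mphi [C hC]]; apply: measurable_bounded_integrable => //.
  by apply: measurable_funTS; exact: measurableT_comp.
exists (expR C); split; first exact: num_real.
move=> M hM x Dx; rewrite /= ger0_norm ?expR_ge0// (le_trans _ (ltW hM))// ler_expR.
by rewrite (le_trans (ler_norm _))// hC.
Qed.

Lemma Rintegral_expR_ge phi c : tame phi -> (forall x, D x -> c <= phi x) ->
  expR c * fine (m D) <= \int[m]_(x in D) expR (phi x).
Proof.
move=> tp hc; rewrite -Rintegral_cst//; apply: le_Rintegral => //.
- exact: (integrable_expR (tame_cst c)).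
- exact: integrable_expR.
- by move=> x Dx; rewrite ler_expR hc.
Qed.

Lemma Rintegral_expR_gt0 phi : tame phi -> 0 < \int[m]_(x in D) expR (phi x).
Proof.
move=> tp; have [mphi [C hC]] := tp.
apply: (@lt_le_trans _ _ (expR (- C) * fine (m D))).
  by rewrite mulr_gt0 ?expR_gt0// fine_gt0// D_gt0 D_fin.
by apply: Rintegral_expR_ge => // x /hC; rewrite ler_norml => /andP[].
Qed.

Lemma log_integralK phi : tame phi ->
  expR (L phi) = \int[m]_(x in D) expR (phi x).
Proof. by move=> tp; rewrite lnK// posrE; exact: Rintegral_expR_gt0. Qed.

Lemma log_integral_le phi psi : tame phi -> tame psi ->
  (forall x, D x -> phi x <= psi x) -> L phi <= L psi.
Proof.
move=> tp tq pq; rewrite ler_ln ?posrE; try exact: Rintegral_expR_gt0.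
apply: le_Rintegral => //; try exact: integrable_expR.
by move=> x Dx; rewrite ler_expR pq.
Qed.

Lemma log_integralDc phi c : tame phi -> L (fun x => phi x + c) = L phi + c.
Proof.
move=> tp; apply: expR_inj; rewrite expRD !log_integralK//; last first.
  by apply: tameD => //; exact: tame_cst.
rewrite -RintegralZr//; last exact: integrable_expR.
by apply: eq_Rintegral => x _; rewrite expRD.
Qed.

Lemma expR_convex (l x y : R) : 0 <= l <= 1 ->
  expR ((1 - l) * x + l * y) <= (1 - l) * expR x + l * expR y.
Proof.
move=> /andP[l0 l1]; set z := (1 - l) * x + l * y.
have tang t : expR z * (1 + (t - z)) <= expR t.
  have -> : expR t = expR z * expR (t - z) by rewrite -expRD addrC subrK.
  by rewrite ler_pM2l ?expR_gt0//; exact: expR_ge1Dx.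
have -> : expR z = (1 - l) * (expR z * (1 + (x - z))) + l * (expR z * (1 + (y - z))).
  by rewrite /z; ring.
by apply: lerD; apply: ler_wpM2l; rewrite ?subr_ge0.
Qed.

(** Convexity of the logarithm of an exponential integral, i.e. Hoelder's
    inequality, reduced to the pointwise convexity of [expR] by normalising both
    integrals to 1. *)
Lemma log_integral_convex phi psi l : tame phi -> tame psi -> 0 <= l <= 1 ->
  L (fun x => (1 - l) * phi x + l * psi x) <= (1 - l) * L phi + l * L psi.
Proof.
move=> tp tq l01.
have tpq : tame (fun x => (1 - l) * phi x + l * psi x).
  by apply: tameD; exact: tameZ.
set a := L phi; set b := L psi.
rewrite -ler_expR log_integralK//.
have tA : tame (fun x => phi x - a) by apply: tameD => //; exact: tame_cst.
have tB : tame (fun x => psi x - b) by apply: tameD => //; exact: tame_cst.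
have iA := integrable_expR tA; have iB := integrable_expR tB.
have nA : \int[m]_(x in D) expR (phi x - a) = 1.
  by rewrite -log_integralK// log_integralDc// subrr expR0.
have nB : \int[m]_(x in D) expR (psi x - b) = 1.
  by rewrite -log_integralK// log_integralDc// subrr expR0.
set k := expR ((1 - l) * a + l * b).
have -> : \int[m]_(x in D) expR ((1 - l) * phi x + l * psi x) =
    k * \int[m]_(x in D) expR ((1 - l) * (phi x - a) + l * (psi x - b)).
  rewrite -RintegralZl//.
    by apply: eq_Rintegral => x _; rewrite /k -expRD; congr expR; ring.
  by apply: integrable_expR; apply: tameD; exact: tameZ.
rewrite -[leRHS]mulr1 ler_pM2l ?expR_gt0//.
have iA' : m.-integrable D (EFin \o (fun x => (1 - l) * expR (phi x - a))).
  exact: (integrableZl mD (1 - l) iA).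
have iB' : m.-integrable D (EFin \o (fun x => l * expR (psi x - b))).
  exact: (integrableZl mD l iB).
have eA : \int[m]_(x in D) ((1 - l) * expR (phi x - a)) = 1 - l.
  by transitivity ((1 - l) * \int[m]_(x in D) expR (phi x - a));
    [exact: (RintegralZl _ mD iA)|rewrite nA mulr1].
have eB : \int[m]_(x in D) (l * expR (psi x - b)) = l.
  by transitivity (l * \int[m]_(x in D) expR (psi x - b));
    [exact: (RintegralZl _ mD iB)|rewrite nB mulr1].
have E : \int[m]_(x in D) ((1 - l) * expR (phi x - a) + l * expR (psi x - b)) = 1.
  exact: (etrans (RintegralD mD iA' iB') (etrans (f_equal2 +%R eA eB) (subrK l 1))).
rewrite -[leRHS]E; apply: le_Rintegral.
- exact: mD.
- by apply: integrable_expR; apply: tameD; exact: tameZ.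
- exact: (integrableD mD iA' iB').
- by move=> x Dx; exact: expR_convex.
Qed.

Lemma measurable_log_integral d' (Y : measurableType d') (F : T * Y -> R) :
  measurable_fun setT F ->
  measurable_fun setT (fun y => L (fun x => F (x, y))).
Proof.
move=> mF; apply: measurableT_comp; first exact: measurable_ln.
rewrite /Rintegral; apply: (@measurableT_comp _ _ _ _ _ _ fine); first by [].
under eq_fun do rewrite integral_mkcond.
pose h (z : T * Y) := (((fun z => expR (F z)) \* (\1_D \o fst)) z)%:E.
have mh : measurable_fun setT h.
  apply/measurable_EFinP; apply: measurable_funM.
    exact: measurableT_comp.
  by apply: measurableT_comp; [exact: measurable_indic|exact: measurable_fst].
have h0 z : (0 <= h z)%E.
  by rewrite lee_fin mulr_ge0 ?expR_ge0// /= indicE ler0n.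
have := @measurable_fun_fubini_tonelli_G _ _ T Y R m h mh h0.
apply: eq_measurable_fun => y _; apply: eq_integral => x _.
rewrite patchE /h /= indicE; case: ifPn => _; first by rewrite mulr1.
by rewrite mulr0.
Qed.

End log_integral.

#[global] Opaque log_integral.

(** * Convexity of inverse half-plane integrals *)

Lemma convex_comb_gt0 {R : realType} (l x y : R) :
  0 <= l <= 1 -> 0 < x -> 0 < y -> 0 < (1 - l) * x + l * y.
Proof. by move=> /andP[l0 l1] x0 y0; nra. Qed.

Lemma divr_3_cancel {R : realType} (p c : R) : 0 < p ->
  - p^-1 * c = - (3%:R * ((3 * p)^-1 * c)).
Proof. by move=> p0; field; rewrite gt_eqF. Qed.

Section half_plane.
Context d (T : measurableType d) (R : realType).
Variables (m : {sigma_finite_measure set T -> \bar R}) (D : set T).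
Hypotheses (mD : measurable D) (D_gt0 : (0 < m D)%E) (D_fin : (m D < +oo)%E).
Variables (p : R) (p_gt0 : 0 < p).
Local Notation mu := (@lebesgue_measure R).
Local Notation T2 := (measurableTypeR R * measurableTypeR R)%type.
Local Notation tame := (tame D).
Local Notation L := (log_integral m D).
Implicit Types xi eta : T -> R.

(** The function exp (- h) of the support function h of the image of D under
    (xi, eta), up to the normalisation by the measure of D. *)
Definition exp_support xi eta (y : R * R) : R :=
  expR (- p^-1 * L (fun x => p * (xi x * y.1 + eta x * y.2))).
Local Notation G := exp_support.

Lemma exp_support_ge0E xi eta y : (0 <= (G xi eta y)%:E)%E.
Proof. by rewrite lee_fin expR_ge0. Qed.

Lemma tame_pairing xi eta a b : tame xi -> tame eta ->
  tame (fun x => p * (xi x * a + eta x * b)).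
Proof.
move=> t1 t2; apply: tameZ; apply: tameD.
  by under eq_fun do rewrite mulrC; exact: tameZ.
by under eq_fun do rewrite mulrC; exact: tameZ.
Qed.

Lemma measurable_exp_support xi eta : measurable_fun setT xi ->
  measurable_fun setT eta -> measurable_fun [set: T2] (G xi eta : T2 -> R).
Proof.
move=> mxi meta; apply: measurableT_comp => //.
apply: measurable_funM => //.
apply: (@measurable_log_integral _ T R m D mD _ T2
  (fun z : T * T2 => p * (xi z.1 * z.2.1 + eta z.1 * z.2.2))).
have m2 : measurable_fun [set: T * T2] (@snd T T2) by exact: measurable_snd.
apply: measurable_funM => //; apply: measurable_funD.
  apply: measurable_funM.
    by apply: measurableT_comp => //; exact: measurable_fst.
  by apply: (measurableT_comp (@measurable_fst _ _ _ _)).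
apply: measurable_funM.
  by apply: measurableT_comp => //; exact: measurable_fst.
by apply: (measurableT_comp (@measurable_snd _ _ _ _)).
Qed.

Definition half_integral xi eta : \bar R :=
  (\int[mu]_(r in `]0%R, +oo[) \int[mu]_s (G xi eta (r, s))%:E)%E.
Local Notation J := half_integral.

(** The density in the projective coordinates u = 1 / r, v = s / r, which carry the
    Jacobian u ^ -3. *)
Definition projective_density xi eta (u v : R) : R :=
  haar_density u ^+ 3 * G xi eta (haar_density u, v * haar_density u).
Local Notation F := projective_density.

Lemma projective_density_ge0E xi eta u v : (0 <= (F xi eta u v)%:E)%E.
Proof. by rewrite lee_fin mulr_ge0 ?expR_ge0// exprn_ge0// haar_density_ge0. Qed.

Lemma measurable_projective_density xi eta : measurable_fun setT xi ->
  measurable_fun setT eta ->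
  measurable_fun [set: T2] (fun z : T2 => F xi eta z.1 z.2).
Proof.
move=> mxi meta.
have mh : measurable_fun [set: T2] (fun z : T2 => haar_density z.1).
  by apply: (measurableT_comp measurable_haar_density); exact: measurable_fst.
apply: measurable_funM; first exact: measurable_funX.
apply: (measurableT_comp (measurable_exp_support mxi meta)).
apply: measurable_fun_pair => //.
by apply: measurable_funM => //; exact: measurable_snd.
Qed.

Lemma half_integralE xi eta : measurable_fun setT xi -> measurable_fun setT eta ->
  J xi eta = (\int[mu]_u \int[mu]_v (F xi eta u v)%:E)%E.
Proof.
move=> mxi meta.
have mG := measurable_exp_support mxi meta.
pose g (r : R) : \bar R := (\int[mu]_s (G xi eta (r, s))%:E)%E.
have mGE : measurable_fun [set: T2] (fun z : T2 => (G xi eta z)%:E).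
  exact/measurable_EFinP.
have mg : measurable_fun setT g.
  exact: (@measurable_fun_fubini_tonelli_F _ _ _ _ R mu _ mGE
   (fun z => exp_support_ge0E xi eta z)).
have g0 r : (0 <= g r)%E by apply: integral_ge0 => s _; exact: exp_support_ge0E.
pose f (r : R) : \bar R := (`|r|%:E * g r)%E.
have mf : measurable_fun setT f.
  rewrite /f; apply: emeasurable_funM; last exact: mg.
  by apply/measurable_EFinP; exact: normr_measurable.
have f0 r : (0 <= f r)%E by apply: mule_ge0; [rewrite lee_fin|exact: g0].
transitivity (haar_integral f).
  rewrite /J integral_mkcond /haar_integral; apply: eq_integral => r _.
  rewrite patchE /haar_density; case: ifPn => [|].
    rewrite inE/= in_itv/= andbT => r0; rewrite r0 /f muleA -EFinM gtr0_norm//.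
    by rewrite mulVf ?mul1e// gt_eqF.
  rewrite notin_setE/= in_itv/= andbT => /negP/negbTE ->.
  by rewrite mul0e.
rewrite -(haar_integral_inv mf f0) /haar_integral.
apply: eq_integral => u _; rewrite /F /f /haar_density.
case: ifPn => u0; last first.
  rewrite mul0e; apply/esym; apply: integral0_eq => v _.
  by rewrite expr0n mul0r.
have ui : 0 < u^-1 by rewrite invr_gt0.
have mGu : measurable_fun setT (fun s : R => (G xi eta (u^-1, s))%:E).
  by apply: (measurableT_comp mGE); exact: measurable_fun_pair.
rewrite gtr0_norm// /g (integral_affine_pos 0 ui mGu); last first.
  by move=> s; exact: exp_support_ge0E.
rewrite !muleA -!EFinM.
rewrite -ge0_integralZl.
- by apply: eq_integral => v _; rewrite addr0 -EFinM !exprS expr0 mulr1 mulrA [v * _]mulrC.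
- exact: measurableT.
- apply: (measurableT_comp mGu).
  by apply: measurable_funD => //; apply: measurable_funM.
- by move=> v _; exact: exp_support_ge0E.
- by rewrite lee_fin !mulr_ge0// ltW.
Qed.

(** With [A(u, v, xi) = u * ln (int_D exp (p (xi + v eta) / u)) / p], the
    perspective of a convex function, [F = u^-3 exp (- A / u)], so that
    [F^(-1/3) = u exp (A / 3u)] is again a perspective of a convex function. *)
Lemma projective_density_concave xi0 xi1 eta l u0 u1 :
  tame xi0 -> tame xi1 -> tame eta -> 0 <= l <= 1 ->
  inv_pow_concave 3 l (fun v => (F xi0 eta u0 v)%:E) (fun v => (F xi1 eta u1 v)%:E)
   (fun v => (F (fun x => (1 - l) * xi0 x + l * xi1 x) eta ((1 - l) * u0 + l * u1) v)%:E).
Proof.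
move=> t0 t1 te l01 v0 v1 a b a0 b0; rewrite !lee_fin.
have /andP[l0 l1] := l01.
have pos u xi v c : 0 < c -> c ^- 3 <= F xi eta u v -> 0 < u.
  move=> c0 h; rewrite ltNge; apply/negP => un; move: h.
  rewrite /F /haar_density ltNge un /= expr0n mul0r leNgt.
  by rewrite invr_gt0 exprn_gt0.
move=> h0 h1.
have u0p := pos _ _ _ _ a0 h0; have u1p := pos _ _ _ _ b0 h1.
set u := (1 - l) * u0 + l * u1; set v := (1 - l) * v0 + l * v1.
have up : 0 < u by exact: convex_comb_gt0.
pose E xi w z := L (fun x => p * (xi x * w^-1 + eta x * (z / w))).
have FE xi w z : 0 < w ->
    F xi eta w z = (w * expR ((3 * p)^-1 * E xi w z)) ^- 3.
  move=> w0; rewrite /F /haar_density w0 exprMn invfM exprVn; congr (_ * _).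
  rewrite -expRM_natl -expRN; congr expR; rewrite /E.
  have -> : z * w^-1 = z / w by [].
  exact: divr_3_cancel.
have third (w c : R) : 0 < w -> 0 < c -> (c ^- 3 <= w ^- 3) = (w <= c).
  by move=> w0 c0; rewrite lef_pV2 ?posrE ?exprn_gt0// ler_pXn2r// nnegrE ltW.
have {}h0 : u0 * expR ((3 * p)^-1 * E xi0 u0 v0) <= a.
  by move: h0; rewrite (FE _ _ _ u0p) (third _ _ (mulr_gt0 u0p (expR_gt0 _)) a0).
have {}h1 : u1 * expR ((3 * p)^-1 * E xi1 u1 v1) <= b.
  by move: h1; rewrite (FE _ _ _ u1p) (third _ _ (mulr_gt0 u1p (expR_gt0 _)) b0).
have ab0 : 0 < (1 - l) * a + l * b by exact: convex_comb_gt0.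
rewrite (FE _ _ _ up) (third _ _ (mulr_gt0 up (expR_gt0 _)) ab0).
pose t := l * u1 / u.
have t01 : 0 <= t <= 1.
  rewrite /t divr_ge0 ?mulr_ge0 ?(ltW up) ?(ltW u1p)//= ler_pdivrMr// mul1r.
  by rewrite lerDr mulr_ge0 ?subr_ge0// ltW.
have tu : t * u = l * u1 by rewrite /t divfK ?gt_eqF.
have tu' : (1 - t) * u = (1 - l) * u0 by rewrite mulrBl tu mul1r /u; ring.
have EE : E (fun x => (1 - l) * xi0 x + l * xi1 x) u v <=
    (1 - t) * E xi0 u0 v0 + t * E xi1 u1 v1.
  apply: le_trans (log_integral_convex mD D_gt0 D_fin _ _ t01); last 2 first.
  - exact: tame_pairing.
  - exact: tame_pairing.
  rewrite /E le_eqVlt; apply/orP; left; apply/eqP; congr L; apply/funext => x.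
  have e1 : (1 - t) / u0 = (1 - l) / u.
    have -> : 1 - t = (1 - l) * u0 / u by rewrite -tu' mulfK ?gt_eqF.
    by rewrite (mulrAC _ u^-1) mulfK ?gt_eqF.
  have e2 : t / u1 = l / u by rewrite /t (mulrAC _ u^-1) mulfK ?gt_eqF.
  transitivity (p * ((xi0 x + v0 * eta x) * ((1 - l) / u) + (xi1 x + v1 * eta x) * (l / u))).
    by rewrite /v; ring.
  by rewrite -e1 -e2; ring.
have e3 : 0 < (3 * p)^-1 by rewrite invr_gt0 mulr_gt0.
apply: (@le_trans _ _ (u * expR ((3 * p)^-1 * ((1 - t) * E xi0 u0 v0 + t * E xi1 u1 v1)))).
  by rewrite ler_pM2l// ler_expR ler_pM2l.
apply: (@le_trans _ _ (u * ((1 - t) * expR ((3 * p)^-1 * E xi0 u0 v0) +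
    t * expR ((3 * p)^-1 * E xi1 u1 v1)))).
  rewrite ler_pM2l//.
  have distr (c A B : R) : c * ((1 - t) * A + t * B) = (1 - t) * (c * A) + t * (c * B).
    by ring.
  by rewrite distr; exact: expR_convex.
have regroup (A B : R) : u * ((1 - t) * A + t * B) = (1 - l) * (u0 * A) + l * (u1 * B).
  by rewrite (mulrA (1 - l)) (mulrA l) -tu' -tu; ring.
rewrite regroup.
by apply: lerD; apply: ler_wpM2l => //; rewrite subr_ge0.
Qed.

(** In projective coordinates the density to the power -1/3 is convex in u, v and
    xi jointly, so that integrating v and then u leaves a function of xi whose
    inverse is convex. *)
Lemma half_integral_inv_convex xi0 xi1 eta l a b :
  tame xi0 -> tame xi1 -> tame eta -> 0 < l < 1 -> 0 < a -> 0 < b ->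
  ((a^-1)%:E <= J xi0 eta)%E -> ((b^-1)%:E <= J xi1 eta)%E ->
  ((((1 - l) * a + l * b)^-1)%:E <= J (fun x => (1 - l) * xi0 x + l * xi1 x)%R eta)%E.
Proof.
move=> t0 t1 te l01 a0 b0.
have tmix (x y : T -> R) k : tame x -> tame y -> tame (fun z => (1 - k) * x z + k * y z).
  by move=> tx ty; apply: tameD; exact: tameZ.
have me : measurable_fun setT eta by case: te.
have mt (x : T -> R) : tame x -> measurable_fun setT x by case.
have mF x : tame x -> measurable_fun [set: T2] (fun z : T2 => (F x eta z.1 z.2)%:E).
  by move=> tx; apply/measurable_EFinP; apply: measurable_projective_density => //; exact: mt.
have mFu x u : tame x -> measurable_fun setT (fun v : R => (F x eta u v)%:E).
  move=> tx; have mu_v : measurable_fun setT (fun v : R => (u, v) : T2).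
    exact: measurable_fun_pair.
  exact: (measurableT_comp (mF _ tx) mu_v).
pose k x (u : R) := (\int[mu]_v (F x eta u v)%:E)%E.
have mk x : tame x -> measurable_fun setT (k x).
  move=> tx; exact: (@measurable_fun_fubini_tonelli_F _ _ _ _ R mu _ (mF _ tx)
    (fun z => projective_density_ge0E x eta z.1 z.2)).
have k0 x u : (0 <= k x u)%E.
  by apply: integral_ge0 => v _; exact: projective_density_ge0E.
have selfk (x : T -> R) (q : R) : (fun z : T => (1 - q) * x z + q * x z) = x.
  by apply/funext => z; ring.
have step x y q : tame x -> tame y -> 0 < q < 1 ->
    inv_pow_concave 2 q (k x) (k y) (k (fun z => (1 - q) * x z + q * y z)).
  move=> tx ty q01 u0 u1 c e c0 e0.
  have q01' : 0 <= q <= 1 by lra.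
  apply: (@borell_brascamp_lieb R 2 q (fun v => (F x eta u0 v)%:E)
    (fun v => (F y eta u1 v)%:E) _ c e q01).
  - exact: mFu.
  - exact: mFu.
  - by apply: mFu; exact: tmix.
  - by move=> v; exact: projective_density_ge0E.
  - by move=> v; exact: projective_density_ge0E.
  - by move=> v; exact: projective_density_ge0E.
  - exact: projective_density_concave.
  - move=> r r01; have := @projective_density_concave x x eta r u0 u0 tx tx te r01.
    by rewrite selfk (_ : (1 - r) * u0 + r * u0 = u0)//; ring.
  - move=> r r01; have := @projective_density_concave y y eta r u1 u1 ty ty te r01.
    by rewrite selfk (_ : (1 - r) * u1 + r * u1 = u1)//; ring.
  - exact: c0.
  - exact: e0.
have stepx x : tame x -> forall q, 0 <= q <= 1 -> inv_pow_concave 2 q (k x) (k x) (k x).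
  move=> tx; apply: inv_pow_concave_closed => q q01.
  by have := step x x q tx tx q01; rewrite selfk.
have JE x : tame x -> J x eta = (\int[mu]_u k x u)%E.
  by move=> tx; exact: (half_integralE (mt _ tx) me).
rewrite (JE _ t0) (JE _ t1) (JE _ (tmix _ _ l t0 t1)).
move=> ha hb.
have := @borell_brascamp_lieb R 1 l (k xi0) (k xi1)
  (k (fun z => (1 - l) * xi0 z + l * xi1 z)) a b l01.
rewrite !expr1; apply.
- exact: mk.
- exact: mk.
- by apply: mk; exact: tmix.
- exact: k0.
- exact: k0.
- exact: k0.
- exact: step.
- exact: stepx.
- exact: stepx.
- exact: a0.
- exact: b0.
- exact: ha.
- exact: hb.
Qed.

End half_plane.

(** * Quasi-concavity along shadow systems *)

(** Two functions P and M of a time t and a translation c, varying in opposite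
    directions with c, with inverses convex in (t, c). Once it is minimised over
    c, their sum is quasi-concave in t: thresholds a and b split the translations
    at each end, at a point where P exceeds a and M exceeds b, and the interpolated
    point at time 0 does so too. *)
Lemma balanced_quasiconcave {R : realType} (P M : R -> R -> \bar R)
    (t1 t2 : R) (B : \bar R) :
  (forall l t0 c0 t1 c1 a b, 0 < l < 1 -> 0 < a -> 0 < b ->
    ((a^-1)%:E <= P t0 c0)%E -> ((b^-1)%:E <= P t1 c1)%E ->
    ((((1 - l) * a + l * b)^-1)%:E <=
     P ((1 - l) * t0 + l * t1)%R ((1 - l) * c0 + l * c1)%R)%E) ->
  (forall l t0 c0 t1 c1 a b, 0 < l < 1 -> 0 < a -> 0 < b ->
    ((a^-1)%:E <= M t0 c0)%E -> ((b^-1)%:E <= M t1 c1)%E ->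
    ((((1 - l) * a + l * b)^-1)%:E <=
     M ((1 - l) * t0 + l * t1)%R ((1 - l) * c0 + l * c1)%R)%E) ->
  (forall t c c', c <= c' -> (P t c' <= P t c)%E) ->
  (forall t c c', c <= c' -> (M t c <= M t c')%E) ->
  (forall t a, exists c, (a%:E <= P t c)%E) ->
  (forall t c, exists2 k : R, 0 < k & (k%:E <= P t c)%E) ->
  (forall t c, 0 <= P t c)%E -> (forall t c, 0 <= M t c)%E ->
  t1 < 0 -> 0 < t2 ->
  (forall c, (B <= P t1 c + M t1 c)%E) -> (forall c, (B <= P t2 c + M t2 c)%E) ->
  (B <= P 0%R 0%R + M 0%R 0%R)%E.
Proof.
move=> P_convex M_convex P_decr M_incr P_large P_gt0 P0 M0 t10 t20 H1 H2.
rewrite leNgt; apply/negP => ltB.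
have PMfin : (P 0%R 0%R + M 0%R 0%R < +oo)%E by apply: lt_le_trans ltB (leey _).
have Pfin : P 0%R 0%R \is a fin_num.
  rewrite ge0_fin_numE; last exact: P0.
  by apply: le_lt_trans PMfin; rewrite leeDl.
have Mfin : M 0%R 0%R \is a fin_num.
  rewrite ge0_fin_numE; last exact: M0.
  by apply: le_lt_trans PMfin; rewrite leeDr.
have [x0 Px0] : exists x : R, P 0%R 0%R = x%:E by exists (fine (P 0%R 0%R)); rewrite fineK.
have [y0 My0] : exists y : R, M 0%R 0%R = y%:E by exists (fine (M 0%R 0%R)); rewrite fineK.
have x00 : 0 <= x0 by rewrite -lee_fin -Px0; exact: P0.
have y00 : 0 <= y0 by rewrite -lee_fin -My0; exact: M0.
have [e e0 eB] : exists2 e : R, 0 < e & ((x0 + e + (y0 + e))%:E <= B)%E.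
  rewrite Px0 My0 -EFinD in ltB.
  have [BE|Bn] := eqVneq B +oo%E; first by exists 1; rewrite ?BE ?leey.
  have Bf : B \is a fin_num.
    rewrite fin_numElt (lt_trans _ ltB) ?ltNyr//=; by rewrite ltey.
  move: ltB; rewrite -(fineK Bf) lte_fin => ltB.
  exists ((fine B - (x0 + y0)) / 2); first by rewrite divr_gt0// subr_gt0.
  by rewrite lee_fin le_eqVlt; apply/orP; left; apply/eqP; field.
(* Thresholds slightly above the values at time 0, with sum at most B: at both
   ends, wherever P is below a, M is above b. *)
pose a := x0 + e; pose b := y0 + e.
have a0 : 0 < a by rewrite ltr_wpDl.
have b0 : 0 < b by rewrite ltr_wpDl.
have alt t c : (B <= P t c + M t c)%E -> (a%:E <= P t c)%E \/ (b%:E <= M t c)%E.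
  move=> hB; have [h|h] := leP a%:E (P t c); first by left.
  right; rewrite leNgt; apply/negP => h'.
  have : (P t c + M t c < a%:E + b%:E)%E by exact: lteD.
  by apply/negP; rewrite -leNgt; apply: le_trans hB; exact: eB.
pose l := - t1 / (t2 - t1).
have d0 : 0 < t2 - t1 by lra.
have l01 : 0 < l < 1.
  rewrite /l divr_gt0 ?oppr_gt0//= ltr_pdivrMr// mul1r; lra.
have lt : (1 - l) * t1 + l * t2 = 0 by rewrite /l; field; rewrite gt_eqF.
have /andP[l0 l1] := l01.
have k0 : 0 < 1 - l by rewrite subr_gt0.
have avg (q : R) : (1 - l) * q + l * q = q by ring.
have mixP c1 c2 : (a%:E <= P t1 c1)%E -> (a%:E <= P t2 c2)%E ->
    (a%:E <= P 0%R ((1 - l) * c1 + l * c2)%R)%E.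
  move=> h1 h2; have ai : 0 < a^-1 by rewrite invr_gt0.
  have := @P_convex l t1 c1 t2 c2 a^-1 a^-1 l01 ai ai.
  by rewrite avg lt invrK; apply.
have mixM c1 c2 : (b%:E <= M t1 c1)%E -> (b%:E <= M t2 c2)%E ->
    (b%:E <= M 0%R ((1 - l) * c1 + l * c2)%R)%E.
  move=> h1 h2; have bi : 0 < b^-1 by rewrite invr_gt0.
  have := @M_convex l t1 c1 t2 c2 b^-1 b^-1 l01 bi bi.
  by rewrite avg lt invrK; apply.
have Pneg c : (a%:E <= P 0%R c)%E -> c < 0.
  move=> h; rewrite ltNge; apply/negP => c0.
  have := le_trans h (P_decr 0 _ _ c0); rewrite Px0 lee_fin /a.
  by rewrite gerDl leNgt e0.
have Mpos c : (b%:E <= M 0%R c)%E -> 0 < c.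
  move=> h; rewrite ltNge; apply/negP => c0.
  have := le_trans h (M_incr 0 _ _ c0); rewrite My0 lee_fin /b.
  by rewrite gerDl leNgt e0.
pose D1 := [set c | (a%:E <= P t1 c)%E]; pose D2 := [set c | (a%:E <= P t2 c)%E].
have [q1 q1D] : exists c, D1 c by exact: P_large.
have [q2 q2D] : exists c, D2 c by exact: P_large.
have D12 c1 c2 : D1 c1 -> D2 c2 -> (1 - l) * c1 + l * c2 < 0.
  by move=> h1 h2; apply: Pneg; exact: mixP.
have sD1 : has_sup D1.
  split; first by exists q1.
  exists (- (l * q2) / (1 - l)) => c cD; rewrite ler_pdivlMr// mulrC.
  by have := D12 _ _ cD q2D; rewrite -ltrBrDr sub0r => /ltW.
have sD2 : has_sup D2.
  split; first by exists q2.
  exists (- ((1 - l) * q1) / l) => c cD; rewrite ler_pdivlMr// mulrC.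
  by have := D12 _ _ q1D cD; rewrite -ltrBrDl sub0r => /ltW.
(* At the suprema of D1 and D2 the roles switch from P to M. Their combination is
   neither negative, by M, nor positive, by P, hence is 0, and P at time 0 reaches
   a arbitrarily close to the translation 0. *)
have near0 e' : 0 < e' -> (a%:E <= P 0%R (- e')%R)%E.
  move=> e'0; have h0 : 0 < e' / 2 by rewrite divr_gt0.
  have [d1 d1D d1e] := sup_adherent h0 sD1.
  have [d2 d2D d2e] := sup_adherent h0 sD2.
  have u1 : (b%:E <= M t1 (sup D1 + e' / 2)%R)%E.
    case: (alt t1 (sup D1 + e' / 2) (H1 _)) => // h.
    have : sup D1 + e' / 2 <= sup D1 by apply: ub_le_sup => //; case: sD1.
    by rewrite gerDl leNgt h0.
  have u2 : (b%:E <= M t2 (sup D2 + e' / 2)%R)%E.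
    case: (alt t2 (sup D2 + e' / 2) (H2 _)) => // h.
    have : sup D2 + e' / 2 <= sup D2 by apply: ub_le_sup => //; case: sD2.
    by rewrite gerDl leNgt h0.
  have := Mpos _ (mixM _ _ u1 u2).
  have := mixP _ _ d1D d2D.
  move: d1e d2e; set s1 := sup D1; set s2 := sup D2 => d1e d2e h pos.
  apply: le_trans h (P_decr 0 _ _ _).
  have : (1 - l) * (s1 - e' / 2) + l * (s2 - e' / 2) <= (1 - l) * d1 + l * d2.
    by apply: lerD; rewrite ler_pM2l// ltW.
  apply: le_trans.
  move: pos; clear -l0 l1; set h := e' / 2.
  have -> : e' = 2 * h by rewrite /h; field.
  nra.
have x0p : 0 < x0.
  by have [k kk] := P_gt0 0 0; rewrite Px0 lee_fin; exact: lt_le_trans.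
have [k kk Pk] := P_gt0 0 1.
have ax : a^-1 < x0^-1 by rewrite ltf_pV2 ?posrE// /a ltrDl.
(* Convexity of 1 / P between - r / (1 - r), where P reaches a, and 1 bounds 1 / P
   at 0 by a value that tends to 1 / a, hence to less than 1 / x0. *)
have small r : 0 < r < 1 -> x0^-1 <= (1 - r) * a^-1 + r * k^-1.
  move=> /andP[r0 r1].
  have r1' : 0 < 1 - r by rewrite subr_gt0.
  have er : 0 < r / (1 - r) by rewrite divr_gt0.
  have ai : 0 < a^-1 by rewrite invr_gt0.
  have ki : 0 < k^-1 by rewrite invr_gt0.
  have r01 : 0 < r < 1 by rewrite r0.
  have := @P_convex r 0 (- (r / (1 - r))) 0 1 a^-1 k^-1 r01 ai ki.
  rewrite !invrK => /(_ (near0 _ er) Pk).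
  have -> : (1 - r) * 0 + r * 0 = 0 by rewrite !mulr0 addr0.
  have -> : (1 - r) * - (r / (1 - r)) + r * 1 = 0.
    by rewrite mulrN mulrC divfK ?gt_eqF// mulr1 addNr.
  rewrite Px0 lee_fin => h.
  have q0 : 0 < (1 - r) * a^-1 + r * k^-1 by rewrite addr_gt0// mulr_gt0.
  by rewrite -[leRHS]invrK lef_pV2 ?posrE ?invr_gt0.
pose r := Num.min (2^-1) ((x0^-1 - a^-1) * k / 2).
have dx : 0 < x0^-1 - a^-1 by rewrite subr_gt0.
have r0 : 0 < r by rewrite /r lt_min invr_gt0 ltr0n /= !mulr_gt0 ?invr_gt0.
have r1 : r < 1.
  by rewrite /r gt_min invf_lt1 ?ltr1n.
have r01 : 0 < r < 1 by rewrite r0.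
have := small r r01; rewrite leNgt => /negP; apply.
have rk : r * k^-1 <= (x0^-1 - a^-1) / 2.
  by rewrite ler_pdivrMr// mulrAC /r ge_min lexx orbT.
have ra : (1 - r) * a^-1 <= a^-1.
  rewrite -[leRHS]mul1r; apply: ler_wpM2r; first by rewrite invr_ge0 ltW.
  by rewrite gerBl ltW.
apply: le_lt_trans (lerD ra rk) _.
rewrite -ltrBrDl ltr_pdivrMr// mulr_natr mulr2n ltrDl; exact: dx.
Qed.

Section shadow_system.
Context d (T : measurableType d) (R : realType).
Variables (m : {sigma_finite_measure set T -> \bar R}) (D : set T).
Hypotheses (mD : measurable D) (D_gt0 : (0 < m D)%E) (D_fin : (m D < +oo)%E).
Variables (p : R) (p_gt0 : 0 < p).
Local Notation mu := (@lebesgue_measure R).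
Local Notation T2 := (measurableTypeR R * measurableTypeR R)%type.
Local Notation tame := (tame D).
Local Notation L := (log_integral m D).
Local Notation G := (exp_support m D p).
Local Notation J := (half_integral m D p).
Implicit Types xi eta beta : T -> R.

Definition plane_integral xi eta : \bar R :=
  (\int[lebesgue2 R]_y (G xi eta y)%:E)%E.
Local Notation N := plane_integral.

Let mGE xi eta : tame xi -> tame eta ->
  measurable_fun [set: T2] (fun z : T2 => (G xi eta z)%:E).
Proof.
move=> [mxi _] [meta _]; apply/measurable_EFinP.
exact: measurable_exp_support.
Qed.

Let g xi eta (r : R) : \bar R := (\int[mu]_s (G xi eta (r, s))%:E)%E.

Let mg xi eta : tame xi -> tame eta -> measurable_fun setT (g xi eta).
Proof.
move=> tx te; exact: (@measurable_fun_fubini_tonelli_F _ _ _ _ R mu _ (mGE tx te)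
   (fun z => exp_support_ge0E m D p xi eta z)).
Qed.

Let g0 xi eta r : (0 <= g xi eta r)%E.
Proof. by apply: integral_ge0 => s _; exact: exp_support_ge0E. Qed.

Let mGr xi eta r : tame xi -> tame eta ->
  measurable_fun setT (fun s : R => (G xi eta (r, s))%:E).
Proof.
move=> tx te; have mrs : measurable_fun setT (fun s : R => (r, s) : T2).
  exact: measurable_fun_pair.
exact: (measurableT_comp (mGE tx te) mrs).
Qed.

(** The left half-plane is the right half-plane for - xi. *)
Lemma plane_integral_split xi eta : tame xi -> tame eta ->
  (N xi eta = J xi eta + J (fun x => (- xi x)%R) eta)%E.
Proof.
move=> tx te.
have mgx := mg tx te.
rewrite /N (integral2E (mGE tx te) (fun z => exp_support_ge0E m D p xi eta z)).
rewrite -/(g xi eta).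
have mA : measurable (`]-oo, 0%R[%classic : set (measurableTypeR R)).
  exact: measurable_itv.
have mB : measurable (`[0%R, +oo[%classic : set (measurableTypeR R)).
  exact: measurable_itv.
have dAB : [disjoint `]-oo, 0%R[%classic & (`[0%R, +oo[%classic : set R)].
  apply/disj_setPS => r [] /=; rewrite !in_itv/= andbT => r0.
  by rewrite leNgt r0.
have AB : `]-oo, 0%R[%classic `|` `[0%R, +oo[%classic = [set: R].
  apply/seteqP; split => r //= _; rewrite !in_itv/= andbT.
  by have [h|h] := ltP r 0; [left|right].
have := @ge0_integral_setU _ _ R mu _ _ mA mB _ (measurable_funTS mgx)
  (fun x _ => g0 xi eta x) dAB.
rewrite AB => E; apply: (etrans E); rewrite addeC; apply: f_equal2.
  exact: (esym (integral_itv_obnd_cbnd (measurable_funTS mgx))).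
rewrite integral_mkcond integral_opp; last 2 first.
- by apply/(measurable_restrictT _ mA); exact: measurable_funTS.
- by move=> r; apply: erestrict_ge0 => ? _; exact: g0.
rewrite /J /half_integral [in RHS]integral_mkcond; apply: eq_integral => r _.
rewrite !patchE.
have -> : (- r \in `]-oo, 0%R[%classic) = (r \in `]0%R, +oo[%classic).
  by apply/idP/idP; rewrite !inE/= !in_itv/= andbT oppr_lt0.
case: (r \in _); last by exact: erefl.
rewrite /g.
apply: eq_integral => s _; rewrite /exp_support.
congr (expR (_ * L _))%:E; by apply/funext => x /=; rewrite mulrN mulNr.
Qed.

Lemma half_integral_le xi xi' eta : tame xi -> tame xi' -> tame eta ->
  (forall x, xi x <= xi' x) -> (J xi' eta <= J xi eta)%E.
Proof.
move=> tx tx' te h; have ip : 0 < p^-1 by rewrite invr_gt0.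
apply: ge0_le_integral.
- exact: measurable_itv.
- by move=> r _; exact: g0.
- by apply: measurable_funTS; exact: mg.
- by apply: measurable_funTS; exact: mg.
move=> r /=; rewrite in_itv/= andbT => r0; apply: ge0_le_integral.
- exact: measurableT.
- by move=> s _; exact: exp_support_ge0E.
- exact: mGr.
- exact: mGr.
move=> s _; rewrite lee_fin ler_expR !mulNr lerN2 (ler_pM2l ip).
apply: (log_integral_le mD D_gt0 D_fin); [exact: tame_pairing|exact: tame_pairing|].
move=> x _; rewrite ler_pM2l// lerD2r; apply: ler_wpM2r; first exact: ltW.
exact: h.
Qed.

(** On the box [1, 2] x [0, 1] the translation by - c multiplies the integrand by
    at least exp c. *)
Lemma half_integral_shift_ge xi eta : tame xi -> tame eta ->
  exists2 k : R, 0 < k & forall c, 0 <= c ->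
    ((expR c * k)%:E <= J (fun x => (xi x - c)%R) eta)%E.
Proof.
move=> tx te; have [mxi [A hA]] := tx; have [me [B hB]] := te.
pose l := L (fun=> p * (`|A| * 2 + `|B|)).
exists (expR (- p^-1 * l)); first exact: expR_gt0.
have ip : 0 < p^-1 by rewrite invr_gt0.
move=> c c0; have txc : tame (fun x => xi x - c).
  by apply: tameD => //; exact: tame_cst.
have low r s : 1 <= r <= 2 -> 0 <= s <= 1 ->
    expR c * expR (- p^-1 * l) <= G (fun x => xi x - c) eta (r, s).
  move=> /andP[r1 r2] /andP[s0 s1]; rewrite -expRD ler_expR /exp_support /=.
  have -> : L (fun x => p * ((xi x - c) * r + eta x * s)) =
      L (fun x => p * (xi x * r + eta x * s)) - p * (c * r).
    rewrite -(log_integralDc mD D_gt0 D_fin _ (tame_pairing p r s tx te)).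
    by congr L; apply/funext => x; ring.
  rewrite mulrBr addrC; apply: lerD.
    rewrite !mulNr lerN2 (ler_pM2l ip); apply: (log_integral_le mD D_gt0 D_fin).
    - exact: tame_pairing.
    - exact: tame_cst.
    move=> x Dx; rewrite ler_pM2l//; apply: lerD.
      apply: le_trans (ler_norm _) _; rewrite normrM; apply: ler_pM => //.
        by apply: le_trans (hA x Dx) _; exact: ler_norm.
      by rewrite ger0_norm// (le_trans _ r1).
    apply: le_trans (ler_norm _) _; rewrite normrM -[leRHS]mulr1.
    apply: ler_pM => //; last by rewrite ger0_norm.
    by apply: le_trans (hB x Dx) _; exact: ler_norm.
  rewrite mulNr opprK mulrA mulVf ?gt_eqF// mul1r -[leLHS]mulr1.
  by apply: ler_wpM2l.
set k := expR c * expR _.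
have k0 : (0 <= k%:E)%E by rewrite lee_fin mulr_ge0 ?expR_ge0.
have len (a : R) : mu `[a, a + 1]%classic = 1%E.
  rewrite lebesgue_measure_itv/= lte_fin ltrDl ltr01 -EFinB.
  by congr EFin; ring.
have Ik (a : R) : (\int[mu]_(_ in `[a, (a + 1)%R]) k%:E = k%:E)%E.
  apply: (etrans (integral_cst mu _ k%:E)); first exact: measurable_itv.
  exact: (etrans (f_equal (mule k%:E) (len a)) (mule1 _)).
have inner r : 1 <= r <= 2 -> (k%:E <= g (fun x => (xi x - c)%R) eta r)%E.
  move=> r12; apply: (@le_trans _ _ (\int[mu]_(s in `[0%R, (0 + 1)%R]) k%:E)%E).
    by rewrite (Ik 0) lexx.
  apply: (@le_trans _ _ (\int[mu]_(s in `[0%R, (0 + 1)%R])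
      (G (fun x => xi x - c)%R eta (r, s))%:E)%E).
    apply: ge0_le_integral.
    - exact: measurable_itv.
    - by move=> s _; exact: k0.
    - exact: measurable_cst.
    - by apply: measurable_funTS; exact: mGr.
    move=> s /=; rewrite in_itv/= add0r => s01; rewrite lee_fin; exact: low.
  apply: ge0_subset_integral.
  - exact: measurable_itv.
  - exact: measurableT.
  - exact: mGr.
  - by move=> s _; exact: exp_support_ge0E.
  - by [].
apply: (@le_trans _ _ (\int[mu]_(s in `[1%R, (1 + 1)%R]) k%:E)%E).
  by rewrite (Ik 1) lexx.
apply: (@le_trans _ _ (\int[mu]_(r in `[1%R, (1 + 1)%R])
    (g (fun x => xi x - c)%R eta r))%E).
  apply: ge0_le_integral.
  - exact: measurable_itv.
  - by move=> s _; exact: k0.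
  - exact: measurable_cst.
  - by apply: measurable_funTS; exact: mg.
  by move=> r /=; rewrite in_itv/= => r12; exact: inner.
apply: ge0_subset_integral.
- exact: measurable_itv.
- exact: measurable_itv.
- by apply: measurable_funTS; exact: mg.
- by move=> r _; exact: g0.
by move=> r /=; rewrite !in_itv/= andbT => /andP[r1 _]; exact: lt_le_trans r1.
Qed.

Section quasiconcavity.
Variables (xi beta eta : T -> R).
Hypotheses (txi : tame xi) (tbeta : tame beta) (teta : tame eta).

(** Position at time t, translated by c, of a shadow system with speed [beta]. *)
Definition shadow (t c : R) (x : T) : R := xi x + (t * beta x + c).

Let tsh t c : tame (shadow t c).
Proof.
by apply: tameD => //; apply: tameD; [exact: tameZ|exact: tame_cst].
Qed.

Let shadow_mix l t0 c0 t1 c1 :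
  (fun x => (1 - l) * shadow t0 c0 x + l * shadow t1 c1 x) =
  shadow ((1 - l) * t0 + l * t1) ((1 - l) * c0 + l * c1).
Proof. by apply/funext => x; rewrite /shadow; ring. Qed.

Let shadow_shift t c : (fun x => shadow t 0 x - - c) = shadow t c.
Proof. by apply/funext => x; rewrite /shadow; ring. Qed.

Let P t c := J (shadow t c) eta.
Let M t c := J (fun x => - shadow t c x) eta.

Let P_convex l t0 c0 t1 c1 a b : 0 < l < 1 -> 0 < a -> 0 < b ->
  ((a^-1)%:E <= P t0 c0)%E -> ((b^-1)%:E <= P t1 c1)%E ->
  ((((1 - l) * a + l * b)^-1)%:E <=
     P ((1 - l) * t0 + l * t1)%R ((1 - l) * c0 + l * c1)%R)%E.
Proof.
move=> l01 a0 b0 ha hb; rewrite /P -shadow_mix.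
exact: (half_integral_inv_convex mD D_gt0 D_fin p_gt0 (tsh t0 c0) (tsh t1 c1) teta
  l01 a0 b0 ha hb).
Qed.

Let M_convex l t0 c0 t1 c1 a b : 0 < l < 1 -> 0 < a -> 0 < b ->
  ((a^-1)%:E <= M t0 c0)%E -> ((b^-1)%:E <= M t1 c1)%E ->
  ((((1 - l) * a + l * b)^-1)%:E <=
     M ((1 - l) * t0 + l * t1)%R ((1 - l) * c0 + l * c1)%R)%E.
Proof.
move=> l01 a0 b0 ha hb; rewrite /M -shadow_mix.
have -> : (fun x => - ((1 - l) * shadow t0 c0 x + l * shadow t1 c1 x)) =
    (fun x => (1 - l) * - shadow t0 c0 x + l * - shadow t1 c1 x).
  by apply/funext => x; ring.
exact: (half_integral_inv_convex mD D_gt0 D_fin p_gt0 (tameN (tsh t0 c0))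
  (tameN (tsh t1 c1)) teta l01 a0 b0 ha hb).
Qed.

Let P_decr t c c' : c <= c' -> (P t c' <= P t c)%E.
Proof.
move=> cc; apply: half_integral_le; [exact: tsh|exact: tsh|exact: teta|].
by move=> x; rewrite /shadow !lerD2l.
Qed.

Let M_incr t c c' : c <= c' -> (M t c <= M t c')%E.
Proof.
move=> cc; apply: half_integral_le; [exact/tameN/tsh|exact/tameN/tsh|exact: teta|].
by move=> x; rewrite /shadow lerN2 !lerD2l.
Qed.

Let large (zeta : T -> R) (a : R) : tame zeta ->
  exists2 c : R, 0 <= c & (a%:E <= J (fun x => (zeta x - c)%R) eta)%E.
Proof.
move=> tz; have [k k0 H] := half_integral_shift_ge tz teta.
exists (`|a| / k); first by rewrite divr_ge0// ltW.
have ak : 0 <= `|a| / k by rewrite divr_ge0// ltW.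
apply: le_trans (H _ ak); rewrite lee_fin.
apply: (@le_trans _ _ (`|a| / k * k)).
  by rewrite divfK ?gt_eqF// ler_norm.
rewrite ler_pM2r//; apply: le_trans (expR_ge1Dx _).
by rewrite lerDr.
Qed.

Let P_large t a : exists c, (a%:E <= P t c)%E.
Proof.
have [c _ h] := large a (tsh t 0); exists (- c).
rewrite /P -shadow_shift; have -> : (fun x => shadow t 0 x - - - c) =
  (fun x => shadow t 0 x - c) by apply/funext => x; rewrite opprK.
exact: h.
Qed.

Let P_gt0 t c : exists2 k : R, 0 < k & (k%:E <= P t c)%E.
Proof.
have [k k0 H] := half_integral_shift_ge (tsh t c) teta; exists k => //.
have := H 0 (lexx 0); rewrite expR0 mul1r.
have -> // : (fun x => shadow t c x - 0) = shadow t c.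
by apply/funext => x; rewrite subr0.
Qed.

Let J_ge0 zeta : (0 <= J zeta eta)%E.
Proof. by apply: integral_ge0 => r _; exact: g0. Qed.

(** The integral over the plane is quasi-concave along a shadow system once it
    is minimised over translations. *)
Lemma shadow_quasiconcave (t1 t2 : R) (B : \bar R) : t1 < 0 -> 0 < t2 ->
  (forall c, (B <= N (shadow t1 c) eta)%E) ->
  (forall c, (B <= N (shadow t2 c) eta)%E) ->
  (B <= N (shadow 0 0) eta)%E.
Proof.
have NE t c : N (shadow t c) eta = (P t c + M t c)%E.
  by apply: plane_integral_split; [exact: tsh|exact: teta].
move=> t10 t20 H1 H2; rewrite NE.
apply: (balanced_quasiconcave P_convex M_convex P_decr M_incr P_large P_gt0 _ _
  t10 t20).
- by move=> t c; exact: J_ge0.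
- by move=> t c; exact: J_ge0.
- by move=> c; rewrite -NE; exact: H1.
- by move=> c; rewrite -NE; exact: H2.
Qed.

End quasiconcavity.

End shadow_system.

(** * Affine invariance of the Mahler volume *)

Section Lp_mahler_volume.
Context {R : realType}.
Variables (p : R) (p_gt0 : 0 < p).
Local Notation mu2 := (lebesgue2 R).
Local Notation T2 := (measurableTypeR R * measurableTypeR R)%type.
Implicit Types (K P : set (R * R)) (w : R * R).

(** What the integrals need from a convex body; unlike convexity it is preserved
    by the shears below. *)
Definition solid K := [/\ measurable (K : set T2),
  exists C, forall x, K x -> `|x.1| <= C /\ `|x.2| <= C & (0 < mu2 K)%E].

Lemma solid_fin K : solid K -> (mu2 K < +oo)%E.
Proof.
move=> [mK [C KC] _].
pose I := `[- `|C|, `|C|]%classic.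
have mI : measurable (I : set (measurableTypeR R)) by exact: measurable_itv.
have KI : K `<=` I `*` I.
  have CC : C <= `|C| by exact: ler_norm.
  move=> x Kx; have [h1 h2] := KC x Kx.
  by split; rewrite /I /= in_itv/= -ler_norml; apply: le_trans CC.
apply: (@le_lt_trans _ _ (mu2 (I `*` I))).
  by apply: measure_le => //; exact: measurableX.
rewrite (_ : mu2 _ = lebesgue_measure I * lebesgue_measure I)%E; last exact: product_measure1E.
by rewrite !lebesgue_measure_itv/=; case: ifPn => _; rewrite ?mule0// -EFinB -EFinM ltry.
Qed.

Definition area K : R := fine (mu2 K).

Lemma areaE K : solid K -> mu2 K = (area K)%:E.
Proof. by move=> sK; rewrite /area fineK// ge0_fin_numE// solid_fin. Qed.

Lemma area_gt0 K : solid K -> 0 < area K.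
Proof. by move=> sK; have [_ _] := sK; rewrite areaE// lte_fin. Qed.

(** The power |K| ^ (1 + 1/p): the second factor is the normalisation of the
    support function by |K|. *)
Definition volume_factor K : R := area K * expR (p^-1 * ln (area K)).

Lemma volume_factor_gt0 K : solid K -> 0 < volume_factor K.
Proof. by move=> sK; rewrite mulr_gt0 ?expR_gt0 ?area_gt0. Qed.

Definition map_integral K (phi : R * R -> R * R) : \bar R :=
  plane_integral leb2 K p (fun x => (phi x).1) (fun x => (phi x).2).
Local Notation N := map_integral.

Definition translate w (x : R * R) : R * R := (x.1 + w.1, x.2 + w.2).

(** The L^p-Mahler volume of the translate of K by w. *)
Definition translated_mahler K w : \bar R :=
  ((volume_factor K)%:E * N K (translate w))%E.

Definition tame_map K (phi : R * R -> R * R) :=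
  tame K (fun x : T2 => (phi x).1) /\ tame K (fun x : T2 => (phi x).2).

Lemma tame_translate K w : solid K -> tame_map K (translate w).
Proof.
move=> [mK [C KC] _]; split; split => /=.
- by apply: measurable_funD => //; exact: measurable_fst.
- exists (C + `|w.1|) => x Kx; apply: le_trans (ler_normD _ _) _.
  by rewrite lerD2r; case: (KC x Kx).
- by apply: measurable_funD => //; exact: measurable_snd.
- exists (C + `|w.2|) => x Kx; apply: le_trans (ler_normD _ _) _.
  by rewrite lerD2r; case: (KC x Kx).
Qed.

Lemma map_integral_ge0 K phi : (0 <= N K phi)%E.
Proof. by apply: integral_ge0 => y _; exact: exp_support_ge0E. Qed.

Let measurable_density K (phi : R * R -> R * R) : measurable (K : set T2) ->
  tame_map K phi ->
  measurable_fun [set: T2] (fun y : T2 =>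
    (exp_support leb2 K p (fun x : T2 => (phi x).1) (fun x : T2 => (phi x).2) y)%:E).
Proof.
move=> mK [[m1 _] [m2 _]]; apply/measurable_EFinP.
exact: measurable_exp_support.
Qed.

Lemma Lp_mahlerE K : solid K ->
  Lp_mahler p K = ((volume_factor K)%:E * N K id)%E.
Proof.
move=> sK; have [mK _ _] := sK; have a0 := area_gt0 sK.
have tid : tame_map K id.
  have := tame_translate (0, 0) sK.
  have -> // : translate (0, 0) = id.
  by apply/funext => -[x y]; rewrite /translate /= !addr0.
have t1 := tid.1; have t2 := tid.2.
have tK y : tame K (fun x : T2 => p * (x.1 * y.1 + x.2 * y.2)).
  exact: tame_pairing.
have gt0 : (0 < leb2 K)%E by case: sK.
have lty : (leb2 K < +oo)%E by exact: solid_fin.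
have key y : expR (- Lp_support p K y) =
    expR (p^-1 * ln (area K)) *
    exp_support leb2 K p (fun x : T2 => x.1) (fun x : T2 => x.2) y.
  rewrite /Lp_support /exp_support -expRD; congr expR.
  rewrite (_ : (\int[mu2]_(x in K) (expR (p * dot x y) / fine (mu2 K))) =
     expR (log_integral leb2 K (fun x : T2 => p * (x.1 * y.1 + x.2 * y.2))) * (area K)^-1).
    by rewrite lnM ?posrE ?expR_gt0 ?invr_gt0// expRK lnV ?posrE//; ring.
  rewrite (log_integralK mK gt0 lty (tK y)).
  exact: (RintegralZr _ mK (integrable_expR mK lty (tK y))).
rewrite /Lp_mahler areaE// /volume_factor EFinM -muleA; congr (_ * _)%E.
rewrite /N /plane_integral -ge0_integralZl.
- by apply: eq_integral => y _; rewrite key EFinM.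
- exact: measurableT.
- exact: measurable_density.
- by move=> y _; exact: exp_support_ge0E.
- by rewrite lee_fin expR_ge0.
Qed.

Lemma translated_mahler0 K : solid K -> translated_mahler K (0, 0) = Lp_mahler p K.
Proof.
move=> sK; rewrite (Lp_mahlerE sK) /translated_mahler.
have -> : translate (0, 0) = id; last by [].
by apply/funext => -[x y]; rewrite /translate /= !addr0.
Qed.

Section image.
Variables (K : set (R * R)) (d : R) (phi psi : R * R -> R * R).
Hypotheses (sK : solid K) (jphi : jacobian d phi) (tphi : tame_map K phi).
Hypotheses (mpsi : measurable_fun [set: T2] (psi : T2 -> T2)).
Hypotheses (phiK : cancel phi psi) (psiK : cancel psi phi).

Let imageE : phi @` K = psi @^-1` K.
Proof.
apply/seteqP; split => [_ [x Kx <-]|y Ky]; first by rewrite /= phiK.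
by exists (psi y); rewrite ?psiK.
Qed.

Let preimage_imageE : phi @^-1` (phi @` K) = K.
Proof.
apply/seteqP; split => [x [y Ky e]|x Kx]; last by exists x.
by rewrite -(phiK x) -e phiK.
Qed.

Let mphiK : measurable (phi @` K : set T2).
Proof.
by rewrite imageE -[X in measurable X]setTI; apply: mpsi => //; case: sK.
Qed.

Lemma image_measure : mu2 (phi @` K) = (d%:E * mu2 K)%E.
Proof. by rewrite (jacobian_measure jphi mphiK) preimage_imageE. Qed.

Lemma image_solid : solid (phi @` K).
Proof.
split; first exact: mphiK; last first.
  by rewrite image_measure; case: jphi => d0 _ _; case: sK => *; rewrite mule_gt0.
have [[_ [C1 h1]] [_ [C2 h2]]] := tphi.
exists (Num.max C1 C2) => _ [x Kx <-].
by split; rewrite le_max ?h1 ?h2 ?orbT.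
Qed.

Lemma image_area : area (phi @` K) = d * area K.
Proof.
apply: EFin_inj; rewrite EFinM -!areaE//; last exact: image_solid.
exact: image_measure.
Qed.

Let d0 : 0 < d. Proof. by case: jphi. Qed.

Lemma log_integral_image (f : T2 -> R) : tame (phi @` K) f -> tame K (f \o phi) ->
  log_integral leb2 (phi @` K) f = ln d + log_integral leb2 K (f \o phi).
Proof.
move=> tf tg; have [mK _ K0] := sK; have sK' := image_solid; have [mK' _ K'0] := sK'.
apply: expR_inj; rewrite expRD lnK ?posrE//.
have K0E : (0 < leb2 K)%E by exact: K0.
have Kfin : (leb2 K < +oo)%E by exact: solid_fin.
have K0E' : (0 < leb2 (phi @` K))%E by exact: K'0.
have Kfin' : (leb2 (phi @` K) < +oo)%E by exact: solid_fin.
rewrite (log_integralK mK K0E Kfin tg) (log_integralK mK' K0E' Kfin' tf).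
have mf : measurable_fun [set: T2] (fun x : T2 => (expR (f x))%:E).
  by apply/measurable_EFinP; case: tf => *; exact: measurableT_comp.
rewrite /Rintegral.
rewrite [X in fine X](_ : _ = d%:E * \int[mu2]_(x in K) (expR (f (phi x)))%:E)%E.
  rewrite fineM//.
  have := integrable_fin_num mK (integrable_expR mK Kfin tg); exact.
have := jacobian_integral jphi mK' mf; rewrite preimage_imageE; apply.
by move=> z; rewrite lee_fin expR_ge0.
Qed.

Lemma image_map_integral (chi : R * R -> R * R) :
  tame_map (phi @` K) chi -> tame_map K (chi \o phi) ->
  ((volume_factor (phi @` K))%:E * N (phi @` K) chi =
   (d * volume_factor K)%:E * N K (chi \o phi))%E.
Proof.
move=> [tc1 tc2] [tk1 tk2]; have sK' := image_solid.
have [mK _ _] := sK.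
have e y : exp_support leb2 (phi @` K) p (fun x : T2 => (chi x).1) (fun x : T2 => (chi x).2) y
   = expR (- p^-1 * ln d) *
     exp_support leb2 K p (fun x : T2 => (chi (phi x)).1) (fun x : T2 => (chi (phi x)).2) y.
  rewrite /exp_support -expRD; congr expR; rewrite -mulrDr; congr (_ * _).
  by apply: log_integral_image; exact: tame_pairing.
have -> : (N (phi @` K) chi = (expR (- p^-1 * ln d))%:E * N K (chi \o phi))%E.
  rewrite /N /plane_integral -ge0_integralZl.
  - by apply: eq_integral => y _; rewrite e EFinM.
  - exact: measurableT.
  - by apply: measurable_density; [exact: mK|split].
  - by move=> y _; exact: exp_support_ge0E.
  - by rewrite lee_fin expR_ge0.
rewrite muleA -EFinM; congr (_%:E * _)%E.
rewrite /volume_factor image_area lnM ?posrE ?area_gt0// mulrDr expRD.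
rewrite mulNr expRN.
set a := expR (p^-1 * ln d); have a0 : a != 0 by rewrite gt_eqF ?expR_gt0.
by field.
Qed.

End image.

Lemma map_integral_linear K (a b c d : R) phi : solid K -> tame_map K phi ->
  a * d - b * c != 0 ->
  (N K phi = `|a * d - b * c|%:E * N K (affine a b c d 0 0 \o phi))%E.
Proof.
move=> sK tphi D0; have [mK _ _] := sK.
have D1 : a * d - c * b != 0 by rewrite [c * b]mulrC.
have [_ _ H] := jacobian_affine 0 0 D1.
rewrite /N /plane_integral.
apply: (etrans (H _ (measurable_density mK tphi)
  (fun z => exp_support_ge0E _ _ _ _ _ z))).
rewrite [c * b]mulrC; apply: f_equal; apply: eq_integral => y _.
rewrite /exp_support; congr (expR (_ * log_integral _ _ _))%:E.
by apply/funext => x; rewrite /affine /=; ring.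
Qed.

Lemma affine_inverse (a b c d e f : R) : a * d - b * c != 0 ->
  let D := a * d - b * c in
  let psi := affine (d / D) (- b / D) (- c / D) (a / D)
    ((b * f - d * e) / D) ((c * e - a * f) / D) in
  cancel (affine a b c d e f) psi /\ cancel psi (affine a b c d e f).
Proof.
move=> D0 D psi; have D1 : D != 0 by [].
split => -[x y]; rewrite /psi /affine /=; congr pair; rewrite /D; field; exact: D0.
Qed.

Lemma measurable_affine (a b c d e f : R) :
  measurable_fun [set: T2] (affine a b c d e f : T2 -> T2).
Proof.
have lin (u v k : R) : measurable_fun [set: T2] (fun z : T2 => u * z.1 + v * z.2 + k).
  have m1 : measurable_fun [set: T2] (fun z : T2 => z.1) by exact: measurable_fst.
  have m2 : measurable_fun [set: T2] (fun z : T2 => z.2) by exact: measurable_snd.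
  apply: measurable_funD; last exact: measurable_cst.
  by apply: measurable_funD; apply: measurable_funM.
by apply: measurable_fun_pair; exact: lin.
Qed.

Lemma tame_affine K (a b c d e f : R) : solid K -> tame_map K (affine a b c d e f).
Proof.
move=> sK; have := tame_translate (0, 0) sK; rewrite /translate /= => -[t1 t2].
have lin (u v k : R) : tame K (fun z : T2 => u * z.1 + v * z.2 + k).
  apply: tameD; last exact: tame_cst.
  have {}t1 : tame K (fun z : T2 => z.1) by under eq_fun do rewrite -[_.1]addr0.
  have {}t2 : tame K (fun z : T2 => z.2) by under eq_fun do rewrite -[_.2]addr0.
  by apply: tameD; exact: tameZ.
by split; exact: lin.
Qed.

(** The translation of the affine image is a translation of K followed by the linear
    part, and the dual linear map rescales the outer integral by the inverse of the
    factor that the volume gains. *)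
Lemma translated_mahler_affine K (a b c d e f : R) w : solid K ->
  a * d - b * c != 0 -> exists w',
  translated_mahler (affine a b c d e f @` K) w = translated_mahler K w'.
Proof.
move=> sK D0; have [phiK psiK] := affine_inverse e f D0.
set D := a * d - b * c in D0 phiK psiK *.
pose w' : R * R := ((d * (e + w.1) - b * (f + w.2)) / D,
  (a * (f + w.2) - c * (e + w.1)) / D).
exists w'; rewrite /translated_mahler.
have sK' : solid (affine a b c d e f @` K).
  exact: (image_solid sK (jacobian_affine e f D0) (tame_affine _ _ _ _ _ _ sK)
    (measurable_affine _ _ _ _ _ _) phiK psiK).
have twE : translate w \o affine a b c d e f = affine a b c d (e + w.1) (f + w.2).
  by apply/funext => z; rewrite /translate /affine /=; congr pair; ring.
have twE' : translate w \o affine a b c d e f = affine a b c d 0 0 \o translate w'.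
  rewrite twE; apply/funext => z; rewrite /translate /affine /w' /=.
  by congr pair; rewrite /D; field; exact: D0.
have tc : tame_map K (translate w \o affine a b c d e f).
  by rewrite twE; exact: tame_affine.
apply: (etrans (image_map_integral sK (jacobian_affine e f D0)
    (tame_affine _ _ _ _ _ _ sK) (measurable_affine _ _ _ _ _ _) phiK psiK
    (tame_translate w sK') tc)).
rewrite twE' (map_integral_linear sK (tame_translate w' sK) D0).
by rewrite [`|_| * _]mulrC EFinM -muleA.
Qed.

End Lp_mahler_volume.

(** * Inequalities between Mahler volumes *)

Lemma lee_ratio {R : realType} (a b : R) (X Y : \bar R) : 0 < a -> 0 < b ->
  (X <= Y)%E -> (b%:E * X <= (b / a)%:E * (a%:E * Y))%E.
Proof.
move=> a0 b0 XY; rewrite muleA -EFinM divfK; last by rewrite gt_eqF.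
by apply: lee_wpmul2l => //; rewrite lee_fin ltW.
Qed.

Section mahler_inequalities.
Context {R : realType}.
Variables (p : R) (p_gt0 : 0 < p).
Local Notation mu2 := (lebesgue2 R).
Local Notation T2 := (measurableTypeR R * measurableTypeR R)%type.
Implicit Types (K P : set (R * R)) (w : R * R).
Local Notation N := (map_integral p).

Definition shear (t : R) (z : R * R) : R * R := (z.1 + t * Num.max z.2 0, z.2).

Lemma shearK s : cancel (shear s) (shear (- s)).
Proof. by case=> x y; rewrite /shear /= mulNr addrK. Qed.

Lemma shear0 : shear 0 = id.
Proof. by apply/funext => -[x y]; rewrite /shear /= mul0r addr0. Qed.

Let measurable_pos_snd : measurable_fun [set: T2] (fun z : T2 => Num.max z.2 0).
Proof. by apply: measurable_maxr => //; exact: measurable_snd. Qed.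

Lemma measurable_shear t : measurable_fun [set: T2] (shear t : T2 -> T2).
Proof.
apply: measurable_fun_pair; last exact: measurable_snd.
apply: measurable_funD; first exact: measurable_fst.
by apply: measurable_funM => //; exact: measurable_pos_snd.
Qed.

Lemma jacobian_shear t : jacobian 1 (shear t).
Proof.
have h := @jacobian_fst R 1 (fun y => t * Num.max y 0) (oner_neq0 _).
apply: jacobian_eq (h _); first by rewrite normr1.
  by case=> x y; rewrite /shear /= mul1r.
apply: measurable_funM; first exact: measurable_cst.
by apply: measurable_maxr.
Qed.

Lemma solid_tame K : solid K ->
  [/\ tame K (fun z : T2 => z.1), tame K (fun z : T2 => z.2) &
      tame K (fun z : T2 => Num.max z.2 0)].
Proof.
move=> [mK [C KC] _]; split; split.
- exact: measurable_fst.
- by exists C => x /KC[].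
- exact: measurable_snd.
- by exists C => x /KC[].
- exact: measurable_pos_snd.
exists C => x /KC[_ h]; apply: le_trans h.
by rewrite /Num.max; case: ifPn => // _; rewrite normr0.
Qed.

Lemma tame_shear K w t : solid K -> tame_map K (translate w \o shear t).
Proof.
move=> /solid_tame[t1 t2 t3]; split => /=.
  apply: tameD; last exact: tame_cst.
  by apply: tameD; [exact: t1|exact: tameZ].
by apply: tameD; [exact: t2|exact: tame_cst].
Qed.

Lemma shear_solid K t : solid K -> solid (shear t @` K).
Proof.
move=> sK.
have tw : tame_map K (shear t).
  have -> : shear t = translate (0, 0) \o shear t.
    by apply/funext => -[x y]; rewrite /translate /= !addr0.
  exact: tame_shear.
apply: (image_solid sK (jacobian_shear t) tw (measurable_shear (- t)) (shearK t)).
by move=> z; have := shearK (- t) z; rewrite opprK.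
Qed.

Lemma translated_mahler_shear K t w : solid K ->
  translated_mahler p (shear t @` K) w =
  ((volume_factor p K)%:E * N K (translate w \o shear t))%E.
Proof.
move=> sK.
have tw : tame_map K (shear t).
  have -> : shear t = translate (0, 0) \o shear t.
    by apply/funext => -[x y]; rewrite /translate /= !addr0.
  exact: tame_shear.
have shK : cancel (shear (- t)) (shear t).
  by move=> z; have := shearK (- t) z; rewrite opprK.
rewrite -[volume_factor p K]mul1r.
exact: (image_map_integral p sK (jacobian_shear t) tw (measurable_shear (- t))
  (shearK t) shK (tame_translate w (shear_solid t sK)) (tame_shear w t sK)).
Qed.

Let shear_step_strict K t1 t2 (B : \bar R) : solid K -> t1 < 0 -> 0 < t2 ->
  (forall w, (B <= translated_mahler p (shear t1 @` K) w)%E) ->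
  (forall w, (B <= translated_mahler p (shear t2 @` K) w)%E) ->
  forall w, (B <= translated_mahler p K w)%E.
Proof.
move=> sK t10 t20 H1 H2 w.
have v0 : 0 < volume_factor p K by exact: volume_factor_gt0.
set v := volume_factor p K in v0.
have lev (X : \bar R) : (B <= v%:E * X)%E = ((v^-1)%:E * B <= X)%E.
  rewrite -[in RHS](@lee_pmul2l _ v%:E)//.
  by rewrite muleA -EFinM divff ?gt_eqF// mul1e.
have [t_1 t_2 t_3] := solid_tame sK.
have [mK _ K0] := sK.
pose xi (x : T2) := x.1 + w.1; pose beta (x : T2) : R := Num.max x.2 0.
pose eta (x : T2) := x.2 + w.2.
have txi : tame K xi by apply: tameD; [exact: t_1|exact: tame_cst].
have teta : tame K eta by apply: tameD; [exact: t_2|exact: tame_cst].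
have NE t c : N K (translate (w.1 + c, w.2) \o shear t) =
    plane_integral leb2 K p (shadow xi beta t c) eta.
  rewrite /map_integral; have -> // : (fun x : R * R =>
    ((translate (w.1 + c, w.2) \o shear t) x).1) = shadow xi beta t c.
  by apply/funext => x; rewrite /shadow /xi /beta /translate /shear /=; ring.
have H t : (forall w, (B <= translated_mahler p (shear t @` K) w)%E) ->
    forall c, ((v^-1)%:E * B <= plane_integral leb2 K p (shadow xi beta t c) eta)%E.
  move=> h c; have := h (w.1 + c, w.2).
  by rewrite translated_mahler_shear// lev NE.
have leb0 : (0 < leb2 K)%E by exact: K0.
have lebfin : (leb2 K < +oo)%E by exact: solid_fin.
have := shadow_quasiconcave mK leb0 lebfin p_gt0 txi t_3 teta t10 t20 (H _ H1) (H _ H2).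
have E : N K (translate w) = plane_integral leb2 K p (shadow xi beta 0 0) eta.
  rewrite -NE shear0; congr (N K _); apply/funext => x.
  by rewrite /translate /= addr0.
by rewrite -E -lev.
Qed.

(** The shears of K form a shadow system: all points move horizontally, each at its
    constant speed, the positive part of its ordinate. *)
Lemma shear_step K t1 t2 (B : \bar R) : solid K -> t1 <= 0 -> 0 <= t2 ->
  (forall w, (B <= translated_mahler p (shear t1 @` K) w)%E) ->
  (forall w, (B <= translated_mahler p (shear t2 @` K) w)%E) ->
  forall w, (B <= translated_mahler p K w)%E.
Proof.
move=> sK; rewrite le_eqVlt => /predU1P[->|t10].
  by move=> _ H1 _ w; have := H1 w; rewrite shear0 image_id.
rewrite le_eqVlt => /predU1P[<-|t20].
  by move=> _ H2 w; have := H2 w; rewrite shear0 image_id.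
exact: shear_step_strict.
Qed.

(** Enlarging K enlarges the integral of exp (p <x, y>) over K, hence decreases
    everything but the power of the volume. *)
Lemma Lp_mahler_outer K P : solid K -> solid P -> K `<=` P ->
  (Lp_mahler p P <= (volume_factor p P / volume_factor p K)%:E * Lp_mahler p K)%E.
Proof.
move=> sK sP KP; rewrite (Lp_mahlerE p sK) (Lp_mahlerE p sP).
have vK := volume_factor_gt0 p sK; have vP := volume_factor_gt0 p sP.
suff : (N P id <= N K id)%E by exact: lee_ratio.
have [mK _ K0] := sK; have [mP _ P0] := sP.
have K0E : (0 < leb2 K)%E by exact: K0.
have Kfin : (leb2 K < +oo)%E by exact: solid_fin.
have P0E : (0 < leb2 P)%E by exact: P0.
have Pfin : (leb2 P < +oo)%E by exact: solid_fin.
have [tK1 tK2 _] := solid_tame sK; have [tP1 tP2 _] := solid_tame sP.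
have mG Q : solid Q -> measurable_fun [set: T2] (fun y : T2 =>
    (exp_support leb2 Q p (fun x : T2 => x.1) (fun x : T2 => x.2) y)%:E).
  move=> [mQ _ _]; apply/measurable_EFinP; apply: measurable_exp_support.
  - exact: mQ.
  - exact: measurable_fst.
  - exact: measurable_snd.
apply: ge0_le_integral.
- exact: measurableT.
- by move=> y _; exact: exp_support_ge0E.
- exact: mG.
- exact: mG.
move=> y _; rewrite lee_fin /exp_support ler_expR !mulNr lerN2.
rewrite ler_pM2l ?invr_gt0//.
set f := (fun x : T2 => _).
have tKf : tame K f by exact: tame_pairing.
have tPf : tame P f by exact: tame_pairing.
rewrite -ler_expR (log_integralK mK K0E Kfin tKf) (log_integralK mP P0E Pfin tPf).
rewrite /Rintegral; apply: fine_le.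
- exact: (integrable_fin_num mK (integrable_expR mK Kfin tKf)).
- exact: (integrable_fin_num mP (integrable_expR mP Pfin tPf)).
apply: ge0_subset_integral => //.
- apply: measurable_funTS; apply/measurable_EFinP.
  by case: tPf => mf _; exact: measurableT_comp.
Qed.

(** For a set with an affine symmetry of order three fixing the origin, the
    origin minimises the Mahler volume over translates: averaging over the
    symmetry replaces the weight exp (- <w, y>) by its mean over an orbit with
    zero sum, which is at least 1. *)
Lemma Lp_mahler_symmetric_min K w : solid K ->
  affine 0 (- 1) 1 (- 1) 0 0 @` K = K ->
  (Lp_mahler p K <= translated_mahler p K w)%E.
Proof.
move=> sK symK; set rho := affine 0 (- 1) 1 (- 1) 0 0 in symK.
have v0 := volume_factor_gt0 p sK.
rewrite (Lp_mahlerE p sK) /translated_mahler.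
suff : (N K id <= N K (translate w))%E.
  move: (N K id) (N K _) => X Y XY.
  by apply: lee_wpmul2l => //; rewrite lee_fin ltW.
have [mK _ K0] := sK.
have K0E : (0 < leb2 K)%E by exact: K0.
have Kfin : (leb2 K < +oo)%E by exact: solid_fin.
have [tK1 tK2 _] := solid_tame sK.
pose G := exp_support leb2 K p (fun x : T2 => x.1) (fun x : T2 => x.2).
pose dotw (y : R * R) := w.1 * y.1 + w.2 * y.2.
have NE : N K (translate w) = (\int[mu2]_y (expR (- dotw y) * G y)%:E)%E.
  rewrite /map_integral /plane_integral; apply: eq_integral => y _.
  congr EFin; rewrite /G /exp_support -expRD; congr expR.
  have tp : tame K (fun x : T2 => p * (x.1 * y.1 + x.2 * y.2)) by exact: tame_pairing.
  have -> : log_integral leb2 K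
      (fun x => p * ((translate w x).1 * y.1 + (translate w x).2 * y.2)) =
     log_integral leb2 K (fun x : T2 => p * (x.1 * y.1 + x.2 * y.2)) + p * dotw y.
    rewrite -(log_integralDc mK K0E Kfin _ tp); congr (log_integral _ _ _).
    by apply/funext => x; rewrite /translate /dotw /=; ring.
  have e : - p^-1 * (p * dotw y) = - dotw y.
    by rewrite mulNr mulrA mulVf ?gt_eqF// mul1r.
  by rewrite mulrDr e addrC.
pose sigma := affine 0 1 (- 1) (- 1 : R) 0 0.
have Gsigma y : G (sigma y) = G y.
  rewrite /G /exp_support; congr (expR (_ * _)).
  have D0 : 0 * (- 1) - (- 1) * 1 != 0 :> R.
    by rewrite mul0r sub0r mulN1r opprK oner_neq0.
  have [phiK psiK] := affine_inverse 0 0 D0.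
  have tf : tame K (fun x : T2 => p * (x.1 * y.1 + x.2 * y.2)) by exact: tame_pairing.
  have tg : tame K ((fun x : T2 => p * (x.1 * y.1 + x.2 * y.2)) \o rho).
    have [r1 r2] := tame_affine 0 (- 1) 1 (- 1) 0 0 sK.
    exact: tame_pairing.
  have tf' : tame (rho @` K) (fun x : T2 => p * (x.1 * y.1 + x.2 * y.2)) by rewrite symK.
  have := log_integral_image sK (jacobian_affine 0 0 D0) (tame_affine _ _ _ _ _ _ sK)
    (measurable_affine _ _ _ _ _ _) phiK psiK tf' tg.
  rewrite -/rho symK mul0r sub0r mulN1r opprK normr1 ln1 add0r => ->.
  congr (log_integral _ _ _); apply/funext => x.
  by rewrite /rho /sigma /affine /=; ring.
have mG : measurable_fun [set: T2] (G : T2 -> R).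
  apply: measurable_exp_support.
  - exact: mK.
  - exact: measurable_fst.
  - exact: measurable_snd.
have md : measurable_fun [set: T2] (fun y : T2 => expR (- dotw y)).
  apply: measurableT_comp => //; apply: measurable_funN.
  by apply: measurable_funD; apply: measurable_funM.
have ms : measurable_fun [set: T2] (sigma : T2 -> T2) by exact: measurable_affine.
pose k (y : T2) := (expR (- dotw y) * G y)%:E.
have mk : measurable_fun setT k.
  by apply/measurable_EFinP; exact: measurable_funM.
have k0 y : (0 <= k y)%E by rewrite lee_fin mulr_ge0 ?expR_ge0.
have D1 : 0 * (- 1) - 1 * (- 1) != 0 :> R.
  by rewrite mul0r sub0r mulrN1 opprK oner_neq0.
have [_ _ js] := jacobian_affine 0 0 D1.
have J (f : T2 -> \bar R) : measurable_fun setT f -> (forall z, 0 <= f z)%E ->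
    (\int[mu2]_z f z = \int[mu2]_z f (sigma z))%E.
  move=> mf f0; rewrite (js f mf f0) mul0r sub0r mulrN1 opprK normr1 mul1e.
  exact: erefl.
pose k1 y := k (sigma y); pose k2 y := k (sigma (sigma y)).
have mk1 : measurable_fun setT k1 by exact: (measurableT_comp mk ms).
have mk2 : measurable_fun setT k2 by exact: (measurableT_comp mk1 ms).
have E0 : (\int[mu2]_y k y = N K (translate w))%E by exact: esym NE.
have E1 : (\int[mu2]_y k1 y = N K (translate w))%E.
  exact: (etrans (esym (J _ mk k0)) E0).
have E2 : (\int[mu2]_y k2 y = N K (translate w))%E.
  exact: (etrans (esym (J _ mk1 (fun z => k0 (sigma z)))) E1).
have S12 : (\int[mu2]_y (k1 y + k2 y) =
    N K (translate w) + N K (translate w))%E.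
  apply: etrans (f_equal2 _ E1 E2).
  apply: ge0_integralD; [exact: measurableT| | exact: mk1| |exact: mk2].
  - by move=> y _; exact: k0.
  - by move=> y _; exact: k0.
have S : (\int[mu2]_y (k y + (k1 y + k2 y)) =
    N K (translate w) + (N K (translate w) + N K (translate w)))%E.
  apply: etrans (f_equal2 _ E0 S12).
  apply: ge0_integralD; [exact: measurableT| | exact: mk| |].
  - by move=> y _; exact: k0.
  - by move=> y _; apply: adde_ge0; exact: k0.
  - exact: (emeasurable_funD mk1 mk2).
have three_le (u1 u2 u3 : R) : u1 + (u2 + u3) = 0 ->
    3 <= 1 + u1 + (1 + u2 + (1 + u3)).
  move=> h; have -> : 1 + u1 + (1 + u2 + (1 + u3)) = 3 + (u1 + (u2 + u3)) by ring.
  by rewrite h addr0.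
have low : (3%:E * N K id <= N K (translate w) + (N K (translate w) + N K (translate w)))%E.
  rewrite -S /map_integral /plane_integral.
  have mGE : measurable_fun setT (fun y : T2 => (G y)%:E) by exact/measurable_EFinP.
  have h3 : (0 <= 3%:E :> \bar R)%E by rewrite lee_fin.
  rewrite -(ge0_integralZl mu2 measurableT mGE (fun y _ => exp_support_ge0E _ _ _ _ _ y) h3).
  apply: ge0_le_integral.
  - exact: measurableT.
  - by move=> y _; rewrite -EFinM lee_fin mulr_ge0// expR_ge0.
  - by apply: emeasurable_funM; [exact: measurable_cst|exact: mGE].
  - exact: (emeasurable_funD mk (emeasurable_funD mk1 mk2)).
  move=> y _; rewrite /k1 /k2 /k -EFinM -!EFinD lee_fin !Gsigma -!mulrDl.
  apply: ler_wpM2r; first exact: expR_ge0.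
  have e1 := expR_ge1Dx (- dotw y); have e2 := expR_ge1Dx (- dotw (sigma y)).
  have e3 := expR_ge1Dx (- dotw (sigma (sigma y))).
  have z0 : - dotw y + (- dotw (sigma y) + - dotw (sigma (sigma y))) = 0.
    by rewrite /dotw /sigma /affine /=; ring.
  by apply: le_trans (lerD e1 (lerD e2 e3)); exact: three_le.
have [->|Nf] := eqVneq (N K (translate w)) +oo%E; first by rewrite leey.
have Nfin : N K (translate w) \is a fin_num.
  by rewrite ge0_fin_numE ?ltey//; exact: map_integral_ge0.
move: low Nfin {Nf S S12 E0 E1 E2 NE}; move: (N K id) (N K (translate w)) => X Y low Yfin.
rewrite -(@lee_pmul2l _ 3%:E)//.
apply: le_trans low _; rewrite -(fineK Yfin) -!EFinD -EFinM lee_fin.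
by rewrite le_eqVlt; apply/orP; left; apply/eqP; ring.
Qed.

End mahler_inequalities.

(** * Convex hulls of finite sets *)

Section hulls.
Context {R : realType}.
Implicit Types (x y z u v w : R * R) (s L M : seq (R * R)) (C : set (R * R)).

Definition mix (l : R) x y : R * R :=
  ((1 - l) * x.1 + l * y.1, (1 - l) * x.2 + l * y.2).

Definition convex C := forall x y l, C x -> C y -> 0 <= l <= 1 -> C (mix l x y).

(** Defined by its universal property, so that it depends only on the members of
    the list. *)
Definition hull s : set (R * R) :=
  [set x | forall C, convex C -> (forall v, v \in s -> C v) -> C x].

Lemma hull_convex s : convex (hull s).
Proof.
move=> x y l hx hy l01 C cC sC.
exact: (cC x y l (hx C cC sC) (hy C cC sC) l01).
Qed.

Lemma hull_mem s v : v \in s -> hull s v.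
Proof. by move=> vs C _; exact. Qed.

Lemma hull_min s C : convex C -> (forall v, v \in s -> C v) -> hull s `<=` C.
Proof. by move=> cC sC x; exact. Qed.

Lemma hull_sub s L : (forall v, v \in s -> hull L v) -> hull s `<=` hull L.
Proof. by move=> h; apply: hull_min => //; exact: hull_convex. Qed.

Lemma eq_hull s L : s =i L -> hull s = hull L.
Proof.
by move=> e; apply/seteqP; split; apply: hull_sub => v; rewrite (e, =^~ e); exact: hull_mem.
Qed.

Lemma hull_remove v s : hull s v -> hull (v :: s) = hull s.
Proof.
move=> hv; apply/seteqP; split; apply: hull_sub => w.
  by rewrite inE => /predU1P[->//|]; exact: hull_mem.
by move=> ws; apply: hull_mem; rewrite inE ws orbT.
Qed.

Lemma convex3 C u v w (a b c : R) : convex C -> C u -> C v -> C w ->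
  0 <= a -> 0 <= b -> 0 <= c -> a + b + c = 1 ->
  C (a * u.1 + b * v.1 + c * w.1, a * u.2 + b * v.2 + c * w.2).
Proof.
move=> cC Cu Cv Cw a0 b0 c0 abc.
have [bc0|bc0] := eqVneq (b + c) 0.
  have b00 : b = 0 by lra.
  have c00 : c = 0 by lra.
  have a1 : a = 1 by lra.
  by rewrite b00 c00 a1 !mul1r !mul0r !addr0 -surjective_pairing.
have bcp : 0 < b + c by rewrite lt0r bc0 addr_ge0.
have Cz : C (mix (c / (b + c)) v w).
  by apply: cC => //; rewrite divr_ge0 ?(ltW bcp)//= ler_pdivrMr// mul1r lerDr.
have := cC _ _ (b + c) Cu Cz.
have bc1 : 0 <= b + c <= 1 by lra.
move=> /(_ bc1); congr C; rewrite /mix /=.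
have a1 : 1 - (b + c) = a by lra.
by congr pair; rewrite a1; field.
Qed.

Lemma convex_affine_preimage C (a b c d e f : R) : convex C ->
  convex (affine a b c d e f @^-1` C).
Proof.
move=> cC x y l /= Cx Cy l01; have := cC _ _ _ Cx Cy l01.
by congr C; rewrite /mix /affine /=; congr pair; ring.
Qed.

Lemma convex_affine_image C (a b c d e f : R) : convex C ->
  convex (affine a b c d e f @` C).
Proof.
move=> cC _ _ l [x Cx <-] [y Cy <-] l01; exists (mix l x y); first exact: cC.
by rewrite /mix /affine /=; congr pair; ring.
Qed.

Lemma hull_affine s (a b c d e f : R) :
  affine a b c d e f @` hull s = hull (map (affine a b c d e f) s).
Proof.
apply/seteqP; split.
  move=> _ [x hx <-] C cC sC; apply: (hx _ (convex_affine_preimage cC)).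
  by move=> v vs; apply: sC; exact: map_f.
apply: hull_min; first by apply: convex_affine_image; exact: hull_convex.
by move=> _ /mapP[v vs ->]; exists v => //; exact: hull_mem.
Qed.

Lemma mix0 x y : mix 0 x y = x.
Proof. by case: x => a b; rewrite /mix /= subr0 !mul1r !mul0r !addr0. Qed.

Lemma mix1 x y : mix 1 x y = y.
Proof. by case: y => a b; rewrite /mix /= subrr !mul1r !mul0r !add0r. Qed.

Lemma hull1 v : hull [:: v] = [set v].
Proof.
apply/seteqP; split; last by move=> _ ->; apply: hull_mem; rewrite inE.
apply: hull_min => [x y l -> -> l01|w]; last by rewrite inE => /eqP.
by case: v => a b; rewrite /mix /=; congr pair; ring.
Qed.

Lemma hull_nil : hull [::] = set0.
Proof. by apply/seteqP; split => // x; apply; [move=> ? ? ?|]. Qed.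

(** The hull of a finite set is a cone over the hull of one point fewer. *)
Lemma hull_cons v u L : hull (v :: u :: L) =
  [set mix lw.1 v lw.2 | lw in `[0, 1]%classic `*` hull (u :: L)].
Proof.
apply/seteqP; split; last first.
  move=> _ [[l w] [/= l01 hw] <-]; rewrite in_itv/= in l01.
  apply: hull_convex => //; first by apply: hull_mem; rewrite inE eqxx.
  by move: w hw; apply: hull_sub => w wL; apply: hull_mem; rewrite inE wL orbT.
apply: hull_min; last first.
  move=> w; rewrite inE => /predU1P[->|wL].
    exists (0, u); last by rewrite mix0.
    by split; rewrite /= ?in_itv/= ?lexx ?ler01//; apply: hull_mem; rewrite inE eqxx.
  exists (1, w); last by rewrite mix1.
  by split; rewrite /= ?in_itv/= ?lexx ?ler01//; exact: hull_mem.
move=> _ _ m [[l1 w1] [/= l101 h1] <-] [[l2 w2] [/= l201 h2] <-] /andP[m0 m1].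
move: l101 l201; rewrite !in_itv/= => /andP[l10 l11] /andP[l20 l21].
pose l := (1 - m) * l1 + m * l2.
have l0 : 0 <= l by rewrite /l addr_ge0 ?mulr_ge0 ?subr_ge0.
have l1' : l <= 1.
  have e1 : (1 - m) * l1 <= 1 - m by rewrite -[leRHS]mulr1 ler_wpM2l ?subr_ge0.
  have e2 : m * l2 <= m by rewrite -[leRHS]mulr1 ler_wpM2l.
  by rewrite /l; lra.
have [lz|lz] := eqVneq l 0.
  have e1 : (1 - m) * l1 = 0.
    apply/eqP; rewrite eq_le mulr_ge0 ?subr_ge0// andbT -lz /l lerDl.
    by rewrite mulr_ge0.
  have e2 : m * l2 = 0 by move: lz; rewrite /l e1 add0r.
  exists (0, w1); first by split => //=; rewrite in_itv/= lexx ler01.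
  rewrite /mix /= -[X in (X, _)]subr0 -[X in (_, X)]subr0.
  congr pair.
    transitivity (v.1 + (1 - m) * l1 * (w1.1 - v.1) + m * l2 * (w2.1 - v.1)); last by ring.
    by rewrite e1 e2; ring.
  transitivity (v.2 + (1 - m) * l1 * (w1.2 - v.2) + m * l2 * (w2.2 - v.2)); last by ring.
  by rewrite e1 e2; ring.
have lp : 0 < l by rewrite lt0r lz.
exists (l, mix (m * l2 / l) w1 w2).
  split; rewrite /= ?in_itv/= ?l0//.
  apply: hull_convex => //; rewrite divr_ge0 ?mulr_ge0//= ler_pdivrMr// mul1r.
  by rewrite /l lerDr mulr_ge0 ?subr_ge0.
rewrite /mix /=.
have E : l * (1 - m * l2 / l) = (1 - m) * l1.
  by rewrite mulrBr mulr1 mulrCA divff// mulr1 /l addrK.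
have E2 : l * (m * l2 / l) = m * l2 by rewrite mulrCA divff// mulr1.
have H (c d e : R) : (1 - l) * c + l * ((1 - m * l2 / l) * d + m * l2 / l * e) =
    (1 - m) * ((1 - l1) * c + l1 * d) + m * ((1 - l2) * c + l2 * e).
  transitivity ((1 - l) * c + (l * (1 - m * l2 / l)) * d + (l * (m * l2 / l)) * e).
    by ring.
  by rewrite E E2 /l; ring.
by rewrite !H.
Qed.

Lemma triangle_hull u v w : triangle u v w = hull [:: u; v; w].
Proof.
apply/seteqP; split.
  move=> _ [a [b [c [a0 b0 c0 abc ->]]]]; apply: convex3 => //.
  - exact: hull_convex.
  - by apply: hull_mem; rewrite !inE eqxx.
  - by apply: hull_mem; rewrite !inE eqxx orbT.
  - by apply: hull_mem; rewrite !inE eqxx !orbT.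
apply: hull_min.
  move=> _ _ l [a [b [c [a0 b0 c0 abc ->]]]] [a' [b' [c' [a0' b0' c0' abc' ->]]]].
  move=> /andP[l0 l1]; exists ((1 - l) * a + l * a'), ((1 - l) * b + l * b'),
    ((1 - l) * c + l * c'); split.
  - by rewrite addr_ge0 ?mulr_ge0 ?subr_ge0.
  - by rewrite addr_ge0 ?mulr_ge0 ?subr_ge0.
  - by rewrite addr_ge0 ?mulr_ge0 ?subr_ge0.
  - transitivity ((1 - l) * (a + b + c) + l * (a' + b' + c')); first by ring.
    by rewrite abc abc'; ring.
  - by rewrite /mix /=; congr pair; ring.
move=> x; rewrite !inE => /or3P[] /eqP ->.
- exists 1, 0, 0; split; rewrite ?ler01 ?lexx//; first by ring.
  by case: u => ? ? /=; congr pair; ring.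
- exists 0, 1, 0; split; rewrite ?ler01 ?lexx//; first by ring.
  by case: v => ? ? /=; congr pair; ring.
- exists 0, 0, 1; split; rewrite ?ler01 ?lexx//; first by ring.
  by case: w => ? ? /=; congr pair; ring.
Qed.

Definition axis_segment : seq (R * R) := [:: (0, 0); (1, 0)].

(** The points below the axis in the angle at the apex (t, 1) spanned by the unit
    segment of the axis. Adding such points to the triangle over the segment does
    not enlarge it above the axis. *)
Definition below_apex (t : R) w :=
  [/\ w.2 <= 0, 0 <= w.1 - t * w.2 & w.1 - t * w.2 + w.2 <= 1].

Lemma below_apex_convex t : convex (below_apex t).
Proof.
move=> x y l [x1 x2 x3] [y1 y2 y3] /andP[l0 l1]; have k0 : 0 <= 1 - l by lra.
rewrite /below_apex /mix /=; split.
- have := mulr_ge0 k0 (_ : 0 <= - x.2); have := mulr_ge0 l0 (_ : 0 <= - y.2).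
  by move=> /(_ ltac:(lra)) h1 /(_ ltac:(lra)) h2; lra.
- have := mulr_ge0 k0 x2; have := mulr_ge0 l0 y2; lra.
- have x4 : 0 <= 1 - (x.1 - t * x.2 + x.2) by lra.
  have y4 : 0 <= 1 - (y.1 - t * y.2 + y.2) by lra.
  have := mulr_ge0 k0 x4; have := mulr_ge0 l0 y4; lra.
Qed.

(** A point of the hull above the axis belongs to the triangle with base the axis
    segment, which the shear maps to the triangle with the moved apex; a point
    below is fixed, and the segment joining the apex to a point of the base hull
    enters the lower half-plane through the axis segment, so that the apex is not
    needed to reach it. *)
Lemma shear_hull_sub (a t : R) L : (forall w, w \in L -> below_apex a w) ->
  shear t @` hull ((a, 1) :: axis_segment ++ L) `<=`
  hull ((a + t, 1) :: axis_segment ++ L).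
Proof.
move=> hL _ [x hx <-].
set M := axis_segment ++ L.
have M0 : hull M (0, 0) by apply: hull_mem; rewrite !inE eqxx.
have M1 : hull M (1, 0) by apply: hull_mem; rewrite !inE eqxx orbT.
have sub (c : R * R) : hull M `<=` hull (c :: M).
  by apply: hull_sub => w wM; apply: hull_mem; rewrite inE wM orbT.
have hM : hull M `<=` below_apex a.
  apply: hull_min; first exact: below_apex_convex.
  move=> w; rewrite mem_cat => /orP[|]; last exact: hL.
  by rewrite !inE => /orP[] /eqP ->; rewrite /below_apex /=; split; lra.
have {}hx : hull ((a, 1) :: (0, 0) :: (1, 0) :: L) x by exact: hx.
move: hx; rewrite hull_cons => -[[l w] [/= l01 hw] <-].
move: l01; rewrite in_itv/= => /andP[l0 l1].
have [w1 w2 w3] := hM _ hw.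
rewrite /mix /=; set x1 := (1 - l) * a + l * w.1; set x2 := (1 - l) * 1 + l * w.2.
have [x2n|x2p] := leP x2 0.
  have -> : shear t (x1, x2) = (x1, x2).
    by rewrite /shear /= max_r// mulr0 addr0.
  apply: sub.
  have [wz|wz] := eqVneq w.2 0.
    have l1e : l = 1 by move: x2n; rewrite /x2 wz mulr0 mulr1 addr0; lra.
    rewrite (_ : (x1, x2) = w)// [RHS]surjective_pairing /x1 /x2 l1e.
    by congr pair; ring.
  have wn : w.2 < 0 by rewrite lt_neqAle wz.
  pose q := 1 - w.2; have q1 : 1 < q by rewrite /q; lra.
  have q0 : 0 < q by lra.
  pose c := (w.1 - a * w.2) / q.
  have hz : hull M (c, 0).
    have := convex3 (hull_convex (s := M)) M0 M1 M0 (a := 1 - c) (b := c) (c := 0).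
    have c0 : 0 <= c by rewrite divr_ge0// ltW.
    have c1 : c <= 1 by rewrite ler_pdivrMr// mul1r /q; lra.
    rewrite lexx subr_ge0 /= => /(_ c1 c0 isT).
    have e1 : 1 - c + c + 0 = 1 by ring.
    move=> /(_ e1); congr (hull M _); congr pair; ring.
  have lq : 0 <= (l * q - 1) / (q - 1) <= 1.
    rewrite divr_ge0/=; [|move: x2n; rewrite /x2 /q; lra|lra].
    rewrite ler_pdivrMr; last lra.
    have : l * q <= 1 * q by rewrite ler_wpM2r// ltW.
    lra.
  have := hull_convex hz hw lq; congr (hull M _); rewrite /mix /c /x1 /x2 /=.
  have qE : w.2 = 1 - q by rewrite /q; ring.
  have q2 : q - 1 != 0 by rewrite gt_eqF// subr_gt0.
  rewrite qE; congr pair.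
    by field; rewrite q2 gt_eqF.
  by field.
have -> : shear t (x1, x2) = (x1 + t * x2, x2).
  by rewrite /shear /= max_l// ltW.
have k0 : 0 <= x1 - a * x2.
  have := mulr_ge0 l0 w2; rewrite /x1 /x2; lra.
have k1 : 0 <= 1 - x2 - (x1 - a * x2).
  have w4 : 0 <= 1 - (w.1 - a * w.2 + w.2) by lra.
  have := mulr_ge0 l0 w4; rewrite /x1 /x2; lra.
have e1 : x2 + (x1 - a * x2) + (1 - x2 - (x1 - a * x2)) = 1 by ring.
have apex : hull ((a + t, 1) :: M) (a + t, 1) by apply: hull_mem; rewrite inE eqxx.
have := convex3 (@hull_convex _) apex (sub _ _ M1) (sub _ _ M0) (ltW x2p) k0 k1 e1.
by congr (hull _ _); rewrite /=; congr pair; ring.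
Qed.

Lemma shear_hull (t : R) L : (forall w, w \in L -> below_apex 0 w) ->
  (forall w, w \in L -> below_apex t w) ->
  shear t @` hull ((0, 1) :: axis_segment ++ L) =
  hull ((t, 1) :: axis_segment ++ L).
Proof.
move=> h0 ht; apply/seteqP; split.
  by have := @shear_hull_sub 0 t L h0; rewrite add0r.
move=> x hx; exists (shear (- t) x).
  have := @shear_hull_sub t (- t) L ht; rewrite subrr; apply.
  by exists x.
by have := shearK (- t) x; rewrite opprK.
Qed.

End hulls.

(** * Topology and measure in the plane *)

Section planar_topology.
Context {R : realType}.
Local Notation mu2 := (lebesgue2 R).
Local Notation T2 := (measurableTypeR R * measurableTypeR R)%type.
Implicit Types (x y z w : R * R) (U K P : set (R * R)).

(** The ball of the product metric, with explicit coordinates. *)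
Definition box z (r : R) : set (R * R) :=
  [set w | `|z.1 - w.1| < r /\ `|z.2 - w.2| < r].

Lemma box_ball z (r : R) : box z r = ball z r.
Proof.
by apply/seteqP; split => w; rewrite /box /ball /= /prod_ball -!ball_normE.
Qed.

Lemma measurable_box z (r : R) : measurable (box z r : set T2).
Proof.
have -> : box z r = (ball z.1 r : set R) `*` (ball z.2 r : set R).
  by apply/seteqP; split => w; rewrite /= -!ball_normE.
by apply: measurableX; exact: measurable_ball.
Qed.

Lemma lebesgue2_box z (r : R) : 0 <= r -> mu2 (box z r) = (r *+ 2 * (r *+ 2))%:E.
Proof.
move=> r0.
have -> : box z r = (ball z.1 r : set R) `*` (ball z.2 r : set R).
  by apply/seteqP; split => w; rewrite /= -!ball_normE.
have mb (c : R) : measurable (ball c r : set (measurableTypeR R)) by exact: measurable_ball.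
apply: etrans (product_measure1E (@lebesgue_measure R) (@lebesgue_measure R) (mb z.1) (mb z.2)) _.
by rewrite EFinM; congr (_ * _)%E; exact: lebesgue_measure_ball.
Qed.

Lemma open_box U z : open U -> U z -> exists2 r, 0 < r & box z r `<=` U.
Proof.
move=> oU Uz; have : nbhs z U by exact: open_nbhs_nbhs.
by move=> /nbhs_ballP[r r0 rU]; exists r => //; rewrite box_ball.
Qed.

(** An open set is the union of the boxes that it contains, with rational centres
    and inverse integers as radii. *)
Lemma open_measurable2 U : open U -> measurable (U : set T2).
Proof.
move=> oU.
pose B (i : rat * rat * nat) := box (ratr i.1.1, ratr i.1.2) (i.2.+1%:R^-1 : R).
pose F i := if `[< B i `<=` U >] then B i else set0.
have -> : U = \bigcup_i F i.
  apply/seteqP; split => [z Uz|z [i _]]; last first.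
    by rewrite /F; case: ifPn => // /asboolP h; exact: h.
  have [r r0 rU] := open_box oU Uz.
  have [n nr] : exists n, n.+1%:R^-1 < r / 2.
    have r20 : 0 < r / 2 by rewrite divr_gt0.
    exists (Num.truncn (r / 2)^-1); rewrite -[ltRHS]invrK ltf_pV2 ?posrE ?invr_gt0//.
    exact: truncnS_gt.
  have n0 : 0 < n.+1%:R^-1 :> R by rewrite invr_gt0.
  have near (c : R) : exists q : rat, `|ratr q - c| < n.+1%:R^-1.
    have cc : c - n.+1%:R^-1 < c + n.+1%:R^-1 by rewrite ltrBlDr -addrA ltrDl addr_gt0.
    have [q] := rat_in_itvoo cc.
    by rewrite in_itv/= => qi; exists q; rewrite ltr_distl.
  have [q1 h1] := near z.1; have [q2 h2] := near z.2.
  exists (q1, q2, n) => //; rewrite /F; case: ifPn => [_|]; first by split.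
  move=> /asboolPn; case => w [/= w1 w2]; apply: rU; split.
  - apply: le_lt_trans (ler_distD (ratr q1) _ _) _; rewrite [r]splitr distrC.
    by apply: ltrD; [exact: lt_trans h1 nr|exact: lt_trans w1 nr].
  - apply: le_lt_trans (ler_distD (ratr q2) _ _) _; rewrite [r]splitr distrC.
    by apply: ltrD; [exact: lt_trans h2 nr|exact: lt_trans w2 nr].
apply: countable_bigcupT_measurable => // i.
by rewrite /F; case: ifPn => _ //; exact: measurable_box.
Qed.

Lemma compact_measurable2 K : compact K -> measurable (K : set T2).
Proof.
move=> cK; have : closed K.
  apply: compact_closed cK.
  exact: (@norm_hausdorff R (R^o * R^o)%type).
move=> /closed_openC /open_measurable2 h; rewrite -[K]setCK.
exact: (@measurableC _ T2).
Qed.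

Lemma compact_bounded2 K : compact K ->
  exists C, forall x, K x -> `|x.1| <= C /\ `|x.2| <= C.
Proof.
move=> cK.
have bnd (f : R * R -> R) : continuous f -> exists C, forall x, K x -> `|f x| <= C.
  move=> cf.
  have /compact_bounded : compact (f @` K).
    by apply: continuous_compact => //; exact: continuous_subspaceT.
  move=> [M [_ hM]]; exists (M + 1) => x Kx.
  by apply: (hM (M + 1)); [rewrite ltrDl|exists x].
have [C1 h1] : exists C, forall x, K x -> `|x.1| <= C.
  by apply: (bnd fst) => x; exact: cvg_fst.
have [C2 h2] : exists C, forall x, K x -> `|x.2| <= C.
  by apply: (bnd snd) => x; exact: cvg_snd.
exists (Num.max C1 C2) => x Kx.
by split; rewrite le_max ?h1 ?h2 ?orbT.
Qed.

Lemma compact_solid K : compact K -> (0 < mu2 K)%E -> solid K.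
Proof.
by move=> cK K0; split => //; [exact: compact_measurable2|exact: compact_bounded2].
Qed.

Lemma box_solid K z (r : R) : compact K -> 0 < r -> box z r `<=` K -> solid K.
Proof.
move=> cK r0 rK; apply: compact_solid => //.
have mK := compact_measurable2 cK.
apply: lt_le_trans (le_measure mu2 _ _ rK); rewrite ?inE//; last exact: measurable_box.
have : (0 < (r *+ 2 * (r *+ 2))%:E)%E by rewrite lte_fin mulr_gt0// mulrn_wgt0.
by rewrite -(lebesgue2_box z (ltW r0)); exact.
Qed.

Lemma compact_hull (s : seq (R * R)) : compact (hull s).
Proof.
case: s => [|v s]; first by rewrite hull_nil; exact: compact0.
elim: s v => [v|u s ih v]; first by rewrite hull1; exact: compact_set1.
rewrite hull_cons; apply: continuous_compact; last first.
  by apply: compact_setX; [exact: segment_compact|exact: ih].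
apply: continuous_subspaceT => lw.
have lin (a : R) (f : R * (R * R) -> R) : {for lw, continuous f} ->
    {for lw, continuous (fun l : R * (R * R) => (1 - l.1) * a + l.1 * f l)}.
  have c1 : {for lw, continuous (fun l : R * (R * R) => l.1 : R)} by exact: cvg_fst.
  move=> cf; apply: (@cvgD _ R^o).
    apply: (@cvgM _ _ _ _ (fun l : R * (R * R) => 1 - l.1) (fun=> a)).
      by apply: (@cvgB _ R^o); [exact: cvg_cst|exact: c1].
    exact: cvg_cst.
  exact: (@cvgM _ _ _ _ (fun l : R * (R * R) => l.1) f).
have c2 : {for lw, continuous (fun l : R * (R * R) => l.2.1)}.
  by apply: (@cvg_comp _ _ _ snd fst); [exact: cvg_snd|exact: cvg_fst].
have c3 : {for lw, continuous (fun l : R * (R * R) => l.2.2)}.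
  by apply: (@cvg_comp _ _ _ snd snd); [exact: cvg_snd|exact: cvg_snd].
exact: (cvg_pair (lin v.1 _ c2) (lin v.2 _ c3)).
Qed.

Lemma affine_solid K (a b c d e f : R) : solid K -> a * d - b * c != 0 ->
  solid (affine a b c d e f @` K).
Proof.
move=> sK D0; have [phiK psiK] := affine_inverse e f D0.
exact: (image_solid sK (jacobian_affine e f D0) (tame_affine _ _ _ _ _ _ sK)
  (measurable_affine _ _ _ _ _ _) phiK psiK).
Qed.

Lemma affine_area K (a b c d e f : R) : solid K -> a * d - b * c != 0 ->
  area (affine a b c d e f @` K) = `|a * d - b * c| * area K.
Proof.
move=> sK D0; have [phiK psiK] := affine_inverse e f D0.
exact: (image_area sK (jacobian_affine e f D0) (tame_affine _ _ _ _ _ _ sK)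
  (measurable_affine _ _ _ _ _ _) phiK psiK).
Qed.

(** A set inside a line is fixed by a dilation transverse to the line, which
    multiplies the area. *)
Lemma solid_not_flat K (a b c : R) : solid K -> (a, b) != (0, 0) ->
  ~ (forall x, K x -> a * x.1 + b * x.2 = c).
Proof.
move=> sK ab0 flat.
have q0 : 0 < a ^+ 2 + b ^+ 2.
  rewrite lt0r addr_ge0 ?sqr_ge0// andbT paddr_eq0 ?sqr_ge0// !sqrf_eq0.
  by move: ab0; rewrite xpair_eqE.
pose D := (1 + a ^+ 2) * (1 + b ^+ 2) - (a * b) * (a * b).
have DE : D = 1 + (a ^+ 2 + b ^+ 2) by rewrite /D; ring.
have D0 : D != 0 by rewrite DE gt_eqF// ltr_wpDr// ltW.
have := affine_area (- (c * a)) (- (c * b)) sK D0.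
have fixK : affine (1 + a ^+ 2) (a * b) (a * b) (1 + b ^+ 2) (- (c * a)) (- (c * b)) @` K = K.
  have fx x : K x -> affine (1 + a ^+ 2) (a * b) (a * b) (1 + b ^+ 2) (- (c * a)) (- (c * b)) x = x.
    move=> /flat <-; case: x => x1 x2; rewrite /affine /=; congr pair; ring.
  apply/seteqP; split => [_ [x Kx <-]|x Kx]; first by rewrite fx.
  by exists x; rewrite ?fx.
rewrite fixK -/D DE ger0_norm; last by rewrite addr_ge0// ltW.
by have := area_gt0 sK; move: (area K) => A A0; nra.
Qed.

End planar_topology.

(** * Polygons *)

Lemma list_least (T : eqType) (le : rel T) u (s : seq T) :
  {in u :: s &, total le} -> {in u :: s & &, transitive le} ->
  exists2 a, a \in u :: s & {in u :: s, forall x, le a x}.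
Proof.
elim: s u => [|v s ih] u tot tr.
  exists u; first by rewrite inE.
  by move=> x; rewrite inE => /eqP ->; have := tot u u; rewrite !inE eqxx orbb; exact.
have sub x : x \in v :: s -> x \in u :: v :: s by move=> h; rewrite inE h orbT.
have [||a av ha] := ih v.
- by move=> x y /sub hx /sub hy; exact: tot.
- by move=> y x z /sub hy /sub hx /sub hz; exact: tr.
have uu : u \in u :: v :: s by rewrite inE eqxx.
have au : a \in u :: v :: s by exact: sub.
have [ua|] := boolP (le u a).
  exists u => // x; rewrite inE => /predU1P[->|xs].
    by have := tot u u uu uu; rewrite orbb.
  by apply: (tr a) => //; [exact: sub|exact: ha].
move=> nua; exists a => // x; rewrite inE => /predU1P[->|xs]; last exact: ha.
by have := tot a u au uu; rewrite (negbTE nua) orbF.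
Qed.

Section lexicographic.
Context {R : realType}.
Implicit Types x y z : R * R.

Definition lex_le x y := (x.1 < y.1) || ((x.1 == y.1) && (x.2 <= y.2)).

Lemma lex_total : total lex_le.
Proof.
move=> x y; rewrite /lex_le; case: (ltgtP x.1 y.1) => //= _.
exact: le_total.
Qed.

Lemma lex_trans : transitive lex_le.
Proof.
move=> y x z; rewrite /lex_le => /orP[h|/andP[/eqP -> h]] /orP[k|/andP[/eqP <- k]].
- by rewrite (lt_trans h k).
- by rewrite h.
- by rewrite k.
- by rewrite eqxx (le_trans h k) orbT.
Qed.

Definition cross v x y : R :=
  (x.1 - v.1) * (y.2 - v.2) - (x.2 - v.2) * (y.1 - v.1).

Lemma crossC v x y : cross v x y = - cross v y x.
Proof. by rewrite /cross; ring. Qed.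

(** Seen from a lexicographically smaller point, points lie in a half-plane, so
    that turning counterclockwise orders their directions. *)
Lemma cross_trans v x y z : lex_le v x -> lex_le v y -> lex_le v z ->
  y != v -> z != v -> 0 <= cross v x y -> 0 <= cross v y z -> 0 <= cross v x z.
Proof.
have shift (w : R * R) : lex_le v w -> 0 <= w.1 - v.1 /\ (w.1 - v.1 = 0 -> 0 <= w.2 - v.2).
  by rewrite /lex_le => /orP[h|/andP[/eqP h k]]; split; lra.
move=> /shift[x1 _] /shift[y1 y2] /shift[z1 z2] yv zv.
have {}yv : y.1 - v.1 = 0 -> y.2 - v.2 != 0.
  move=> e; apply: contra yv; rewrite subr_eq0 => /eqP e2; apply/eqP.
  by move/eqP: e; rewrite subr_eq0 => /eqP e1; case: y v e1 e2 {y1 y2 x1 z1 z2 zv shift} => ? ? [? ?] /= -> ->.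
rewrite /cross.
move: (x.1 - v.1) (x.2 - v.2) (y.1 - v.1) (y.2 - v.2) (z.1 - v.1) (z.2 - v.2) x1 y1 y2 z1 z2 yv.
move=> a a' b b' c c' a0 b0 b0' c0 c0' b'n h k.
have [bz|bn] := eqVneq b 0.
  have b'p : 0 < b' by rewrite lt0r b'n// b0'.
  have cz : c = 0.
    apply/eqP; rewrite eq_le c0 andbT -(@ler_pM2l _ b')//.
    by move: k; rewrite bz; lra.
  by rewrite cz mulr0 subr0 mulr_ge0// c0'.
have bp : 0 < b by rewrite lt0r bn.
rewrite -(@pmulr_rge0 _ b)//.
have -> : b * (a * c' - a' * c) = a * (b * c' - b' * c) + c * (a * b' - a' * b) by ring.
by rewrite addr_ge0// mulr_ge0.
Qed.

End lexicographic.

Section polygons.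
Context {R : realType}.
Variables (p : R) (p_gt0 : 0 < p).
Local Notation mu2 := (lebesgue2 R).
Implicit Types (K P : set (R * R)) (w v : R * R) (s L : seq (R * R)).

(** All translates are included: affine maps and shears trade one translation for
    another. *)
Definition above_triangle K :=
  forall w, (Lp_mahler p (Delta20 R) <= translated_mahler p K w)%E.

Lemma box_Delta20 : box (0, 0) 8^-1 `<=` Delta20 R.
Proof.
move=> -[x y]; rewrite /box /= !sub0r !normrN !ltr_norml => -[/andP[x1 x2] /andP[y1 y2]].
pose u := (1 - x - y) / 3.
exists (u + x), (u + y), u; split; rewrite /u; [lra|lra|lra|lra|].
by rewrite /=; congr pair; lra.
Qed.

Lemma Delta20_origin : Delta20 R (0, 0).
Proof. by apply: box_Delta20; split; rewrite /= subrr normr0 invr_gt0. Qed.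

Lemma solid_Delta20 : solid (Delta20 R).
Proof.
apply: box_solid box_Delta20; last by rewrite invr_gt0.
by rewrite /Delta20 triangle_hull; exact: compact_hull.
Qed.

Lemma above_Delta20 : above_triangle (Delta20 R).
Proof.
move=> w; apply: Lp_mahler_symmetric_min => //; first exact: solid_Delta20.
rewrite /Delta20 triangle_hull hull_affine; apply: eq_hull => x.
rewrite /= /affine /= !inE.
have e1 : (0 * 1 + -1 * 0 + 0, 1 * 1 + -1 * 0 + 0) = (0, 1) :> R * R by congr pair; ring.
have e2 : (0 * 0 + -1 * 1 + 0, 1 * 0 + -1 * 1 + 0) = (-1, -1) :> R * R by congr pair; ring.
have e3 : (0 * -1 + -1 * -1 + 0, 1 * -1 + -1 * -1 + 0) = (1, 0) :> R * R by congr pair; ring.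
by rewrite e1 e2 e3; case: (x == (0, 1)); case: (x == (1, 0)); case: (x == _).
Qed.

Lemma above_affine K (a b c d e f : R) : solid K -> a * d - b * c != 0 ->
  above_triangle (affine a b c d e f @` K) -> above_triangle K.
Proof.
move=> sK D0 h w; have [phiK _] := affine_inverse e f D0.
have sK' := affine_solid e f sK D0.
move: phiK; set D := a * d - b * c => phiK.
have D1 : d / D * (a / D) - - b / D * (- c / D) != 0.
  have -> : d / D * (a / D) - - b / D * (- c / D) = D^-1.
    by rewrite /D; field.
  by rewrite invr_eq0.
have [w' ] := translated_mahler_affine p ((b * f - d * e) / D) ((c * e - a * f) / D) w sK' D1.
set psi := affine (d / D) _ _ _ _ _ in phiK *.
have -> : psi @` (affine a b c d e f @` K) = K.
  apply/seteqP; split => [_ [_ [x Kx <-] <-]|x Kx]; first by rewrite phiK.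
  by exists (affine a b c d e f x); rewrite ?phiK//; exists x.
by move=> ->; exact: h.
Qed.

Definition unit_triangle : set (R * R) := hull [:: (0, 1); (0, 0); (1, 0)].

Lemma hull_solid s : (0 < mu2 (hull s))%E -> solid (hull s).
Proof. by apply: compact_solid; exact: compact_hull. Qed.

Lemma solid_over_unit s : (forall v, v \in [:: (0, 1); (0, 0); (1, 0)] -> v \in s) ->
  solid (hull s).
Proof.
move=> h; apply: (@box_solid _ _ (4^-1, 4^-1) 8^-1); first exact: compact_hull.
  by rewrite invr_gt0.
apply: (@subset_trans _ unit_triangle); last by apply: hull_sub => v /h; exact: hull_mem.
move=> -[x y]; rewrite /box /= !ltr_norml => -[/andP[x1 x2] /andP[y1 y2]].
rewrite /unit_triangle -triangle_hull.
exists y, (1 - x - y), x; split; [lra|lra|lra|lra|].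
by rewrite /=; congr pair; lra.
Qed.

Lemma above_unit : above_triangle unit_triangle.
Proof.
have D0 : 2 * 2 - 1 * 1 != 0 :> R by rewrite gt_eqF//; lra.
apply: (above_affine (e := -1) (f := -1) _ D0); first exact: solid_over_unit.
rewrite /unit_triangle hull_affine /= /affine /=.
have -> : hull [:: (2 * 0 + 1 * 1 + -1, 1 * 0 + 2 * 1 + -1);
    (2 * 0 + 1 * 0 + -1, 1 * 0 + 2 * 0 + -1);
    (2 * 1 + 1 * 0 + -1, 1 * 1 + 2 * 0 + -1)] = Delta20 R; last exact: above_Delta20.
have e1 : (2 * 0 + 1 * 1 + -1, 1 * 0 + 2 * 1 + -1) = (0, 1) :> R * R by congr pair; ring.
have e2 : (2 * 0 + 1 * 0 + -1, 1 * 0 + 2 * 0 + -1) = (-1, -1) :> R * R by congr pair; ring.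
have e3 : (2 * 1 + 1 * 0 + -1, 1 * 1 + 2 * 0 + -1) = (1, 0) :> R * R by congr pair; ring.
rewrite e1 e2 e3 /Delta20 triangle_hull; apply: eq_hull => x; rewrite !inE.
by case: (x == (0, 1)); case: (x == (1, 0)); case: (x == _).
Qed.

Definition polygon_above n := forall s, (size s <= n)%N -> (0 < mu2 (hull s))%E ->
  above_triangle (hull s).

(** The shears move the apex to (t, 1) and leave the other points, as long as they
    stay in the angle at the apex. On each side this lasts until an end of the axis
    segment lies between the apex and some point of L; that end is then redundant,
    so that the induction hypothesis applies to both extreme positions. *)
Lemma shear_until_collinear n L : polygon_above n -> L != [::] ->
  (size L + 2 <= n)%N ->
  (forall w, w \in L -> [/\ 0 <= w.1, w.1 + w.2 <= 1 & w.2 < 0]) ->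
  above_triangle (hull ((0, 1) :: axis_segment ++ L)).
Proof.
case: L => // u L' IH _ sz; set L := u :: L' in sz *; move=> hL.
have below0 w : w \in L -> below_apex 0 w.
  by move=> /hL[w1 w2 w3]; rewrite /below_apex mul0r subr0; split; [exact: ltW| |].
have sK : solid (hull ((0, 1) :: axis_segment ++ L)).
  by apply: solid_over_unit => v; rewrite !inE => /or3P[] ->; rewrite ?orbT.
have lin_le (f : R * R -> R) : exists2 m, m \in L & forall w, w \in L -> f m <= f w.
  have [||m mL hm] := @list_least _ (fun x y => f x <= f y) u L'.
  - by move=> x y _ _; exact: le_total.
  - by move=> y x z _ _ _; exact: le_trans.
  by exists m.
have remove c (t : R) m : m \in L ->
    c = mix (1 - m.2)^-1 (t, 1) m -> forall c', axis_segment =i [:: c; c'] ->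
    (forall w, w \in L -> below_apex t w) ->
    above_triangle (shear t @` hull ((0, 1) :: axis_segment ++ L)).
  move=> mL cE c' ax bt; have sKt := shear_solid t sK.
  have [_ _ m2] := hL m mL.
  move: sKt; rewrite shear_hull//.
  have -> : hull ((t, 1) :: axis_segment ++ L) = hull ((t, 1) :: c' :: L).
    transitivity (hull (c :: (t, 1) :: c' :: L)).
      have memE x : (x \in axis_segment ++ L) = (x \in [:: c; c']) || (x \in L).
        by rewrite -ax -mem_cat.
      apply: eq_hull => x; rewrite [LHS]in_cons [X in _ || X]memE !inE.
      by case: (x == (t, 1)); case: (x == c); case: (x == c').
    apply: hull_remove; rewrite cE; apply: hull_convex.
    - by apply: hull_mem; rewrite inE eqxx.
    - by apply: hull_mem; rewrite in_cons [X in _ || X]in_cons mL !orbT.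
    - rewrite invr_ge0 subr_ge0 (le_trans (ltW m2))//= invf_le1; lra.
  move=> [_ _ pos]; apply: IH pos; rewrite /= addn2 in sz *.
  exact: sz.
have fin (m : R * R) : m.2 < 0 -> 1 - m.2 != 0 by move=> h; rewrite gt_eqF//; lra.
(* The apex (t, 1), the end (1, 0) and w are collinear when t is this quotient for
   w; for the end (0, 0) the position is w.1 / w.2. *)
have [m2 m2L hm2] := lin_le (fun w => (1 - w.2 - w.1) / (- w.2)).
have [m1 m1L hm1] := lin_le (fun w => - (w.1 / w.2)).
have [a1 a2 a3] := hL _ m1L; have [b1 b2 b3] := hL _ m2L.
have na3 : m1.2 != 0 by rewrite lt_eqF.
have nb3 : m2.2 != 0 by rewrite lt_eqF.
pose t1 := m1.1 / m1.2; pose t2 := (1 - m2.2 - m2.1) / (- m2.2).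
have t10 : t1 <= 0 by rewrite /t1 mulr_ge0_le0// invr_le0 ltW.
have t20 : 0 <= t2 by rewrite /t2 divr_ge0; lra.
apply: (shear_step p_gt0 sK t10 t20).
- apply: (remove (0, 0) t1 m1 m1L _ (1, 0)) => //.
    have := fin _ a3 => q; rewrite /mix /t1 /=; congr pair; field => //.
    by apply/andP; split; [exact: q|exact: na3].
  move=> w wL; have [w1 w2 w3] := hL _ wL; have nw3 : w.2 != 0 by rewrite lt_eqF.
  have tw : t1 * w.2 <= w.1.
    by have := hm1 _ wL; rewrite lerN2 /t1 ler_ndivrMr.
  have tw0 : 0 <= t1 * w.2 by rewrite mulr_le0// ltW.
  by split; [exact: ltW|rewrite subr_ge0|lra].
- apply: (remove (1, 0) t2 m2 m2L _ (0, 0)) => //.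
  - have := fin _ b3 => q; rewrite /mix /t2 /=; congr pair; field => //.
    by apply/andP; split; [exact: q|exact: nb3].
  - by move=> x; rewrite !inE orbC.
  move=> w wL; have [w1 w2 w3] := hL _ wL; have nw3 : w.2 != 0 by rewrite lt_eqF.
  have tw : t2 * (- w.2) <= 1 - w.2 - w.1.
    by have := hm2 _ wL; rewrite -/t2 ler_pdivlMr// oppr_gt0.
  have tw0 : 0 <= t2 * (- w.2) by rewrite mulr_ge0// oppr_ge0 ltW.
  by split; [exact: ltW| |]; rewrite mulrN in tw tw0; lra.
Qed.

(** A point of L on or above the axis lies in the triangle of the first three
    points and can be dropped. *)
Lemma normalized_step n L : polygon_above n -> (size L + 2 <= n)%N ->
  (forall w, w \in L -> 0 <= w.1 /\ w.1 + w.2 <= 1) ->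
  above_triangle (hull ((0, 1) :: axis_segment ++ L)).
Proof.
move=> IH sz hL.
have [/hasP[w wL w2]|/hasPn neg] := boolP (has (fun w => 0 <= w.2) L); last first.
  have [L0|L0] := eqVneq L [::]; first by rewrite L0; exact: above_unit.
  apply: (shear_until_collinear IH L0 sz) => w wL; have [w1 w2] := hL w wL.
  by split => //; rewrite ltNge; exact: neg.
set M := (0, 1) :: axis_segment ++ rem w L.
have E : hull ((0, 1) :: axis_segment ++ L) = hull M.
  transitivity (hull (w :: M)).
    apply: eq_hull => x; rewrite !inE (perm_mem (perm_to_rem wL)) inE.
    by case: (x == w); rewrite /= ?orbT.
  apply: hull_remove; have [w1 w3] := hL w wL.
  apply: (@hull_sub _ [:: (0, 1); (0, 0); (1, 0)]).
    by move=> v; rewrite !inE => /or3P[] /eqP ->; apply: hull_mem; rewrite !inE eqxx ?orbT.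
  rewrite -triangle_hull; exists w.2, (1 - w.1 - w.2), w.1.
  split => //; [lra|lra|].
  by rewrite /= [LHS]surjective_pairing; congr pair; ring.
rewrite E; apply: IH.
  by rewrite /= size_rem//; case: L wL sz {hL E M} => // ? ? _; rewrite addn2.
suff [_ _] : solid (hull M) by exact.
by apply: solid_over_unit => v; rewrite !inE => /or3P[] ->; rewrite ?orbT.
Qed.

(** Seen from the lexicographically least point v, all points lie between two
    extreme directions, those of a and b. The affine map sending v, a and b to
    (0, 1), (0, 0) and (1, 0) sends the other points into the angle spanned by the
    axis segment at (0, 1). *)
Lemma induction_step n : polygon_above n -> polygon_above n.+1.
Proof.
move=> IH s sz pos; have sK := hull_solid pos.
case: s sz pos sK => [|u s']; first by rewrite hull_nil measure0 ltxx.
set s := u :: s' => sz pos sK.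
have [v vs hv] : exists2 v, v \in s & forall x, x \in s -> lex_le v x.
  by apply: list_least => [x y _ _|y x z _ _ _]; [exact: lex_total|exact: lex_trans].
pose L0 := [seq x <- s | x != v].
have L0s x : x \in L0 -> x != v /\ lex_le v x.
  by rewrite mem_filter => /andP[/= h /hv].
have sL0 : (size L0 < size s)%N.
  rewrite size_filter ltn_neqAle count_size andbT -all_count.
  by apply/allPn; exists v => //=; rewrite eqxx.
have sE : hull s = hull (v :: L0).
  apply: eq_hull => x; rewrite inE mem_filter /=.
  by case: eqVneq => [->|].
have flat (x : R * R) : (forall y, y \in L0 -> cross v x y = 0) -> x = v.
  move=> hx; apply/eqP/negPn/negP => xv.
  have := @solid_not_flat _ _ (- (x.2 - v.2)) (x.1 - v.1)
    (- (x.2 - v.2) * v.1 + (x.1 - v.1) * v.2) sK.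
  apply.
    apply: contra xv; rewrite xpair_eqE oppr_eq0 !subr_eq0 => /andP[/eqP e2 /eqP e1].
    by apply/eqP; rewrite [LHS]surjective_pairing e1 e2 -surjective_pairing.
  move=> y; rewrite sE; move: y; apply: hull_min.
    move=> y z l hy hz _; rewrite /mix /=.
    move: hy hz; set A := - _; set B := x.1 - v.1 => hy hz.
    transitivity ((1 - l) * (A * y.1 + B * y.2) + l * (A * z.1 + B * z.2)); first by ring.
    by rewrite hy hz; ring.
  move=> y; rewrite inE => /predU1P[->//|/hx]; rewrite /cross => h.
  apply/eqP; rewrite -subr_eq0 -h; apply/eqP; ring.
case L0E : L0 => [|u0 L0'].
  have := flat (v.1 + 1, v.2); rewrite L0E => /(_ (fun _ => ltac:(by []))) /(congr1 fst) /=.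
  by move=> /eqP; rewrite -subr_eq0 addrAC subrr add0r oner_eq0.
have ctr : {in L0 & &, transitive (fun x y => 0 <= cross v x y)}.
  by move=> y x z /L0s[y1 y2] /L0s[x1 x2] /L0s[z1 z2]; exact: cross_trans.
have ctot x y : (0 <= cross v x y) || (0 <= cross v y x).
  by rewrite [cross v y x]crossC oppr_ge0 le_total.
have [a aL ha] : exists2 a, a \in L0 & forall x, x \in L0 -> 0 <= cross v a x.
  move: ctr; rewrite L0E => tr.
  by apply: (list_least (le := fun x y => 0 <= cross v x y)) tr => x y _ _; exact: ctot.
have [b bL hb] : exists2 b, b \in L0 & forall x, x \in L0 -> 0 <= cross v x b.
  move: ctr; rewrite L0E => tr.
  apply: (list_least (le := fun x y => 0 <= cross v y x)) => [x y _ _|y x z hy hx hz h1 h2].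
    exact: ctot.
  exact: (tr y z x).
pose D := cross v a b.
have Dp : 0 < D.
  rewrite lt0r ha// andbT; apply/eqP => D0.
  have [/eqP bv _] := L0s _ bL; apply: bv; apply: flat => x xL.
  apply/eqP; rewrite eq_le [cross v b x]crossC oppr_le0 hb//= -crossC.
  by apply: (ctr a) => //; [rewrite crossC -/D D0 oppr0|exact: ha].
have ab : b != a.
  by apply: contraTneq Dp => e; rewrite /D e /cross [X in _ - X]mulrC subrr ltxx.
have bL' : b \in rem a L0.
  by have := perm_mem (perm_to_rem aL) b; rewrite bL inE (negbTE ab) => /esym.
pose L := rem b (rem a L0).
have sE' : hull s = hull (v :: a :: b :: L).
  rewrite sE; apply: eq_hull => x; rewrite !inE (perm_mem (perm_to_rem aL)) inE.
  by rewrite (perm_mem (perm_to_rem bL')) inE.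
have Ln : (size L + 2 <= n)%N.
  rewrite !size_rem//; move: sL0 sz; rewrite L0E /=.
  case: L0' L0E => [E|? ? _ /=]; last by rewrite addn2; exact: leq_trans.
  by move: aL bL ab; rewrite E !inE => /eqP -> /eqP ->; rewrite eqxx.
have LL0 x : x \in L -> x \in L0 by move=> /mem_rem /mem_rem.
(* The coordinates of the image are built from the barycentric coordinates
   cross v a x / D and cross v x b / D of x along b and along a. *)
pose e := ((a.2 - v.2) * v.1 - (a.1 - v.1) * v.2) / D.
pose f := 1 + ((b.2 - a.2) * v.1 - (b.1 - a.1) * v.2) / D.
pose g := affine (- (a.2 - v.2) / D) ((a.1 - v.1) / D) (- (b.2 - a.2) / D) ((b.1 - a.1) / D) e f.
have Dn : D != 0 by rewrite gt_eqF.
have gE x : g x = (cross v a x / D, 1 - cross v x b / D - cross v a x / D).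
  by rewrite /g /affine /e /f /cross /=; congr pair; field.
have cxx x : cross v x x = 0 by rewrite /cross; ring.
have cvl x : cross v v x = 0 by rewrite /cross; ring.
have cvr x : cross v x v = 0 by rewrite /cross; ring.
have D0 : (- (a.2 - v.2) / D) * ((b.1 - a.1) / D) - ((a.1 - v.1) / D) * (- (b.2 - a.2) / D) != 0.
  have -> : (- (a.2 - v.2) / D) * ((b.1 - a.1) / D) - ((a.1 - v.1) / D) * (- (b.2 - a.2) / D)
     = cross v a b / D / D.
    by rewrite /cross; field.
  by rewrite -/D divff// mul1r invr_eq0.
apply: (above_affine (e := e) (f := f) sK D0); rewrite sE' hull_affine -/g /=.
have -> : g v = (0, 1) by rewrite gE cvr cvl mul0r !subr0.
have -> : g a = (0, 0) by rewrite gE cxx -/D divff// mul0r !subrr.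
have -> : g b = (1, 0) by rewrite gE cxx -/D divff// mul0r subr0 subrr.
apply: (normalized_step (L := map g L) IH); first by rewrite size_map.
move=> _ /mapP[x /LL0 xL ->]; rewrite gE /=.
split; first by rewrite divr_ge0 ?ha ?ltW.
by rewrite addrC subrK gerBl divr_ge0 ?hb ?ltW.
Qed.

Lemma above_triangle_hull s : (0 < mu2 (hull s))%E -> above_triangle (hull s).
Proof.
move=> pos; suff H n : polygon_above n by exact: (H (size s)).
elim: n => [|n]; last exact: induction_step.
by move=> [|//] _; rewrite hull_nil measure0 ltxx.
Qed.

End polygons.

(** * Approximation by polygons from outside *)

Section outer_polygon.
Context {R : realType}.
Implicit Types (K : set (R * R)) (x y z w : R * R).

Lemma convex_set_convex K : convex_set (K : set (R^o * R^o)%type) -> convex K.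
Proof.
move=> cK x y l Kx Ky /andP[l0 l1].
have := cK y x (Itv01 l0 l1); rewrite !inE => /(_ Ky Kx).
rewrite (_ : mix l x y = (l * y.1 + (1 - l) * x.1, l * y.2 + (1 - l) * x.2)) //.
by rewrite /mix addrC [X in (_, X)]addrC.
Qed.

Lemma compact_cover_compact K : compact K -> cover_compact K.
Proof.
move=> cK; pose T : ptopologicalType := HB.pack (R * R)%type.
suff : @cover_compact T K by exact.
by rewrite -compact_cover.
Qed.

Definition corners x (r : R) : seq (R * R) :=
  [:: (x.1 - r, x.2 - r); (x.1 - r, x.2 + r); (x.1 + r, x.2 - r); (x.1 + r, x.2 + r)].

Lemma box_hull_corners x (r : R) : 0 < r -> box x r `<=` hull (corners x r).
Proof.
move=> r0 y; rewrite /box /= !ltr_distlC => -[/andP[y11 y12] /andP[y21 y22]].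
pose l := (y.1 - x.1 + r) / (r + r); pose m := (y.2 - x.2 + r) / (r + r).
have unit01 (u c : R) : c - r < u -> u < c + r -> 0 <= (u - c + r) / (r + r) <= 1.
  move=> h k; have rr : 0 < r + r by rewrite addr_gt0.
  by rewrite divr_ge0 ?(ltW rr)//= ?ler_pdivrMr//; lra.
have l01 : 0 <= l <= 1 by exact: unit01.
have m01 : 0 <= m <= 1 by exact: unit01.
have cnr i : (i < 4)%N -> hull (corners x r) (nth (0, 0) (corners x r) i).
  by move=> i4; apply: hull_mem; apply: mem_nth.
have low := hull_convex (cnr 0 isT) (cnr 2 isT) l01.
have up := hull_convex (cnr 1 isT) (cnr 3 isT) l01.
have := hull_convex low up m01; congr (hull _ _).
have rr2 : r + r != 0 by rewrite gt_eqF// addr_gt0.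
rewrite [RHS]surjective_pairing /mix /l /m /=.
by congr pair; field; rewrite ?r2 ?rr2.
Qed.

Definition dilation (t : R) z := affine t 0 0 t (- ((t - 1) * z.1)) (- ((t - 1) * z.2)).

(** A point y near x is, up to the dilation, the combination of x with the point of
    the box at z in direction y - x. *)
Lemma box_dilation K z (r d : R) x : convex K -> 0 < d -> box z r `<=` K -> K x ->
  box x (d * r) `<=` dilation (1 + d) z @` K.
Proof.
move=> cK d0 zK Kx y [y1 y2].
pose w : R * R := (z.1 + (y.1 - x.1) / d, z.2 + (y.2 - x.2) / d).
have dn : d != 0 by rewrite gt_eqF.
have d1 : 1 + d != 0 by rewrite gt_eqF// addr_gt0.
have Kw : K w.
  have near (a b c : R) : `|a - b| < d * r -> `|c - (c + (b - a) / d)| < r.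
    move=> h; rewrite opprD addrA subrr add0r normrN normrM [X in _ * X]normfV.
    by rewrite (gtr0_norm d0) ltr_pdivrMr// distrC mulrC.
  by apply: zK; split; apply: near.
exists (mix (d / (1 + d)) x w).
  apply: (cK x w _ Kx Kw); have dd : 0 < 1 + d by rewrite addr_gt0.
  rewrite divr_ge0 ?(ltW d0) ?(ltW dd)//=.
  by rewrite ler_pdivrMr ?addr_gt0// mul1r lerDr.
rewrite [RHS]surjective_pairing /dilation /affine /mix /w /=.
by congr pair; field; rewrite dn d1.
Qed.

(** Finitely many boxes around points of K cover K, and the corners of these
    boxes lie in a slightly dilated copy of K. *)
Lemma outer_polygon K z (r d : R) : compact K -> convex K -> 0 < r ->
  box z r `<=` K -> 0 < d ->
  exists s, K `<=` hull s /\ hull s `<=` dilation (1 + d) z @` K.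
Proof.
move=> cK vK r0 zK d0; pose e := d * r / 2.
have e0 : 0 < e by rewrite divr_gt0// mulr_gt0.
have [||] := compact_cover_compact cK (I := (R * R)%type) (D := K) (f := fun x => (box x e)°).
- by move=> x _; exact: open_interior.
- by move=> x Kx; exists x => //; rewrite box_ball; exact: nbhsx_ballx.
move=> D DK KD; exists (flatten [seq corners x e | x <- finmap.enum_fset D]); split.
  move=> y /KD[x xD /interior_subset /(box_hull_corners e0)].
  apply: hull_sub => v vx; apply: hull_mem; apply/flattenP.
  by exists (corners x e) => //; apply: map_f.
apply: hull_min; first exact: convex_affine_image.
move=> v /flattenP[_ /mapP[x xD ->] vx].
have Kx : K x by have := DK x xD; rewrite inE.
apply: (box_dilation vK d0 zK Kx).
have near (a : R) : `|a - (a - e)| < d * r /\ `|a - (a + e)| < d * r.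
  rewrite subKr opprD addrA subrr add0r normrN (gtr0_norm e0) /e.
  by have : 0 < d * r by [rewrite mulr_gt0]; split; lra.
have [n1 p1] := near x.1; have [n2 p2] := near x.2.
by move: vx; rewrite !inE => /or4P[] /eqP ->.
Qed.

Lemma lee_mul_gt1 (b m : \bar R) : (0 <= m)%E ->
  (forall t : R, 1 < t -> (b <= t%:E * m)%E) -> (b <= m)%E.
Proof.
case: m => [m| |] // m0 h; last by rewrite leey.
rewrite lee_fin in m0.
apply/lee_addgt0Pr => e e0.
have m1 : 0 < m + 1 by rewrite ltr_pwDr.
apply: le_trans (h (1 + e / (m + 1)) _) _; first by rewrite ltrDl divr_gt0.
rewrite -EFinM -EFinD lee_fin mulrDl mul1r lerD2l.
by rewrite mulrAC ler_pdivrMr// ler_wpM2l ?(ltW e0)// lerDl.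
Qed.

End outer_polygon.

Lemma dilation_volume_factor {R : realType} (p : R) (K P : set (R * R)) z (c : R) :
  0 < p -> solid K -> solid P -> P `<=` dilation (expR c) z @` K ->
  volume_factor p P <= expR (2 * c * (1 + p^-1)) * volume_factor p K.
Proof.
move=> p0 sK sP PK.
have q0 : 0 < expR c by exact: expR_gt0.
have D0 : expR c * expR c - 0 * 0 != 0 by rewrite mul0r subr0 mulf_neq0 ?gt_eqF.
have sD := affine_solid (- ((expR c - 1) * z.1)) (- ((expR c - 1) * z.2)) sK D0.
have aD := affine_area (- ((expR c - 1) * z.1)) (- ((expR c - 1) * z.2)) sK D0.
rewrite -/(dilation _ _) in sD aD.
have aP : area P <= expR (2 * c) * area K.
  have -> : expR (2 * c) = `|expR c * expR c - 0 * 0|.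
    by rewrite mul0r subr0 ger0_norm ?mulr_ge0 ?ltW// -expRD mulr2n mulrDl mul1r.
  rewrite -aD -lee_fin -!areaE//.
  by apply: le_measure; rewrite ?inE//; [case: sP|case: sD].
have aK0 := area_gt0 sK; have aP0 := area_gt0 sP.
rewrite /volume_factor mulrDr mulr1 expRD mulrACA.
apply: ler_pM; [exact: ltW|exact: expR_ge0|exact: aP|].
rewrite -expRD ler_expR [2 * c * _]mulrC -mulrDr ler_wpM2l ?invr_ge0 ?(ltW p0)//.
rewrite -[2 * c]expRK -lnM ?posrE ?expR_gt0// ler_ln ?posrE ?mulr_gt0 ?expR_gt0//.
Qed.

Theorem theorem1p10 (R : realType) (p : R) (p_gt0 : 0 < p)
    (K : set (R * R)) (bodyK : convex_body K) :
  (ereal_inf [set Lp_mahler p (shift_by_opp (Delta20 R) x) | x in Delta20 R]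
     <= Lp_mahler p K)%E.
Proof.
have [cK /convex_set_convex vK [z Kz]] := bodyK.
apply: (@le_trans _ _ (Lp_mahler p (Delta20 R))).
  apply: ereal_inf_lbound; exists (0, 0); first exact: Delta20_origin.
  congr (Lp_mahler p _); rewrite /shift_by_opp.
  by rewrite -[RHS]image_id; apply: eq_imagel => x _; exact: subr0.
have [r r0 zrK] : exists2 r, 0 < r & box z r `<=` K.
  have [r r0 h] := open_box (@open_interior _ K) Kz.
  by exists r => //; exact: subset_trans h (@interior_subset _ K).
have sK : solid K := box_solid cK r0 zrK.
apply: lee_mul_gt1.
  rewrite Lp_mahlerE//; apply: mule_ge0; last exact: map_integral_ge0.
  by rewrite lee_fin ltW// volume_factor_gt0.
move=> t t1; pose c := ln t / (2 * (1 + p^-1)).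
have k0 : 0 < 1 + p^-1 by rewrite addr_gt0// invr_gt0.
have c0 : 0 < c by rewrite divr_gt0 ?ln_gt0// mulr_gt0.
have d0 : 0 < expR c - 1 by rewrite subr_gt0 expR_gt1.
have [s [Ks sK']] := outer_polygon cK vK r0 zrK d0.
rewrite addrC subrK in sK'.
have sP : solid (hull s) := box_solid (@compact_hull _ s) r0 (subset_trans zrK Ks).
have [_ _ P0] := sP.
apply: (@le_trans _ _ (Lp_mahler p (hull s))).
  rewrite -(translated_mahler0 p sP); exact: (above_triangle_hull p_gt0 P0).
apply: le_trans (Lp_mahler_outer p_gt0 sK sP Ks) _.
apply: lee_wpmul2r.
  rewrite Lp_mahlerE//; apply: mule_ge0; last exact: map_integral_ge0.
  by rewrite lee_fin ltW// volume_factor_gt0.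
rewrite lee_fin ler_pdivrMr ?volume_factor_gt0//.
have := dilation_volume_factor p_gt0 sK sP sK'.
have -> // : expR (2 * c * (1 + p^-1)) = t.
rewrite /c -[RHS]lnK ?posrE ?(lt_trans ltr01)//; congr expR.
by move: k0 (ln t); clear; move: (1 + p^-1) => k k0 l; field; rewrite gt_eqF.
Qed.
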